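(* \textsc{AllTargets} can be solved in time $O(a_n^{3/2}\log^{1/2} a_n)$.
   Context: Instances consist of integers $1\le a_0<a_1<\dots<a_n$ with $\gcd(a_0,\dots,a_n)=1$. A nonnegative integer $t$ is feasible if there is $x\in\mathbb{Z}_{\ge 0}^{n+1}$ with $a_0x_0+\dots+a_nx_n=t$. \textsc{AllTargets}: given $a_0,\dots,a_n$, compute $a[0],\dots,a[a_0-1]$ where $a[i]=\min\{t\in\mathbb{Z}_{\ge0}: t\equiv i \pmod{a_0},\ t \text{ feasible}\}$. *)

(* Defs.v *)
From mathcomp Require Import all_boot.
Set Implicit Arguments. Unset Strict Implicit. Unset Printing Implicit Defensive.

Definition instance (n : nat) (a : nat -> nat) : Prop :=
  [/\ 1 <= a 0,
      (forall i, i < n -> a i < a i.+1)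
    & \big[gcdn/0]_(i < n.+1) a i = 1].

Definition feasible (n : nat) (a : nat -> nat) (t : nat) : Prop :=
  exists x : nat -> nat, \sum_(i < n.+1) a i * x i = t.

Definition is_target (n : nat) (a : nat -> nat) (i v : nat) : Prop :=
  [/\ v = i %[mod a 0], feasible n a v
    & forall t, t = i %[mod a 0] -> feasible n a t -> v <= t].

(* Registers r_0, r_1, ... and memory M : nat -> nat hold natural numbers.
   All values produced and all addresses used must be < W (the word bound);
   otherwise the machine crashes.  Subtraction is truncated. *)
Inductive instr : Type :=
| IConst of nat & nat        (* IConst d k   : r_d := k                 *)
| IAdd of nat & nat & nat    (* IAdd d s t   : r_d := r_s + r_t         *)
| ISub of nat & nat & nat    (* r_d := r_s - r_t (truncated)            *)
| IMul of nat & nat & nat    (* r_d := r_s * r_t                        *)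
| IDiv of nat & nat & nat    (* r_d := r_s / r_t  (crash if r_t = 0)    *)
| IMod of nat & nat & nat    (* r_d := r_s mod r_t (crash if r_t = 0)   *)
| ILoad of nat & nat         (* ILoad d s  : r_d := M[r_s]              *)
| IStore of nat & nat        (* IStore d s : M[r_d] := r_s              *)
| IJlt of nat & nat & nat    (* IJlt s t l : if r_s < r_t then pc := l  *)
| IJmp of nat                (* pc := l                                 *)
| IHalt.

Record state : Type := State { pc : nat; regs : nat -> nat; mem : nat -> nat }.

Inductive outcome : Type := Running of state | Halted of state | Crash.

Definition upd (f : nat -> nat) (k v : nat) : nat -> nat :=
  fun j => if j == k then v else f j.

Definition step (W : nat) (P : seq instr) (s : state) : outcome :=
  let r := regs s in
  let next := (pc s).+1 in
  let setr d v :=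
      if v < W then Running (State next (upd r d v) (mem s)) else Crash in
  if pc s < size P then
    match nth IHalt P (pc s) with
    | IConst d k => setr d k
    | IAdd d x y => setr d (r x + r y)
    | ISub d x y => setr d (r x - r y)
    | IMul d x y => setr d (r x * r y)
    | IDiv d x y => if r y == 0 then Crash else setr d (r x %/ r y)
    | IMod d x y => if r y == 0 then Crash else setr d (r x %% r y)
    | ILoad d x => if r x < W then setr d (mem s (r x)) else Crash
    | IStore d x => if r d < W then Running (State next r (upd (mem s) (r d) (r x)))
                    else Crash
    | IJlt x y l => Running (State (if r x < r y then l else next) r (mem s))
    | IJmp l => Running (State l r (mem s))
    | IHalt => Halted s
    end
  else Crash.

Fixpoint exec (W : nat) (P : seq instr) (T : nat) (s : state) : option state :=
  match T with
  | 0 => None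
  | T'.+1 => match step W P s with
             | Running s' => exec W P T' s'
             | Halted s' => Some s'
             | Crash => None
             end
  end.

(* Input encoding: M[0] = n, M[1+i] = a_i for i <= n, all else 0. *)
Definition init_state (n : nat) (a : nat -> nat) : state :=
  State 0 (fun _ => 0)
        (fun j => if j == 0 then n else if j <= n.+1 then a j.-1 else 0).

(* Output convention: on halting, r_0 = p and M[p + i] = a[i] for i < a_0. *)
Definition solves_AllTargets (n : nat) (a : nat -> nat) (s : state) : Prop :=
  forall i, i < a 0 -> is_target n a i (mem s (regs s 0 + i)).

(* Main.v *)
Require Import Defs.
From mathcomp Require Import all_boot all_order all_algebra algC zify ring.
Set Implicit Arguments. Unset Strict Implicit. Unset Printing Implicit Defensive.
Import Order.TTheory GRing.Theory Num.Theory.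

(* Let m = a_n.  By an isoperimetric inequality for sumsets in a cyclic group, every
   t >= m * floor(2m / (n+1)) is feasible, so a[0], ..., a[a_0 - 1] are at most
   B = O(m^2 / n).  Two algorithms compete.  Adding the generators one at a time and
   walking around the cycles of +a_i in Z/a_0 costs O(n a_0) steps.  Alternatively, the
   set S_L of feasible integers below L determines S_{2L} as the part below 2L of
   S_L + S_L + {0, a_0, ..., a_n}, which is the support of a convolution; convolving with
   a fast Fourier transform and doubling L up to B costs O(B log m).  Choosing the first
   algorithm when n^2 <= m log m and the second one otherwise gives
   O(m^{3/2} log^{1/2} m).  The transform is computed in fixed point with O(log m) bits,
   with all rounding errors bounded against the exact transform over the algebraic
   numbers; signed values are represented modulo the bound V on register contents. *)

(** * Sumsets and the largest infeasible integer *)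

(** The summand {0, a_0, ..., a_n} is needed because a feasible t in [L, 2L) need not be a sum of
    two feasible integers below L: when its parts are added up one at a time, one part carries the
    partial sum across L, and what remains on either side of that part is below L. Only the support
    of the convolution matters, so 0 has to be told from 1. The data are scaled by D: a nonzero
    count yields at least N D^3 after the inverse transform of length N, while the error grows only
    like D^2 times a power of N. The roots of unity come from iterated square roots of i, each
    multiplying the error by about 8; logarithmically many of them lose a polynomial factor, that is
    O(log m) bits. The machine crashes on overflow and cannot read its word bound. A structured
    language with total operations separates this from the algorithms: V and the array length Bg are
    computed as powers of a_n + 2, all values stay below V, and one compiler proof excludes crashes
    and counts instructions. The costs n m and (m^2 / n) log m of the two algorithms balance at n^2
    = m log m. *)

Section Sumset.
Local Open Scope ring_scope.
Variable G : finZmodType.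
Implicit Types X Y A M : {set G}.

Definition sumset X Y : {set G} := [set x + y | x in X, y in Y].

Lemma mem_sumset X Y x y : x \in X -> y \in Y -> x + y \in sumset X Y.
Proof. by move=> Xx Yy; apply/imset2P; exists x y. Qed.

Lemma sumsetP X Y z :
  reflect (exists x y, [/\ x \in X, y \in Y & z = x + y]) (z \in sumset X Y).
Proof.
apply: (iffP imset2P) => [[x y Xx Yy ->]|[x [y [Xx Yy ->]]]]; first by exists x, y.
by exists x y.
Qed.

Lemma sumsetSl X X' Y : X \subset X' -> sumset X Y \subset sumset X' Y.
Proof. by move=> sX; apply: imset2S. Qed.

Lemma sumsetUl X X' Y : sumset (X :|: X') Y = sumset X Y :|: sumset X' Y.
Proof.
apply/setP => z; rewrite inE; apply/idP/idP.
  case/sumsetP => x [y [/setUP[]Xx Yy ->]]; by rewrite (mem_sumset Xx Yy) ?orbT.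
by case/orP; apply/subsetP/sumsetSl; [apply: subsetUl | apply: subsetUr].
Qed.

Definition shift g X : {set G} := [set x + g | x in X].

Lemma mem_shift g X x : (x \in shift g X) = (x - g \in X).
Proof.
apply/imsetP/idP => [[y Xy ->]|Xx]; first by rewrite addrK.
by exists (x - g); rewrite ?subrK.
Qed.

(* All cardinals go through this constant so that [lia] identifies them. *)
Definition sz X : nat := #|X|.

Lemma sz_sub X Y : X \subset Y -> (sz X <= sz Y)%N.
Proof. exact: subset_leq_card. Qed.

Lemma sz_max X : (sz X <= sz setT)%N.
Proof. exact/sz_sub/subsetT. Qed.

Lemma sz_gt0 X : (0 < sz X)%N = (X != set0).
Proof. exact: card_gt0. Qed.

Lemma szUI X Y : (sz (X :|: Y) + sz (X :&: Y) = sz X + sz Y)%N.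
Proof. exact: cardsUI. Qed.

Lemma szC X : (sz X + sz (~: X) = sz setT)%N.
Proof. by rewrite /sz cardsT cardsC. Qed.

Lemma sz_eqT X : (X == setT) = (sz setT <= sz X)%N.
Proof. by rewrite eqEcard subsetT. Qed.

Lemma sz_opp X : sz [set - x | x in X] = sz X.
Proof. by apply: card_imset; apply: oppr_inj. Qed.

Lemma sz_shift g X : sz (shift g X) = sz X.
Proof. by apply: card_imset; apply: addIr. Qed.

Lemma sumset_shift g X Y : sumset (shift g X) Y = shift g (sumset X Y).
Proof.
apply/setP => z; rewrite mem_shift; apply/sumsetP/sumsetP => -[x [y [Xx Yy e]]].
  by exists (x - g), y; rewrite -mem_shift Xx Yy e addrAC.
exists (x + g), y; rewrite mem_shift addrK Xx Yy; split => //.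
by rewrite addrAC -e subrK.
Qed.

Variable A : {set G}.
Hypothesis A0 : 0 \in A.

Lemma sub_sumset X : X \subset sumset X A.
Proof. by apply/subsetP => x Xx; rewrite -[x]addr0 mem_sumset. Qed.

(** Hamidoune's isoperimetric method: a set of least boundary among the nonempty X with X + A not
    everything, and of least size among these, is an atom. *)
Definition boundary X := (sz (sumset X A) - sz X)%N.
Definition proper_fragment X := (X != set0) && (sumset X A != setT).

Lemma boundaryE X : sz (sumset X A) = (sz X + boundary X)%N.
Proof. by rewrite /boundary subnKC // sz_sub // sub_sumset. Qed.

(** Generation is stated through sets containing 0 and closed under subtraction, which are the
    subgroups; no group structure has to be built on an atom. *)
Hypothesis A_gen : forall H : {set G}, 0 \in H ->
  (forall x y, x \in H -> y \in H -> x - y \in H) -> A \subset H -> H = setT.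

Section Atom.
Variable M : {set G}.
Hypothesis M_proper : proper_fragment M.
Hypothesis M_min : forall X, proper_fragment X ->
  (boundary M <= boundary X)%N /\ (boundary X = boundary M -> sz M <= sz X)%N.

(* The complement of M + A, negated, is again a fragment of the same boundary. *)
Lemma atom_room : (sz M + sz M + boundary M <= sz setT)%N.
Proof.
pose Y := [set - z | z in ~: sumset M A].
have cY : (sz Y + sz (sumset M A) = sz setT)%N by rewrite sz_opp addnC szC.
have [M0 MT] := andP M_proper.
have sMG : (sz (sumset M A) < sz setT)%N by rewrite ltnNge -sz_eqT.
have M1 : (0 < sz M)%N by rewrite sz_gt0.
(* Y + A misses -M, since -z + a = -x with x in M would put z = x + a into M + A. Hence the boundary
   of Y is at most that of M, and minimality gives |M| <= |Y|. *)
have YA : (sz (sumset Y A) + sz M <= sz setT)%N.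
  rewrite -(sz_opp M) -(szC [set - x | x in M]) addnC leq_add2l.
  apply/sz_sub/subsetP => w /sumsetP[y [a [/imsetP[z zN ->] Aa ->]]].
  rewrite inE; apply/negP => /imsetP[x Mx e]; move: zN; rewrite inE => /negP; apply.
  suff -> : z = x + a by apply: mem_sumset.
  by apply: oppr_inj; rewrite opprD -e addrK.
have Yprop : proper_fragment Y.
  by rewrite /proper_fragment -sz_gt0 sz_eqT; lia.
have := M_min Yprop; have := boundaryE Y; have := boundaryE M.
lia.
Qed.

(** The map X -> |X + A| is submodular, applied here to M and its translate. [atom_room] makes their
    union U a proper fragment, so neither U nor the intersection I has a smaller boundary than M;
    hence I has the same boundary, and minimality of size gives I = M. *)
Lemma shift_atom g : M :&: shift g M != set0 -> shift g M = M.
Proof.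
move=> I0; set I := M :&: _ in I0 *; set U := M :|: shift g M.
have [_ MT] := andP M_proper.
have IM : I \subset M by apply: subsetIl.
have Iprop : proper_fragment I.
  rewrite /proper_fragment I0 /=; apply: contraNneq MT => e.
  by rewrite -subTset -e sumsetSl.
have cU : (sz U + sz I = sz M + sz M)%N by rewrite szUI sz_shift.
have cUA : (sz (sumset U A) + sz (sumset I A) <= sz (sumset M A) + sz (sumset M A))%N.
  rewrite sumsetUl sumset_shift -{2}(sz_shift g (sumset M A)) -(szUI (sumset M A)) leq_add2l.
  apply: sz_sub; rewrite subsetI sumsetSl //= -sumset_shift sumsetSl //.
  exact: subsetIr.
have I1 : (0 < sz I)%N by rewrite sz_gt0.
have room := atom_room.
have [bI eI] := M_min Iprop.
have bM := boundaryE M; have bIe := boundaryE I; have bU := boundaryE U.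
have IMs := sz_sub IM.
have Uprop : proper_fragment U.
  by rewrite /proper_fragment -sz_gt0 sz_eqT; lia.
have [bbU _] := M_min Uprop.
have MI : (sz M <= sz I)%N by apply: eI; lia.
have IeM : I = M by apply/eqP; rewrite eqEcard IM; exact: MI.
apply/esym/eqP; rewrite eqEcard -{1}IeM subsetIr; apply: eq_leq.
exact: sz_shift.
Qed.

(** Distinct translates of M are disjoint, so the translate H through 0 is a subgroup. As A is not
    contained in H, the set H + A contains two cosets of H; the boundary is thus at least half of |H
    + A|, which is at least |A|. *)
Lemma atom_bound : (sz A <= 2 * boundary M)%N.
Proof.
have [/set0Pn[x0 Mx0] MT] := andP M_proper.
pose H := shift (- x0) M.
have H0 : 0 \in H by rewrite mem_shift sub0r opprK.
have HN g : g \in H -> shift (- g) H = H.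
  have shs g' h : shift g' (shift h M) = shift (h + g') M.
    by apply/setP => z; rewrite !mem_shift opprD addrA addrAC.
  rewrite mem_shift opprK => Hg; rewrite /H shs.
  have := @shift_atom (- g); rewrite addrC -shs => -> //.
  apply/set0Pn; exists x0; by rewrite inE Mx0 mem_shift opprK addrC.
have Hsub x y : x \in H -> y \in H -> x - y \in H.
  by move=> Hx Hy; rewrite -(HN _ Hy) mem_shift opprK subrK.
have cH : sz H = sz M by rewrite sz_shift.
have cHA : sz (sumset H A) = sz (sumset M A) by rewrite sumset_shift sz_shift.
have /subsetPn[a Aa Ha] : ~~ (A \subset H).
  apply/negP => /(A_gen H0 Hsub) e; case/negP: MT.
  by rewrite sz_eqT -cHA -e sz_sub // sub_sumset.
have A_HA : (sz A <= sz (sumset H A))%N.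
  by apply/sz_sub/subsetP => b Ab; rewrite -[b]add0r mem_sumset.
have HH : (sz H + sz H <= sz (sumset H A))%N.
  rewrite -{2}(sz_shift a H) -szUI.
  have -> : H :&: shift a H = set0.
    apply/setP => z; rewrite !inE mem_shift; apply/negP => /andP[Hz Hza].
    by case/negP: Ha; rewrite -(subKr z a) Hsub.
  rewrite [sz set0]cards0 addn0; apply/sz_sub/subsetP => z /setUP[Hz|].
    exact: (subsetP (sub_sumset H)).
  by rewrite mem_shift => Hz; rewrite -(subrK a z) mem_sumset.
have := boundaryE M; lia.
Qed.
End Atom.

Lemma sumset_growth X : X != set0 ->
  (minn (2 * sz setT) (2 * sz X + sz A) <= 2 * sz (sumset X A))%N.
Proof.
move=> X0; have [->|XT] := eqVneq (sumset X A) setT; first exact: geq_minl.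
have Xp : proper_fragment X by rewrite /proper_fragment X0.
(* Lexicographic order in one number: sizes are at most |G|, so the factor |G| + 1 makes the
   boundary dominate. *)
pose f (Y : {set G}) := (boundary Y * (sz setT).+1 + sz Y)%N.
case: (arg_minnP f Xp) => M Mp Mmin.
have Mm Y : proper_fragment Y ->
    (boundary M <= boundary Y)%N /\ (boundary Y = boundary M -> sz M <= sz Y)%N.
  move=> Yp; have := Mmin Y Yp; rewrite /f; have := sz_max Y.
  move: (boundary M) (boundary Y) (sz setT) (sz M) (sz Y) => bM bY t sM sY leY le.
  split=> [|e]; last by move: le; rewrite e leq_add2l.
  rewrite leqNgt; apply/negP => lt; have := leq_mul lt (leqnn t.+1); lia.
have [bX _] := Mm X Xp; have := atom_bound Mp Mm; have := boundaryE X.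
lia.
Qed.
End Sumset.

(** * Feasible integers *)

Lemma feasible0 n a : feasible n a 0.
Proof. by exists (fun=> 0); rewrite big1 // => i _; rewrite muln0. Qed.

Lemma feasibleD n a s t : feasible n a s -> feasible n a t -> feasible n a (s + t).
Proof.
move=> [x <-] [y <-]; exists (fun i => x i + y i); rewrite -big_split.
by apply: eq_bigr => i _; rewrite mulnDr.
Qed.

Lemma feasible_gen n a i : i <= n -> feasible n a (a i).
Proof.
move=> le_in; exists (fun j => j == i); rewrite (bigD1 (Ordinal (le_in : i < n.+1))) //=.
rewrite eqxx muln1 big1 ?addn0 // => j; rewrite -val_eqE /= => /negPf->; exact: muln0.
Qed.

Lemma feasibleM n a t k : feasible n a t -> feasible n a (k * t).
Proof. by move=> ft; elim: k => [|k IH]; [apply: feasible0 | rewrite mulSn; apply: feasibleD]. Qed.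

Lemma feasible_pos n a t : 0 < t -> feasible n a t ->
  exists i t', [/\ i <= n, feasible n a t' & t = a i + t'].
Proof.
move=> t0 [x ex].
case: (pickP (fun i : 'I_n.+1 => 0 < a i * x i)) => [i i0|no]; last first.
  by move: t0; rewrite -ex big1 // => i _; apply/eqP; rewrite -leqn0 leqNgt no.
have xi0 : 0 < x i by move: i0; rewrite muln_gt0 => /andP[].
exists i, (\sum_(j < n.+1) a j * (x j - (j == i))); split; first by rewrite -ltnS.
  by exists (fun j => x j - (j == i)).
rewrite -ex (bigD1 i) //= [in RHS](bigD1 i) //= eqxx addnA; congr (_ + _).
  by rewrite mulnBr muln1 subnKC // leq_pmulr.
by apply: eq_bigr => j; rewrite -val_eqE => /negPf->; rewrite subn0.
Qed.

Section Instance.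
Variables (n : nat) (a : nat -> nat).
Hypothesis inst : instance n a.

Lemma inst_mono i j : i < j -> j <= n -> a i < a j.
Proof.
have [_ lt_a _] := inst; elim: j => // j IH; rewrite ltnS leq_eqVlt => /orP[/eqP-> |lt_ij] le_jn.
  exact: lt_a.
by apply: (ltn_trans (IH lt_ij (ltnW le_jn))); apply: lt_a.
Qed.

Lemma inst_ge i : i <= n -> i < a i.
Proof.
have [a0 _ _] := inst; elim: i => // i IH le_in.
by apply: leq_ltn_trans (IH (ltnW le_in)) _; apply: inst_mono.
Qed.

Lemma inst_le i : i <= n -> a i <= a n.
Proof. by rewrite leq_eqVlt => /orP[/eqP->|/inst_mono/(_ (leqnn n))/ltnW]. Qed.

Local Notation m := (a n).
(** Residues are taken modulo the largest generator, so that the n + 1 generators have distinct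
    residues, that of a_n being 0. The form [m'.+1] gives the ordinals their additive group. *)
Let m' := m.-1.
Let mE : m = m'.+1. Proof. by rewrite /m' prednK // (leq_ltn_trans _ (inst_ge (leqnn n))). Qed.
Let res (t : nat) : 'I_m'.+1 := inZp t.
Let resD s t : res (s + t) = (res s + res t)%R.
Proof. by apply: val_inj; rewrite /= modnDm. Qed.
Let A : {set 'I_m'.+1} := [set res (a i) | i : 'I_n.+1].

Let A0 : (0%R : 'I_m'.+1) \in A.
Proof. by apply/imsetP; exists ord_max => //; apply: val_inj; rewrite /= -mE modnn. Qed.

Let card_A : #|A| = n.+1.
Proof.
rewrite card_imset ?card_ord // => i j /(congr1 val) /=; rewrite -mE.
have P k : k < n -> a k %% m = a k by move=> ?; rewrite modn_small // inst_mono.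
have Q (k : 'I_n.+1) : (k < n) || (k == n :> nat) by rewrite orbC -leq_eqVlt -ltnS.
move=> e; apply: val_inj => /=.
have pos k : k <= n -> 0 < a k by move=> ?; apply: leq_ltn_trans (inst_ge _).
case/orP: (Q i) => [ltin|/eqP ein]; case/orP: (Q j) => [ltjn|/eqP ejn].
- move: e; rewrite !P // => e; case: (ltngtP i j) => // h.
    by have := inst_mono h (ltnW ltjn); rewrite e ltnn.
  by have := inst_mono h (ltnW ltin); rewrite e ltnn.
- by move: e; rewrite (P i) // ejn modnn => e; have := pos i (ltnW ltin); rewrite e.
- by move: e; rewrite ein modnn (P j) // => e; have := pos j (ltnW ltjn); rewrite -e.
- by rewrite ein ejn.
Qed.

Let A_gen (H : {set 'I_m'.+1}) : (0%R \in H) ->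
  (forall x y, x \in H -> y \in H -> (x - y)%R \in H) -> A \subset H -> H = setT.
Proof.
move=> H0 HB sAH.
have HN x : x \in H -> (- x)%R \in H by move=> Hx; rewrite -GRing.sub0r HB.
have HD x y : x \in H -> y \in H -> (x + y)%R \in H.
  by move=> Hx Hy; rewrite -[y]GRing.opprK HB ?HN.
have HM k s : res s \in H -> res (k * s) \in H.
  move=> Hs; elim: k => [|k IH]; last by rewrite mulSn resD HD.
  by rewrite mul0n; have -> : res 0 = 0%R by apply: val_inj; rewrite /= mod0n.
(* 1 is the gcd of the generators, and by Bezout the numbers with residue in H are closed under
   gcd. *)
have H1 : res 1 \in H.
  have [_ _ <-] := inst.
  apply: (big_ind (fun d => res d \in H)) => [|x y Hx Hy|i _].
  - by have := HM 0 0; rewrite mul0n; apply; have -> : res 0 = 0%R by apply: val_inj; rewrite /= mod0n.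
  - have [->|x0] := posnP x; first by rewrite gcd0n.
    have [u v e _] := egcdnP y x0.
    have -> : res (gcdn x y) = (res (u * x) - res (v * y))%R.
      by rewrite e resD GRing.addrAC GRing.subrr GRing.add0r.
    by rewrite HB ?HM.
  - by apply: (subsetP sAH); apply/imsetP; exists i.
apply/setP => x; rewrite inE; have := HM x _ H1; rewrite muln1.
by have -> : res x = x by apply: val_inj; rewrite /= modn_small.
Qed.

Let ksum k := iter k (fun X => sumset X A) [set 0%R].

(** In the doubled count the first copy of A gives 2 (n + 1), and each of the k further copies gives
    n + 1 by [sumset_growth]. *)
Let card_ksum k : minn (2 * m) (k.+2 * n.+1) <= 2 * #|ksum k.+1|.
Proof.
have szT : sz [set: 'I_m'.+1] = m by rewrite /sz cardsT card_ord -mE.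
elim: k => [|k IH].
  rewrite geq_min; apply/orP; right; rewrite leq_mul2l /= -card_A.
  by apply/subset_leq_card/subsetP => x Ax; rewrite -[x]GRing.add0r mem_sumset ?inE.
have k0 : ksum k.+1 != set0.
  by rewrite -card_gt0; move: IH (inst_ge (leqnn n)); rewrite mulSn; lia.
have := sumset_growth A0 A_gen k0; rewrite szT [sz A]card_A /sz.
rewrite -/(ksum k.+2) -[sumset _ _]/(ksum k.+2); move: IH.
move: #|ksum k.+1| #|ksum k.+2| => c d; rewrite ![_.+2 * _]mulSn [_.+1 * _]mulSn; lia.
Qed.

Lemma ksum_feasible k x : x \in ksum k ->
  exists t, [/\ feasible n a t, t <= k * m & res t = x].
Proof.
elim: k x => [|k IH] x /=.
  rewrite inE => /eqP->; exists 0; split; rewrite ?mul0n //; first exact: feasible0.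
  by apply: val_inj; rewrite /= mod0n.
case/sumsetP => y [z [/IH[t [ft let_ <-]] /imsetP[i _ ->] ->]].
have le_in : i <= n by rewrite -ltnS.
exists (t + a i); split; first exact: feasibleD ft (feasible_gen _ le_in).
  by rewrite mulSn addnC leq_add // inst_le.
exact: resD.
Qed.

(** For k = floor(2m / (n + 1)) one has (k + 1)(n + 1) > 2m, so k copies of A cover every residue
    modulo m by feasible s <= k m. What is missing from s to t is a multiple of the generator m. *)
Lemma large_feasible t : (2 * m %/ n.+1) * m <= t -> feasible n a t.
Proof.
set k := _ %/ _ => let_.
have m0 : 0 < m by rewrite mE.
have k0 : 0 < k by rewrite divn_gt0 // mul2n -addnn (leq_trans (inst_ge (leqnn n))) // leq_addr.
have := card_ksum k.-1; rewrite prednK //.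
have -> : minn (2 * m) (k.+1 * n.+1) = 2 * m.
  by apply/minn_idPl/ltnW/ltn_ceil.
rewrite leq_pmul2l // => cT.
have /ksum_feasible[s [fs les es]] : res t \in ksum k.
  suff -> : ksum k = setT by rewrite inE.
  by apply/eqP; rewrite eqEcard subsetT cardsT card_ord -mE.
have le_st : s <= t by apply: leq_trans les let_.
have /eqP := congr1 val es; rewrite /= -mE eq_sym eqn_mod_dvd // => /dvdnP[q e].
by rewrite -(subnKC le_st) e; apply: feasibleD => //; apply: feasibleM; apply: feasible_gen.
Qed.
End Instance.

(** * A structured language compiled to the word RAM *)

(* [OAdd], [OMul] and [OMsub] are the ring operations modulo the bound V, through which
   signed values are handled; [OSub] is the truncated subtraction. *)
Inductive binop := OAdd | OMul | OSub | OMsub | ODiv | OMod.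
Inductive expr := Cst of nat | Var of nat | Get of nat & expr | Bin of binop & expr & expr.
Inductive cmd :=
| Skip
| Asn of nat & expr
| Sto of nat & expr & expr
| Seq of cmd & cmd
| Ite of expr & expr & cmd & cmd
| For of nat & expr & cmd.

Record store := Store { var : nat -> nat; arr : nat -> nat -> nat }.
Definition setv s x v := Store (upd (var s) x v) (arr s).
Definition seta s k i v :=
  Store (var s) (fun k' => if k' == k then upd (arr s k) i v else arr s k').

Section Semantics.
Variables V Bg : nat.

(** Every operation is total and maps values below V to values below V. That a reduction modulo V is
    invisible, or meant, is left to the proofs of the algorithms. *)
Definition bin o x y :=
  match o with
  | OAdd => (x + y) %% V
  | OMul => (x * y) %% V
  | OSub => x - y
  | OMsub => (x + (V - y)) %% V
  | ODiv => x %/ maxn 1 y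
  | OMod => x %% maxn 1 y
  end.

(** Indices are reduced modulo Bg, so that no access leaves its array. *)
Fixpoint eval e s :=
  match e with
  | Cst k => k
  | Var x => var s x
  | Get k e => arr s k (eval e s %% Bg)
  | Bin o e1 e2 => bin o (eval e1 s) (eval e2 s)
  end.

Fixpoint sem c s :=
  match c with
  | Skip => s
  | Asn x e => setv s x (eval e s)
  | Sto k e1 e2 => seta s k (eval e1 s %% Bg) (eval e2 s)
  | Seq c1 c2 => sem c2 (sem c1 s)
  | Ite e1 e2 c1 c2 => if eval e1 s < eval e2 s then sem c1 s else sem c2 s
  | For x e c => iteri (eval e s) (fun j t => sem c (setv t x j)) s
  end.

Fixpoint ecost e :=
  match e with
  | Cst _ => 1
  | Var _ => 1
  | Get _ e => ecost e + 5
  | Bin o e1 e2 => ecost e1 + ecost e2 +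
      match o with OAdd => 2 | OMul => 2 | OSub => 1 | OMsub => 3 | ODiv => 4 | OMod => 4 end
  end.

(** Exact instruction counts of the compiled code. A loop round takes 5 instructions besides its
    body: the test, the copy of the counter, and the three that increment it and jump back. *)
Fixpoint cost c s :=
  match c with
  | Skip => 0
  | Asn x e => ecost e + 1
  | Sto k e1 e2 => ecost e1 + ecost e2 + 5
  | Seq c1 c2 => cost c1 s + cost c2 (sem c1 s)
  | Ite e1 e2 c1 c2 => ecost e1 + ecost e2 +
      (if eval e1 s < eval e2 s then 1 + cost c1 s else 2 + cost c2 s)
  | For x e c => ecost e + 3 + \sum_(j < eval e s)
      (cost c (setv (iteri j (fun j t => sem c (setv t x j)) s) x j) + 5)
  end.
End Semantics.

(* Machine registers: 0 and 4 scratch, 1 holds V, 2 holds Bg, 3 holds 0;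
   the stack slot d is register 2d+6 and the variable x is register 2x+5. *)
Definition slot d := 2 * d + 6.
Definition vreg x := 2 * x + 5.

Definition bin_code o d :=
  let t := slot d in let u := slot d.+1 in
  match o with
  | OAdd => [:: IAdd t t u; IMod t t 1]
  | OMul => [:: IMul t t u; IMod t t 1]
  | OSub => [:: ISub t t u]
  | OMsub => [:: ISub 4 1 u; IAdd t t 4; IMod t t 1]
  | ODiv => [:: IConst 4 1; ISub 4 4 u; IAdd u u 4; IDiv t t u]
  | OMod => [:: IConst 4 1; ISub 4 4 u; IAdd u u 4; IMod t t u]
  end.

Definition addr_code k d := [:: IMod (slot d) (slot d) 2; IConst 4 k; IMul 4 4 2].

Fixpoint ecomp d e :=
  match e with
  | Cst k => [:: IConst (slot d) k]
  | Var x => [:: IAdd (slot d) (vreg x) 3]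
  | Get k e => ecomp d e ++ addr_code k d ++ [:: IAdd 4 4 (slot d); ILoad (slot d) 4]
  | Bin o e1 e2 => ecomp d e1 ++ ecomp d.+1 e2 ++ bin_code o d
  end.

Fixpoint csize c :=
  match c with
  | Skip => 0
  | Asn x e => ecost e + 1
  | Sto k e1 e2 => ecost e1 + ecost e2 + 5
  | Seq c1 c2 => csize c1 + csize c2
  | Ite e1 e2 c1 c2 => ecost e1 + ecost e2 + 2 + csize c1 + csize c2
  | For x e c => ecost e + 7 + csize c
  end.

Fixpoint ccomp pc d c :=
  match c with
  | Skip => [::]
  | Asn x e => ecomp d e ++ [:: IAdd (vreg x) (slot d) 3]
  | Sto k e1 e2 => ecomp d e1 ++ ecomp d.+1 e2 ++ addr_code k d ++
      [:: IAdd 4 4 (slot d); IStore 4 (slot d.+1)]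
  | Seq c1 c2 => ccomp pc d c1 ++ ccomp (pc + csize c1) d c2
  | Ite e1 e2 c1 c2 =>
      let p := pc + ecost e1 + ecost e2 in
      ecomp d e1 ++ ecomp d.+1 e2 ++
      [:: IJlt (slot d) (slot d.+1) (p + csize c2 + 2)] ++
      ccomp (p + 1) d c2 ++ [:: IJmp (p + csize c2 + 2 + csize c1)] ++
      ccomp (p + csize c2 + 2) d c1
  | For x e c =>
      let p := pc + ecost e + 1 in
      ecomp d.+1 e ++ [:: IConst (slot d) 0] ++
      [:: IJlt (slot d) (slot d.+1) (p + 2); IJmp (p + 6 + csize c);
          IAdd (vreg x) (slot d) 3] ++
      ccomp (p + 3) d.+2 c ++
      [:: IConst 4 1; IAdd (slot d) (slot d) 4; IJmp p]
  end.

Lemma size_ecomp d e : size (ecomp d e) = ecost e.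
Proof.
elim: e d => [k|x|k e IH|o e1 IH1 e2 IH2] d //=; rewrite !size_cat /= ?IH //.
by rewrite IH1 IH2 addnA; case: o.
Qed.

Lemma size_ccomp pc d c : size (ccomp pc d c) = csize c.
Proof.
elim: c pc d => [|x e|k e1 e2|c1 IH1 c2 IH2|e1 e2 c1 IH1 c2 IH2|x e c IH] pc d //=;
  rewrite ?size_cat /= ?size_ecomp ?size_cat /= ?IH1 ?IH2 ?IH //; lia.
Qed.

(** * Runs of the machine *)

Section Machine.
Variables (W : nat) (P : seq instr).

Fixpoint run t s : option state :=
  if t is t'.+1 then if step W P s is Running s' then run t' s' else None else Some s.

Lemma run_cat t1 t2 s s1 : run t1 s = Some s1 -> run (t1 + t2) s = run t2 s1.
Proof. by elim: t1 s => [|t IH] s /= => [[->]|] //; case: step => // s2; apply: IH. Qed.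

Lemma exec_run t T s s1 : run t s = Some s1 -> exec W P (t + T) s = exec W P T s1.
Proof. by elim: t s => [|t IH] s /= => [[->]|] //; case: step => // s2; apply: IH. Qed.

Definition code_at pc code :=
  pc + size code <= size P /\ forall i, i < size code -> nth IHalt P (pc + i) = nth IHalt code i.

Lemma code_at_catl pc c1 c2 : code_at pc (c1 ++ c2) -> code_at pc c1.
Proof.
rewrite /code_at size_cat => -[le nthP]; split=> [|i lti]; first lia.
by rewrite nthP ?nth_cat ?lti //; lia.
Qed.

Lemma code_at_catr pc c1 c2 : code_at pc (c1 ++ c2) -> code_at (pc + size c1) c2.
Proof.
rewrite /code_at size_cat => -[le nthP]; split=> [|i lti]; first lia.
by rewrite -addnA nthP ?nth_cat ?ltnNge ?leq_addr ?addKn //=; lia.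
Qed.

Definition istep (i : instr) (s : state) : outcome :=
  let r := regs s in
  let next := (pc s).+1 in
  let setr d v :=
      if v < W then Running (State next (upd r d v) (Defs.mem s)) else Crash in
  match i with
  | IConst d k => setr d k
  | IAdd d x y => setr d (r x + r y)
  | ISub d x y => setr d (r x - r y)
  | IMul d x y => setr d (r x * r y)
  | IDiv d x y => if r y == 0 then Crash else setr d (r x %/ r y)
  | IMod d x y => if r y == 0 then Crash else setr d (r x %% r y)
  | ILoad d x => if r x < W then setr d (Defs.mem s (r x)) else Crash
  | IStore d x => if r d < W then Running (State next r (upd (Defs.mem s) (r d) (r x)))
                  else Crash
  | IJlt x y l => Running (State (if r x < r y then l else next) r (Defs.mem s))
  | IJmp l => Running (State l r (Defs.mem s))
  | IHalt => Halted s
  end.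

Lemma step_at i s : code_at (pc s) [:: i] -> step W P s = istep i s.
Proof.
move=> [le /(_ 0 isT)]; rewrite addn0 /step => ->.
by rewrite (leq_trans _ le) //= addn1.
Qed.

(** Execution driven by the instruction list instead of the program counter, so that short pieces of
    code can be run by reduction. *)
Fixpoint straight code s : option state :=
  if code is i :: code' then
    if istep i s is Running s' then if pc s' == (pc s).+1 then straight code' s' else None
    else None
  else Some s.

Lemma run_straight code s s' : code_at (pc s) code -> straight code s = Some s' ->
  run (size code) s = Some s' /\ pc s' = pc s + size code.
Proof.
elim: code s => [|i code IH] s at_ /=; first by case=> <-; rewrite addn0.
rewrite (step_at (code_at_catl (c1 := [:: i]) at_)).
case: istep => // s1; case: eqP => // e1 st.
have := code_at_catr (c1 := [:: i]) at_; rewrite /= addn1 -e1 => at1.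
by have [-> ->] := IH _ at1 st; rewrite e1 addSnnS.
Qed.
End Machine.

(** * Correctness of the compiler *)

Section Correct.
Variables (V Bg K W : nat).
(** A product of two values is formed before it is reduced modulo V, whence [V * V <= W]; the K
    arrays of length Bg occupy the addresses below [K * Bg]. *)
Hypotheses (V1 : 1 < V) (VW : V * V <= W) (Bg0 : 0 < Bg) (BgW : K * Bg <= W)
  (KV : K <= V).

Fixpoint ewf e :=
  match e with
  | Cst k => k < V
  | Var _ => true
  | Get k e => (k < K) && ewf e
  | Bin _ e1 e2 => ewf e1 && ewf e2
  end.

Fixpoint cwf c :=
  match c with
  | Skip => true
  | Asn _ e => ewf e
  | Sto k e1 e2 => [&& k < K, ewf e1 & ewf e2]
  | Seq c1 c2 => cwf c1 && cwf c2
  | Ite e1 e2 c1 c2 => [&& ewf e1, ewf e2, cwf c1 & cwf c2]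
  | For _ e c => ewf e && cwf c
  end.

Definition bounded s := (forall x, var s x < V) /\ (forall k i, arr s k i < V).

Local Notation eval := (eval V Bg).
Local Notation sem := (sem V Bg).

Lemma eval_lt e s : ewf e -> bounded s -> eval e s < V.
Proof.
move=> we [bv ba]; elim: e we => //= o e1 IH1 e2 IH2 /andP[/IH1 l1 /IH2 l2].
have V0 : 0 < V by apply: ltnW.
by case: o => /=; rewrite ?ltn_pmod //; apply: leq_ltn_trans l1;
  rewrite ?leq_subr ?leq_div ?leq_mod.
Qed.

Lemma bounded_setv s x v : v < V -> bounded s -> bounded (setv s x v).
Proof. by move=> lv [bv ba]; split=> //= y; rewrite /upd; case: eqP. Qed.

Lemma bounded_sem c s : cwf c -> bounded s -> bounded (sem c s).
Proof.
elim: c s => [|x e|k e1 e2|c1 IH1 c2 IH2|e1 e2 c1 IH1 c2 IH2|x e c IH] s //=.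
- by move=> we b; apply: bounded_setv => //; apply: eval_lt.
- case/and3P=> _ _ we b; have [bv ba] := b; split=> //= k' i.
  by case: eqP => // _; rewrite /upd; case: eqP => // _; apply: eval_lt.
- by case/andP=> w1 w2 b; apply/IH2/IH1.
- by case/and4P=> _ _ w1 w2 b; case: ifP => _; [apply: IH1 | apply: IH2].
- case/andP=> we /IH h b; have := eval_lt we b.
  elim: (eval e s) => //= n IHn ltn; apply/h/bounded_setv; first exact: ltnW.
  exact/IHn/ltnW.
Qed.

Definition represents s ms :=
  [/\ forall x, regs ms (vreg x) = var s x, regs ms 1 = V, regs ms 2 = Bg, regs ms 3 = 0
    & forall k i, k < K -> i < Bg -> Defs.mem ms (k * Bg + i) = arr s k i].

Lemma slot_vreg d x : (vreg x == slot d) = false.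
Proof. by apply/eqP; rewrite /vreg /slot; lia. Qed.
Lemma slot_inj d d' : (slot d == slot d') = (d == d').
Proof. by rewrite /slot eqn_add2r eqn_pmul2l. Qed.
Lemma slot1 d : (1 == slot d) = false. Proof. by apply/eqP; rewrite /slot; lia. Qed.
Lemma slot2 d : (2 == slot d) = false. Proof. by apply/eqP; rewrite /slot; lia. Qed.
Lemma slot3 d : (3 == slot d) = false. Proof. by apply/eqP; rewrite /slot; lia. Qed.
Lemma slot4 d : (4 == slot d) = false. Proof. by apply/eqP; rewrite /slot; lia. Qed.
Lemma slot4' d : (slot d == 4) = false. Proof. by apply/eqP; rewrite /slot; lia. Qed.
Lemma vreg4 x : (vreg x == 4) = false. Proof. by apply/eqP; rewrite /vreg; lia. Qed.
Lemma slotS d : (slot d == slot d.+1) = false. Proof. by rewrite slot_inj; lia. Qed.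
Lemma slotS' d : (slot d.+1 == slot d) = false. Proof. by rewrite slot_inj; lia. Qed.
Definition slotE := (slot_vreg, slot1, slot2, slot3, slot4, slot4', vreg4, slotS, slotS', eqxx).

Lemma updE (f : nat -> nat) k v j : upd f k v j = if j == k then v else f j.
Proof. by []. Qed.

Definition keeps d ms ms' :=
  [/\ forall j, j < d -> regs ms' (slot j) = regs ms (slot j),
      forall x, regs ms' (vreg x) = regs ms (vreg x),
      forall i, i \in [:: 1; 2; 3] -> regs ms' i = regs ms i
    & Defs.mem ms' = Defs.mem ms].

Lemma keeps_represents d s ms ms' : keeps d ms ms' -> represents s ms -> represents s ms'.
Proof.
move=> [_ kv k3 km] [rv r1 r2 r3 rm]; split=> [x||||k i]; rewrite ?kv ?k3 ?km ?rv //; exact: rm.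
Qed.

Lemma keeps_refl d ms : keeps d ms ms. Proof. by []. Qed.

Lemma keeps_trans d d' a b c : d <= d' -> keeps d a b -> keeps d' b c -> keeps d a c.
Proof.
move=> ledd [ks kv k3 km] [ks' kv' k3' km']; split=> [j lj|x|i ii|].
- by rewrite ks' ?ks //; apply: leq_trans lj ledd.
- by rewrite kv'.
- by rewrite k3' ?k3.
- by rewrite km'.
Qed.

Lemma keeps_upd d ms p r j v : j = 4 \/ (exists2 d', d <= d' & j = slot d') ->
  keeps d ms (State p r (Defs.mem ms)) ->
  keeps d ms (State p (upd r j v) (Defs.mem ms)).
Proof.
move=> hj [/= ks kv k3 km]; split=> //= [i lti|x|i ii]; rewrite /upd.
- by case: hj => [->|[d' led ->]]; rewrite ?slotE ?slot_inj ?ks //; case: eqP => // e; lia.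
- by case: hj => [->|[d' led ->]]; rewrite ?slotE ?kv.
- rewrite k3 //; move: ii; rewrite !inE.
  by case/or3P=> /eqP->; case: hj => [->|[d' led ->]]; rewrite ?slotE.
Qed.

Lemma keeps_upd4 d ms p r v : keeps d ms (State p r (Defs.mem ms)) ->
  keeps d ms (State p (upd r 4 v) (Defs.mem ms)).
Proof. by apply: keeps_upd; left. Qed.

Lemma keeps_upd_slot d d' ms p r v : d <= d' -> keeps d ms (State p r (Defs.mem ms)) ->
  keeps d ms (State p (upd r (slot d') v) (Defs.mem ms)).
Proof. by move=> le; apply: keeps_upd; right; exists d'. Qed.

Ltac keeps := rewrite /= ; repeat (apply: keeps_upd4 || (apply: keeps_upd_slot; first by []));
  exact: keeps_refl.

Let W4 k : k <= 2 * V -> k <= W. Proof. by move=> h; apply: leq_trans VW; nia. Qed.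

Lemma bin_straight o d ms x y : regs ms (slot d) = x -> regs ms (slot d.+1) = y ->
  regs ms 1 = V -> x < V -> y < V ->
  exists ms', [/\ straight W (bin_code o d) ms = Some ms', regs ms' (slot d) = bin V o x y
    & keeps d ms ms'].
Proof.
move=> ex ey e1 lx ly.
have V0 : V == 0 = false by apply/eqP; lia.
have lV z : z < 2 * V -> z < W by apply: W4.
have mlt z : z %% V < W by apply: lV; have := ltn_pmod z (ltnW V1); lia.
(* Truncated subtraction makes 1 - y equal to 1 if y = 0 and to 0 otherwise; this is how [bin_code]
   forms the divisor without a branch. *)
have mxE : y + (1 - y) = maxn 1 y by lia.
have mx0 : (maxn 1 y == 0) = false by lia.
case: o; rewrite /= ?ex ?ey ?e1.
- rewrite lV /=; last lia.
  rewrite !(updE, slotE) e1 V0 mlt /= eqxx.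
  eexists; split; [reflexivity | by rewrite /= updE slotE |].
  keeps.
- have -> /= : x * y < W by apply: leq_trans VW; nia.
  rewrite !(updE, slotE) e1 V0 mlt /= eqxx.
  eexists; split; [reflexivity | by rewrite /= updE slotE |].
  keeps.
- have -> /= : x - y < W by apply: lV; lia.
  rewrite !(updE, slotE).
  eexists; split; [reflexivity | by rewrite /= updE slotE |].
  keeps.
- rewrite lV /=; last lia.
  rewrite !(updE, slotE) ex lV /=; last lia.
  rewrite !(updE, slotE) e1 V0 mlt /= eqxx.
  eexists; split; [reflexivity | by rewrite /= updE slotE |].
  keeps.
- rewrite lV /=; last lia.
  rewrite !(updE, slotE) ey lV /=; last lia.
  rewrite !(updE, slotE) ey mxE lV /=; last lia.
  rewrite !(updE, slotE) mx0 ex lV /=; last by have := leq_div x (maxn 1 y); lia.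
  rewrite eqxx; eexists; split; [reflexivity | by rewrite /= updE slotE |].
  keeps.
- rewrite lV /=; last lia.
  rewrite !(updE, slotE) ey lV /=; last lia.
  rewrite !(updE, slotE) ey mxE lV /=; last lia.
  rewrite !(updE, slotE) mx0 ex lV /=; last by have := leq_mod x (maxn 1 y); lia.
  rewrite eqxx; eexists; split; [reflexivity | by rewrite /= updE slotE |].
  keeps.
Qed.

Lemma addr_straight k d ms x : k < K -> regs ms (slot d) = x -> regs ms 2 = Bg ->
  x < V ->
  exists ms', [/\ straight W (addr_code k d ++ [:: IAdd 4 4 (slot d)]) ms = Some ms',
    regs ms' 4 = k * Bg + x %% Bg, regs ms' (slot d.+1) = regs ms (slot d.+1)
    & keeps d ms ms'].
Proof.
move=> ltk ex e2 lx.
have lV z : z < 2 * V -> z < W by apply: W4.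
have xB : x %% Bg < Bg by rewrite ltn_pmod.
have kB : k * Bg + x %% Bg < W by apply: leq_trans BgW; nia.
rewrite /= ex e2 (gtn_eqF Bg0) lV /=; last by have := leq_mod x Bg; lia.
rewrite eqxx lV /=; last lia.
rewrite !(updE, slotE) e2 (leq_ltn_trans (leq_addr _ _) kB) /= !(updE, slotE) kB /= eqxx.
eexists; split; [reflexivity | by rewrite /= updE | by rewrite /= !(updE, slotE) |].
  keeps.
Qed.

Section Program.
Variable P : seq instr.
Local Notation run := (run W P).
Local Notation code_at := (code_at P).

Lemma run_catE t1 t2 ms ms1 ms2 :
  run t1 ms = Some ms1 -> run t2 ms1 = Some ms2 -> run (t1 + t2) ms = Some ms2.
Proof. by move=> /run_cat->. Qed.

Lemma vreg3 x : (3 == vreg x) = false. Proof. by apply/eqP; rewrite /vreg; lia. Qed.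

Lemma ecomp_correct e d ms s : ewf e -> bounded s -> represents s ms ->
  code_at (pc ms) (ecomp d e) ->
  exists ms', [/\ run (ecost e) ms = Some ms', pc ms' = pc ms + ecost e,
    regs ms' (slot d) = eval e s & keeps d ms ms'].
Proof.
have lV z : z < V -> z < W by move=> lz; apply: W4; lia.
move=> we bs; elim: e we d ms => [k|x|k e IH|o e1 IH1 e2 IH2] /= we d ms rep at_.
- have := @run_straight W P _ ms _ at_; rewrite /= lV //= eqxx => /(_ _ erefl)[R p].
  by eexists; split; [exact: R | exact: p | rewrite /= updE eqxx | keeps].
- have [rv r1 r2 r3 rm] := rep; have [bv ba] := bs.
  have := @run_straight W P _ ms _ at_; rewrite /= r3 addn0 rv lV //= eqxx => /(_ _ erefl)[R p].
  by eexists; split; [exact: R | exact: p | rewrite /= updE eqxx | keeps].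
- have [ltk we'] := andP we; have [ms1 [R1 p1 v1 k1]] := IH we' d ms rep (code_at_catl at_).
  have at1 := code_at_catr at_; rewrite size_ecomp -p1 in at1.
  have rep1 := keeps_represents k1 rep; have [_ r1 r2 r3 rm] := rep1.
  have [ms2 [S2 v2 _ k2]] := addr_straight ltk v1 r2 (eval_lt we' bs).
  have {}at1 : code_at (pc ms1) ((addr_code k d ++ [:: IAdd 4 4 (slot d)]) ++
      [:: ILoad (slot d) 4]) by [].
  have [R2 p2] := run_straight (code_at_catl at1) S2.
  have at2 := code_at_catr at1; rewrite -p2 in at2.
  have [_ _ _ _ rm2] := keeps_represents k2 rep1.
  have ltB := ltn_pmod (eval e s) Bg0.
  have aW : k * Bg + eval e s %% Bg < W by apply: leq_trans BgW; nia.
  have := @run_straight W P _ ms2 _ at2; rewrite /= v2 aW rm2 // lV /=; last by case: bs.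
  rewrite eqxx => /(_ _ erefl)[R3 p3]; eexists; split.
  + exact: (run_catE R1 (run_catE R2 (R3 : run 1 ms2 = _))).
  + by rewrite p3 p2 p1 /=; lia.
  + by rewrite /= updE eqxx.
  + by apply: keeps_trans (leqnn d) k1 _; apply: keeps_trans (leqnn d) k2 _; keeps.
- have [we1 we2] := andP we; have [ms1 [R1 p1 v1 k1]] := IH1 we1 d ms rep (code_at_catl at_).
  have at1 := code_at_catr at_; rewrite size_ecomp -p1 in at1.
  have rep1 := keeps_represents k1 rep.
  have [ms2 [R2 p2 v2 k2]] := IH2 we2 d.+1 ms1 rep1 (code_at_catl at1).
  have at2 := code_at_catr at1; rewrite size_ecomp -p2 in at2.
  have [_ r1 _ _ _] := keeps_represents k2 rep1.
  have vd : regs ms2 (slot d) = eval e1 s by case: k2 => -> //; rewrite ltnS.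
  have [ms3 [S3 v3 k3]] := bin_straight o vd v2 r1 (eval_lt we1 bs) (eval_lt we2 bs).
  have [R3 p3] := run_straight at2 S3.
  have sz_ : size (bin_code o d) =
      match o with OAdd => 2 | OMul => 2 | OSub => 1 | OMsub => 3 | ODiv => 4 | OMod => 4 end.
    by case: (o).
  rewrite sz_ in R3 p3; exists ms3; split=> //.
  + by rewrite -addnA; exact: (run_catE R1 (run_catE R2 R3)).
  + by rewrite p3 p2 p1 !addnA.
  + have k2' : keeps d ms1 ms2.
      by case: k2 => ks kv k3' km; split=> // j lj; apply: ks; exact: ltnW.
    exact: keeps_trans (leqnn d) k1 (keeps_trans (leqnn d) k2' k3).
Qed.

Definition sameslots d ms ms' := forall j, j < d -> regs ms' (slot j) = regs ms (slot j).

Lemma ccomp_correct c d ms s : cwf c -> bounded s -> represents s ms ->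
  code_at (pc ms) (ccomp (pc ms) d c) ->
  exists ms', [/\ run (cost V Bg c s) ms = Some ms', pc ms' = pc ms + csize c,
    represents (sem c s) ms' & sameslots d ms ms'].
Proof.
have lV z : z < V -> z < W by move=> lz; apply: W4; lia.
elim: c d ms s => [|x e|k e1 e2|c1 IH1 c2 IH2|e1 e2 c1 IH1 c2 IH2|x e c IH] /= d ms s wc bs rep at_.
- by exists ms; rewrite addn0.
- have [ms1 [R1 p1 v1 k1]] := ecomp_correct wc bs rep (code_at_catl at_).
  have at1 := code_at_catr at_; rewrite size_ecomp -p1 in at1.
  have [rv r1 r2 r3 rm] := keeps_represents k1 rep.
  have le := eval_lt wc bs.
  have := @run_straight W P _ ms1 _ at1; rewrite /= v1 r3 addn0 lV //= eqxx => /(_ _ erefl)[R2 p2].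
  eexists; split; first exact: (run_catE R1 (R2 : run 1 ms1 = _)).
  + by rewrite p2 p1 addnA.
  + have inj y : (vreg y == vreg x) = (y == x) by rewrite /vreg eqn_add2r eqn_pmul2l.
    split=> [y||||k i ltk lti] /=; rewrite ?updE ?vreg3 ?rm //.
    * by rewrite inj; case: eqP.
    * by rewrite (_ : 1 == vreg x = false) //; apply/eqP; rewrite /vreg; lia.
    * by rewrite (_ : 2 == vreg x = false) //; apply/eqP; rewrite /vreg; lia.
  + by move=> j lj; rewrite /= updE eq_sym slotE; case: k1 => ->.
- have [ltk we1 we2] := and3P wc.
  have [ms1 [R1 p1 v1 k1]] := ecomp_correct we1 bs rep (code_at_catl at_).
  have at1 := code_at_catr at_; rewrite size_ecomp -p1 in at1.
  have rep1 := keeps_represents k1 rep.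
  have [ms2 [R2 p2 v2 k2]] := ecomp_correct we2 bs rep1 (code_at_catl at1).
  have at2 := code_at_catr at1; rewrite size_ecomp -p2 in at2.
  have rep2 := keeps_represents k2 rep1; have [_ r1 r2 _ _] := rep2.
  have vd : regs ms2 (slot d) = eval e1 s by case: k2 => -> //; rewrite ltnS.
  have [ms3 [S3 v3 w3 k3]] := addr_straight ltk vd r2 (eval_lt we1 bs).
  have {}at2 : code_at (pc ms2) ((addr_code k d ++ [:: IAdd 4 4 (slot d)]) ++
      [:: IStore 4 (slot d.+1)]) by [].
  have [R3 p3] := run_straight (code_at_catl at2) S3.
  have at3 := code_at_catr at2; rewrite -p3 in at3.
  have [rv3 r13 r23 r33 rm3] := keeps_represents k3 rep2.
  have ltB := ltn_pmod (eval e1 s) Bg0.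
  have aW : k * Bg + eval e1 s %% Bg < W by apply: leq_trans BgW; nia.
  have := @run_straight W P _ ms3 _ at3; rewrite /= v3 aW eqxx => /(_ _ erefl)[R4 p4].
  eexists; split.
  + by rewrite -addnA; exact: (run_catE R1 (run_catE R2 (run_catE R3 (R4 : run 1 ms3 = _)))).
  + by rewrite p4 p3 p2 p1 /=; lia.
  + split=> //= k' i ltk' lti; rewrite updE w3 v2.
    case: (eqVneq k' k) => [->|nk]; last first.
      rewrite rm3 //; case: eqP => // e; case/eqP: nk.
      by have := congr1 (divn^~ Bg) e; rewrite !divnMDl // !divn_small // !addn0.
    by rewrite /= updE eqn_add2l; case: eqP => // _; rewrite rm3.
  + move=> j lj; case: k3 => /= -> //; case: k2 => -> //; last exact: ltnW.
    by case: k1 => ->.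
- have [w1 w2] := andP wc.
  have [ms1 [R1 p1 rep1 k1]] := IH1 d ms s w1 bs rep (code_at_catl at_).
  have at1 := code_at_catr at_; rewrite size_ccomp -p1 in at1.
  have [ms2 [R2 p2 rep2 k2]] := IH2 d ms1 _ w2 (bounded_sem w1 bs) rep1 at1.
  exists ms2; split=> //; first exact: run_catE R1 R2.
    by rewrite p2 p1 addnA.
  by move=> j lj; rewrite k2 ?k1.
- have [we1 we2 w1 w2] := and4P wc.
  have [ms1 [R1 p1 v1 k1]] := ecomp_correct we1 bs rep (code_at_catl at_).
  have at1 := code_at_catr at_; rewrite size_ecomp -p1 in at1.
  have rep1 := keeps_represents k1 rep.
  have [ms2 [R2 p2 v2 k2]] := ecomp_correct we2 bs rep1 (code_at_catl at1).
  have at2 := code_at_catr at1; rewrite size_ecomp -p2 in at2.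
  have rep2 := keeps_represents k2 rep1.
  have vd : regs ms2 (slot d) = eval e1 s by case: k2 => -> //; rewrite ltnS.
  have s2 : sameslots d ms ms2.
    by move=> j lj; case: k2 => -> //; [case: k1 => -> | exact: ltnW].
  have R12 := run_catE R1 R2.
  set tgt := pc ms2 + csize c2 + 2 in at2 *.
  have J : run 1 ms2 = Some (State (if eval e1 s < eval e2 s then tgt else (pc ms2).+1)
     (regs ms2) (Defs.mem ms2)).
    by rewrite /= (step_at W (code_at_catl (c1 := [:: _]) at2)) /= vd v2.
  have at3 := code_at_catr (c1 := [:: _]) at2; rewrite /= in at3.
  case: ifP J => cmp J.
    have at4 := code_at_catr (code_at_catr at3 : code_at _ ([:: _] ++ _)).
    rewrite size_ccomp /= in at4.
    have e4 : pc ms2 + 1 + csize c2 + 1 = tgt by rewrite /tgt; lia.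
    rewrite e4 in at4.
    have [ms3 [R3 p3 rep3 k3]] := IH1 d (State tgt (regs ms2) (Defs.mem ms2)) s w1 bs rep2 at4.
    exists ms3; split=> //.
    + exact: (run_catE R12 (run_catE (J : run 1 ms2 = _) R3)).
    + by rewrite p3 /= /tgt p2 p1; lia.
    + by move=> j lj; rewrite k3 //= s2.
  have at4 := code_at_catl at3.
  have [ms3 [R3 p3 rep3 k3]] := IH2 d (State (pc ms2 + 1) (regs ms2) (Defs.mem ms2)) s w2 bs rep2 at4.
  have at5 := code_at_catr at3; rewrite size_ccomp -[_ + csize c2]p3 in at5.
  have J3 : run 1 ms3 = Some (State (tgt + csize c1) (regs ms3) (Defs.mem ms3)).
    by rewrite /= (step_at W (code_at_catl (c1 := [:: _]) at5)).
  eexists; split.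
  + have -> : 2 + cost V Bg c2 s = 1 + (cost V Bg c2 s + 1) by lia.
    rewrite addn1 in R3; exact: (run_catE R12 (run_catE (J : run 1 ms2 = _) (run_catE R3 (J3 : run 1 ms3 = _)))).
  + by rewrite /= /tgt p2 p1; lia.
  + by [].
  + by move=> j lj; rewrite /= k3 //= s2.
- have [we w] := andP wc.
  have [ms1 [R1 p1 v1 k1]] := ecomp_correct we bs rep (code_at_catl at_).
  have at1 := code_at_catr at_; rewrite size_ecomp -p1 in at1.
  have rep1 := keeps_represents k1 rep.
  have [R2 p2] : run 1 ms1 = Some (State (pc ms1 + 1) (upd (regs ms1) (slot d) 0) (Defs.mem ms1)) /\ True.
    by rewrite /= (step_at W (code_at_catl (c1 := [:: _]) at1)) /= lV ?addn1 //; lia.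
  move: R2; set ms2 := State _ _ _ => R2.
  have k2 : keeps d ms1 ms2 by apply: keeps_upd_slot; last exact: keeps_refl.
  have rep2 := keeps_represents k2 rep1.
  have at2 := code_at_catr (c1 := [:: _]) at1; rewrite /= in at2.
  have lt_n := eval_lt we bs; set n := eval e s in lt_n v1 *.
  set F := (fun j t => sem c (setv t x j)).
  set p := pc ms1 + 1 in at2 ms2 R2 k2 rep2 *.
  have bF j : j <= n -> bounded (iteri j F s).
    elim: j => //= j IHj ltj; apply/bounded_sem/bounded_setv => //; last exact/IHj/ltnW.
    exact: ltn_trans ltj lt_n.
  have atJ := code_at_catl (c1 := [:: _]) at2.
  have at3 := code_at_catr (c1 := [:: _]) at2; rewrite /= in at3.
  have atE := code_at_catl (c1 := [:: _]) at3.
  have at4 := code_at_catr (c1 := [:: _]) at3; rewrite /= in at4.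
  have atA := code_at_catl (c1 := [:: _]) at4.
  have at5 := code_at_catr (c1 := [:: _]) at4; rewrite /= in at5.
  have e3 : p + 1 + 1 + 1 = p + 3 by lia.
  rewrite e3 in at5.
  have atC := code_at_catl at5.
  have at6 := code_at_catr at5; rewrite size_ccomp in at6.
  (* Invariant at the test p after j rounds: the slots d and d + 1 hold the counter and the
     bound. *)
  have loop j : j <= n -> exists ms', [/\
      run (\sum_(i < j) (cost V Bg c (setv (iteri i F s) x i) + 5)) ms2 = Some ms',
      pc ms' = p, represents (iteri j F s) ms', regs ms' (slot d) = j /\ regs ms' (slot d.+1) = n
      & sameslots d ms2 ms'].
    elim: j => [|j IHj] ltj.
      exists ms2; rewrite big_ord0 /=; split=> //; rewrite /= !(updE, slotE).
      by rewrite v1.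
    have [ms3 [R3 p3 rep3 [sd sd1] ss3]] := IHj (ltnW ltj).
    rewrite -p3 in atJ.
    have J3 : run 1 ms3 = Some (State (p + 2) (regs ms3) (Defs.mem ms3)).
      by rewrite /= (step_at W atJ) /= sd sd1 ltj p3.
    have [rv r1 r2 r3 rm] := rep3.
    have J4 : run 1 (State (p + 2) (regs ms3) (Defs.mem ms3)) =
        Some (State (p + 3) (upd (regs ms3) (vreg x) j) (Defs.mem ms3)).
      have e2 : p + 1 + 1 = p + 2 by lia.
      rewrite e2 in atA.
      rewrite /= (step_at W (atA : code_at (pc (State (p + 2) _ _)) _)) /= sd r3 addn0.
      by rewrite lV ?(ltn_trans ltj) // -addnS.
    move: J4; set ms4 := State (p + 3) _ _ => J4.
    have rep4 : represents (setv (iteri j F s) x j) ms4.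
      have inj y : (vreg y == vreg x) = (y == x) by rewrite /vreg eqn_add2r eqn_pmul2l.
      split=> [y||||k i ltk lti] /=; rewrite ?updE ?vreg3 ?rm //.
      * by rewrite inj; case: eqP.
      * by rewrite (_ : 1 == vreg x = false) //; apply/eqP; rewrite /vreg; lia.
      * by rewrite (_ : 2 == vreg x = false) //; apply/eqP; rewrite /vreg; lia.
    have b4 : bounded (setv (iteri j F s) x j).
      by apply: bounded_setv; [exact: ltn_trans ltj lt_n | apply/bF/ltnW].
    have [ms5 [R5 p5 rep5 ss5]] := IH d.+2 ms4 _ w b4 rep4 atC.
    rewrite -[_ + csize c]p5 in at6.
    have [r5v r51 r52 r53 r5m] := rep5.
    have sl d' : d' < d.+2 -> regs ms5 (slot d') = regs ms3 (slot d').
      by move=> ltd; rewrite ss5 //= updE eq_sym slotE.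
    have S6 : straight W [:: IConst 4 1; IAdd (slot d) (slot d) 4] ms5 =
       Some (State (pc ms5).+2 (upd (upd (regs ms5) 4 1) (slot d) j.+1) (Defs.mem ms5)).
      have sdE := sl d (ltnW (ltnSn d.+1)).
      have lj1 : j.+1 < W by apply: lV; apply: leq_ltn_trans ltj lt_n.
      by rewrite /= (lV 1 V1) /= eqxx !(updE, slotE) sdE sd addn1 lj1 /= eqxx.
    have at7 : code_at (pc ms5) ([:: IConst 4 1; IAdd (slot d) (slot d) 4] ++ [:: IJmp p]) by exact: at6.
    have [R6 _] := run_straight (code_at_catl at7) S6.
    have at8 := code_at_catr at7; rewrite /= addn2 in at8.
    move: R6; set ms6 := State _ _ _ => R6.
    have R7 : run 1 ms6 = Some (State p (regs ms6) (Defs.mem ms6)).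
      by rewrite /= (step_at W (at8 : code_at (pc ms6) _)).
    have k6 : keeps d ms5 (State p (regs ms6) (Defs.mem ms6)).
      by rewrite /ms6; keeps.
    eexists; split.
    + rewrite big_ord_recr /=; apply: run_catE R3 _.
      have -> : cost V Bg c (setv (iteri j F s) x j) + 5 =
        1 + (1 + (cost V Bg c (setv (iteri j F s) x j) + (2 + 1))) by lia.
      exact: (run_catE (J3 : run 1 ms3 = _) (run_catE (J4 : run 1 _ = _)
        (run_catE R5 (run_catE (R6 : run 2 ms5 = _) (R7 : run 1 ms6 = _))))).
    + by [].
    + exact: keeps_represents k6 rep5.
    + by rewrite /= !(updE, slotE) (sl _ (ltnSn _)).
    + move=> i lti; case: k6 => -> //; move=> _ _ _; rewrite sl ?ss3 //; lia.
  have [ms3 [R3 p3 rep3 [sd sd1] ss3]] := loop n (leqnn n).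
  rewrite -p3 in atJ.
  have J3 : run 1 ms3 = Some (State (p + 1) (regs ms3) (Defs.mem ms3)).
    by rewrite /= (step_at W atJ) /= sd sd1 ltnn p3 addn1.
  have J4 : run 1 (State (p + 1) (regs ms3) (Defs.mem ms3)) =
      Some (State (pc ms + ecost e + 1 + 6 + csize c) (regs ms3) (Defs.mem ms3)).
    by rewrite /= (step_at W (atE : code_at (pc (State (p + 1) _ _)) _)) /= -p1.
  eexists; split.
  + set S := \sum_(i < n) _ in R3 *.
    have -> : ecost e + 3 + S = ecost e + (1 + (S + (1 + 1))) by lia.
    exact: (run_catE R1 (run_catE (R2 : run 1 ms1 = _) (run_catE R3
       (run_catE (J3 : run 1 ms3 = _) (J4 : run 1 _ = _))))).
  + by rewrite /=; lia.
  + exact: rep3.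
  + by move=> j lj; rewrite /= ss3 //; case: k2 => -> //; case: k1 => -> //; apply: ltnW.
Qed.
End Program.
End Correct.

(* Leaves a_n + 2 in register 0. *)
Definition head_code : seq instr :=
  [:: IConst 4 1; ILoad 0 3; IAdd 0 0 4; ILoad 0 0; IAdd 0 0 4; IAdd 0 0 4;
      IConst 1 1; IConst 2 1].

(** No instruction gives access to the word bound, so the powers V and Bg of a_n + 2 are computed
    from the input. *)
Definition preamble eV eB : seq instr :=
  head_code ++ nseq eV (IMul 1 1 0) ++ nseq eB (IMul 2 2 0).

Definition program eV eB kD c : seq instr :=
  preamble eV eB ++ ccomp (8 + (eV + eB)) 0 c ++ [:: IConst 4 kD; IMul 0 4 2; IHalt].

Lemma ewf_mono V V' K e : V <= V' -> ewf V K e -> ewf V' K e.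
Proof.
move=> le; elim: e => //= [k|k e IH|o e1 IH1 e2 IH2].
- by move=> lt; apply: leq_trans lt le.
- by case/andP=> -> /IH.
- by case/andP=> /IH1-> /IH2.
Qed.

(** The constants of a program are checked once against 2^eV, which does not depend on the instance
    and is at most V = (a_n + 2)^eV. *)
Lemma cwf_mono V V' K c : V <= V' -> cwf V K c -> cwf V' K c.
Proof.
move=> le; elim: c => //= [x e|k e1 e2|c1 IH1 c2 IH2|e1 e2 c1 IH1 c2 IH2|x e c IH].
- exact: ewf_mono.
- by case/and3P=> -> /(ewf_mono le)-> /(ewf_mono le)->.
- by case/andP=> /IH1-> /IH2.
- by case/and4P=> /(ewf_mono le)-> /(ewf_mono le)-> /IH1-> /IH2.
- by case/andP=> /(ewf_mono le)-> /IH.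
Qed.

Lemma straight_mul W r x e s : r != 0 -> regs s 0 = x -> x ^ e * regs s r < W -> 0 < x ->
  exists s', [/\ straight W (nseq e (IMul r r 0)) s = Some s',
    regs s' r = x ^ e * regs s r, forall i, i != r -> regs s' i = regs s i
    & Defs.mem s' = Defs.mem s].
Proof.
move=> r0 rx + x0; elim: e s rx => [|e IH] s rx ltW /=; first by exists s; rewrite mul1n.
rewrite rx ifT; last first.
  apply: leq_ltn_trans ltW; rewrite expnS mulnC leq_mul2r; apply/orP; right.
  by rewrite leq_pmulr // expn_gt0 x0.
rewrite eqxx; set s1 := State _ _ _.
have rx1 : regs s1 0 = x by rewrite /= /upd eq_sym (negPf r0).
have r1 : regs s1 r = regs s r * x by rewrite /= /upd eqxx.
have [|s' [-> e1 e2 e3]] := IH s1 rx1; first by rewrite r1 (mulnC _ x) mulnA -expnSr.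
exists s'; split=> //; first by rewrite e1 r1 (mulnC _ x) mulnA -expnSr.
by move=> i ni; rewrite e2 //= /upd (negPf ni).
Qed.

Lemma straight_cat W c1 c2 s s1 : straight W c1 s = Some s1 ->
  straight W (c1 ++ c2) s = straight W c2 s1.
Proof.
elim: c1 s => [|i c1 IH] s /=; first by case=> ->.
by case: istep => // s2; case: eqP => // _; apply: IH.
Qed.

Lemma start_straight W n m mm : 1 < W -> 0 < W -> n < W -> n + 1 < W ->
  m < W -> m + 1 < W -> m + 1 + 1 < W -> mm 0 = n -> mm n.+1 = m ->
  exists2 s1, straight W head_code (State 0 (fun=> 0) mm) = Some s1 &
    [/\ regs s1 1 = 1, regs s1 2 = 1, regs s1 3 = 0, regs s1 0 = m.+2
     & forall x, regs s1 (vreg x) = 0] /\ Defs.mem s1 = mm.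
Proof.
move=> l1 l0 ln ln1 la la1 la2 m0 m1.
rewrite /= l1 /= !updE /= l0 m0 ln /= !updE /= ln1 /= !updE /= ln1.
rewrite addn1 m1 la /= !updE /= la1 /= !updE /= la2 /=.
eexists; first reflexivity; split=> //; split; rewrite //= ?updE /= ?addn1 // => x.
rewrite !updE /vreg; do !case: eqP => //; lia.
Qed.

(** Array 0 overlays the input: cell 0 is n and cell i + 1 is a_i. Once Bg exceeds n + 1, all other
    arrays start at zero. *)
Definition init_store Bg n a :=
  Store (fun=> 0) (fun k i => Defs.mem (init_state n a) (k * Bg + i)).

Section Compile.
Variables (c : cmd) (eV eB K kD n : nat) (a : nat -> nat).
Hypothesis inst : instance n a.
Let M := (a n).+2.
Let V := M ^ eV.
Let Bg := M ^ eB.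
Let W := M ^ (2 * eV).
Hypotheses (c_wf : cwf (2 ^ eV) K c) (KV : K <= 2 ^ eV) (ltk : kD < K)
  (eVB : eB < eV) (eV2 : 1 < eV).

(** The 11 extra steps are the 8 of [head_code] and the 3 at the end, which put the address of array
    kD into register 0 and halt. *)
Lemma program_correct :
  exists T s, [/\ exec W (program eV eB kD c) T (init_state n a) = Some s,
    T = cost V Bg c (init_store Bg n a) + (11 + (eV + eB))
    & forall i, i < Bg -> Defs.mem s (regs s 0 + i) = arr (sem V Bg c (init_store Bg n a)) kD i].
Proof.
have M2 : 2 <= M by [].
have MV : M < V by rewrite -{1}[M]expn1 ltn_exp2l.
have VW : V * V <= W by rewrite -expnD addnn -mul2n.
have leVW : V < W by apply: leq_trans VW; rewrite -{1}[V]muln1 ltn_pmul2l; lia.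
have VE : 2 ^ eV <= V by rewrite leq_exp2r //; apply: ltnW.
have KV' : K <= V := leq_trans KV VE.
have BV : Bg <= V by rewrite leq_exp2l //; apply: ltnW.
have BgW : K * Bg <= W by apply: leq_trans VW; rewrite leq_mul.
have Bg0 : 0 < Bg by rewrite expn_gt0.
have ge_n := inst_ge inst (leqnn n).
set P := program _ _ _ _; set s0 := init_state n a.
have at0 : code_at P 0 P by split.
have at1 := code_at_catl at0; have at2 := code_at_catr at0.
have szp : size (preamble eV eB) = 8 + (eV + eB) by rewrite !size_cat !size_nseq.
rewrite szp add0n in at2.
have lt1 z : z < V -> z < W by move=> lz; apply: ltn_trans lz leVW.
have l1 : 1 < W by apply: lt1; lia.
have l0 : 0 < W by lia.
have ln : n < W by apply: lt1; rewrite /M in MV; lia.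
have ln1 : n + 1 < W by apply: lt1; rewrite /M in MV; lia.
have la : a n < W by apply: lt1; rewrite /M in MV; lia.
have la1 : a n + 1 < W by apply: lt1; rewrite /M in MV; lia.
have la2 : a n + 1 + 1 < W by apply: lt1; rewrite /M in MV; lia.
have [|s1 S1 [[q1 q2 q3 q0 qx] qm]] := start_straight l1 l0 ln ln1 la la1 la2 (erefl : Defs.mem s0 0 = n).
  by rewrite /= leqnn.
have [|s2 [S2 r2 k2 m2]] := @straight_mul W 1 M eV s1 isT q0 _ isT.
  by rewrite q1 muln1.
have q02 : regs s2 0 = M by rewrite k2.
have [|s3 [S3 r3 k3 m3]] := @straight_mul W 2 M eB s2 isT q02 _ isT.
  by rewrite k2 // q2 muln1; apply: leq_ltn_trans BV leVW.
have Spre : straight W (preamble eV eB) s0 = Some s3.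
  rewrite (straight_cat _ S1) (straight_cat _ S2) //.
have [Rpre pcpre] := run_straight (s := s0) at1 Spre.
have pc0 : pc s0 = 0 by [].
rewrite szp in Rpre; rewrite szp pc0 add0n in pcpre.
have rep : represents V Bg K (init_store Bg n a) s3.
  split=> [x||||k i _ _] /=.
  - have n1 : vreg x != 1 by apply/eqP; rewrite /vreg; lia.
    have n2 : vreg x != 2 by apply/eqP; rewrite /vreg; lia.
    by rewrite -/(vreg x) k3 // k2 // qx.
  - by rewrite k3 // r2 q1 muln1.
  - by rewrite r3 k2 // q2 muln1.
  - by rewrite k3 // k2.
  - by rewrite m3 m2 qm.
have bs : bounded V (init_store Bg n a).
  split=> [x|k i] /=; first lia.
  case: ifP => _; first by rewrite /M in MV; lia.
  case: ifP => // le; last lia.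
  apply: leq_ltn_trans (_ : a n < V); last by rewrite /M in MV; lia.
  by apply: (inst_le inst); move: le; case: (k * Bg + i).
rewrite -pcpre in at2.
have [s4 [R4 p4 rep4 _]] := ccomp_correct (V:=V) (Bg:=Bg) (K:=K) (W:=W) (ltn_trans M2 MV) VW Bg0 BgW KV' (cwf_mono VE c_wf) bs rep (code_at_catl at2).
have at3 := code_at_catr at2; rewrite size_ccomp -p4 in at3.
have [r4 r41 r42 r43 m4] := rep4.
have at4 : code_at P (pc s4) ([:: IConst 4 kD; IMul 0 4 2] ++ [:: IHalt]) by exact: at3.
have S5 : straight W [:: IConst 4 kD; IMul 0 4 2] s4 = Some (State (pc s4).+2 (upd (upd (regs s4) 4 kD) 0 (kD * Bg)) (Defs.mem s4)).
  have lk : kD < W by apply: lt1; apply: leq_trans ltk KV'.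
  have lkB : kD * Bg < W by apply: leq_trans BgW; rewrite ltn_pmul2r.
  by rewrite /= lk /= eqxx !updE /= r42 lkB /= eqxx.
have [R5 p5] := run_straight (code_at_catl at4) S5.
have at5 := code_at_catr at4; rewrite -p5 in at5.
have halt := step_at W at5.
exists (cost V Bg c (init_store Bg n a) + (11 + (eV + eB))); eexists; split; [|by []|].
  have -> : cost V Bg c (init_store Bg n a) + (11 + (eV + eB)) =
    8 + (eV + eB) + (cost V Bg c (init_store Bg n a) + (2 + 1)) by lia.
  by rewrite (exec_run _ Rpre) (exec_run _ R4) (exec_run _ (R5 : run W P 2 s4 = _)) /= halt.
by move=> i ltB /=; rewrite -m4.
Qed.
End Compile.

(** * Program logic: frames and costs *)

Fixpoint wv c : seq nat :=
  match c with
  | Skip | Sto _ _ _ => [::]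
  | Asn x _ => [:: x]
  | Seq c1 c2 | Ite _ _ c1 c2 => wv c1 ++ wv c2
  | For x _ c => x :: wv c
  end.

Fixpoint wa c : seq nat :=
  match c with
  | Skip | Asn _ _ => [::]
  | Sto k _ _ => [:: k]
  | Seq c1 c2 | Ite _ _ c1 c2 => wa c1 ++ wa c2
  | For x _ c => wa c
  end.

(* A variant of the semantics of loop-free commands on which [cbv] can be run:
   reducing [sem] by [simpl] duplicates the store at every assignment. *)
Definition fsetv s x v := Store (fun y => if eqn y x then v else var s y) (arr s).
Definition fseta s k i v :=
  Store (var s) (fun k' => if eqn k' k then upd (arr s k) i v else arr s k').

Fixpoint fsem V Bg c s :=
  match c with
  | Skip | For _ _ _ => s
  | Asn x e => fsetv s x (eval V Bg e s)
  | Sto k e1 e2 => fseta s k (eval V Bg e1 s %% Bg) (eval V Bg e2 s)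
  | Seq c1 c2 => fsem V Bg c2 (fsem V Bg c1 s)
  | Ite e1 e2 c1 c2 => if eval V Bg e1 s < eval V Bg e2 s then fsem V Bg c1 s else fsem V Bg c2 s
  end.

Definition agree c s t :=
  (forall y, y \notin wv c -> var t y = var s y) /\ (forall k, k \notin wa c -> arr t k = arr s k).

(* Meaningful on loop-free commands only: loops are counted as free. *)
Fixpoint flat_cost c :=
  match c with
  | Skip | For _ _ _ => 0
  | Asn x e => ecost e + 1
  | Sto k e1 e2 => ecost e1 + ecost e2 + 5
  | Seq c1 c2 => flat_cost c1 + flat_cost c2
  | Ite e1 e2 c1 c2 => ecost e1 + ecost e2 + 2 + flat_cost c1 + flat_cost c2
  end.

Fixpoint flat c :=
  match c with
  | Skip | Asn _ _ | Sto _ _ _ => true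
  | For _ _ _ => false
  | Seq c1 c2 | Ite _ _ c1 c2 => flat c1 && flat c2
  end.

Lemma fsemE V Bg c s : flat c -> sem V Bg c s = fsem V Bg c s.
Proof.
elim: c s => //= [c1 IH1 c2 IH2|e1 e2 c1 IH1 c2 IH2] s /andP[f1 f2].
  by rewrite IH1 ?IH2.
by rewrite IH1 ?IH2.
Qed.

Section Logic.
Variables V Bg : nat.
Local Notation eval := (eval V Bg).
Local Notation sem := (sem V Bg).
Local Notation cost := (cost V Bg).

Lemma flat_costP c s : flat c -> cost c s <= flat_cost c.
Proof.
elim: c s => //= [c1 IH1 c2 IH2|e1 e2 c1 IH1 c2 IH2] s /andP[f1 f2].
  by rewrite leq_add ?IH1 ?IH2.
by case: ifP => _; have := IH1 s f1; have := IH2 s f2; lia.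
Qed.

Lemma agree_sem c s : agree c s (sem c s).
Proof.
elim: c s => [|x e|k e1 e2|c1 IH1 c2 IH2|e1 e2 c1 IH1 c2 IH2|x e c IH] s //=.
- by split=> //= y; rewrite inE /upd => /negPf->.
- by split=> //= y; rewrite inE => /negPf->.
- split=> y; rewrite mem_cat negb_or => /andP[n1 n2].
    by rewrite (IH2 _).1 ?(IH1 _).1.
  by rewrite (IH2 _).2 ?(IH1 _).2.
- by split=> y; rewrite mem_cat negb_or => /andP[n1 n2];
    case: ifP => _; rewrite ?(IH1 _).1 ?(IH2 _).1 ?(IH1 _).2 ?(IH2 _).2.
- elim: (eval e s) => //= j [IHv IHa]; split=> [y|k nk].
    rewrite inE negb_or => /andP[nx ny]; rewrite (IH _).1 //= /upd (negPf nx).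
    by rewrite IHv // inE negb_or nx.
  by rewrite (IH _).2 //= IHa.
Qed.

Lemma for_rule_sum x e c s n (I : nat -> store -> Prop) (T : nat -> nat) :
  eval e s = n -> I 0 s ->
  (forall j t, j < n -> I j t -> agree (For x e c) s t ->
    I j.+1 (sem c (setv t x j)) /\ cost c (setv t x j) <= T j) ->
  I n (sem (For x e c) s) /\
  cost (For x e c) s <= ecost e + 3 + \sum_(j < n) (T j + 5).
Proof.
move=> <- I0 IS /=; set F := (fun j t => _).
have fr j : agree (For x e c) s (iteri j F s).
  elim: j => //= j [IHv IHa]; split=> [y|k nk].
    rewrite inE negb_or => /andP[nx ny]; rewrite (agree_sem _ _).1 //= /upd (negPf nx).
    by rewrite IHv // inE negb_or nx.
  by rewrite (agree_sem _ _).2 //= IHa.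
have It j : j <= eval e s -> I j (iteri j F s).
  elim: j => // j IHj ltj; exact: (IS _ _ ltj (IHj (ltnW ltj)) (fr j)).1.
split; first exact: It.
rewrite leq_add2l; apply: leq_sum => j _; rewrite leq_add2r.
exact: (IS _ _ (ltn_ord j) (It _ (ltnW (ltn_ord j))) (fr j)).2.
Qed.

Lemma for_rule x e c s n (I : nat -> store -> Prop) T :
  eval e s = n -> I 0 s ->
  (forall j t, j < n -> I j t -> agree (For x e c) s t ->
    I j.+1 (sem c (setv t x j)) /\ cost c (setv t x j) <= T) ->
  I n (sem (For x e c) s) /\
  cost (For x e c) s <= ecost e + 3 + n * (T + 5).
Proof.
move=> eE I0 IS; have [In] := for_rule_sum (T := fun _ => T) eE I0 IS.
by rewrite sum_nat_const card_ord.
Qed.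

Definition clog_body :=
  Ite (Var 62) (Var 60)
    (Seq (Asn 62 (Bin OMul (Var 62) (Cst 2))) (Asn 61 (Bin OAdd (Var 61) (Cst 1)))) Skip.
(** Loops have a fixed number of rounds, so the body runs X times and idles once the power has
    reached X. The linear cost is affordable: X is m or the bound B. *)
Definition clog :=
  Seq (Asn 62 (Cst 1)) (Seq (Asn 61 (Cst 0)) (For 63 (Var 60) clog_body)).

Lemma clogP s : 2 * var s 60 < V ->
  var (sem clog s) 61 = up_log 2 (var s 60) /\ cost clog s <= 30 * (var s 60).+1.
Proof.
set X := var s 60 => XV.
pose s1 := setv (setv s 62 1) 61 0.
have [] := @for_rule 63 (Var 60) clog_body s1 X
  (fun j t => [/\ var t 62 = 2 ^ var t 61, var t 61 <= up_log 2 X, var t 61 <= j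
     & var t 61 = j \/ X <= var t 62]) 20.
- by [].
- by split=> //; left.
- move=> j t ltj [ep lJ Jj dn] [fv _].

  have ex : var t 60 = X by rewrite fv.
  split; last by apply: leq_trans (flat_costP _ _) _.
  rewrite /= !updE /= ex.
  have [lt|le] := ltnP (var t 62) X; last by split=> //; [exact: leqW | right].
  have lJ' : var t 61 < up_log 2 X.
    by rewrite -(ltn_exp2l _ _ (ltnSn 1)) -ep; apply: leq_trans lt (up_logP _ _).
  have eJ : var t 61 = j by case: dn => //; lia.
  rewrite /= !updE /= addn1 !modn_small; [|lia|lia].
  by split; rewrite ?expnSr ?ep ?eJ //; [rewrite -eJ | left].
move=> -[ep lJ Jj dn] cst; split; last first.
  change (is_true (2 + (2 + cost (For 63 (Var 60) clog_body) s1) <= 30 * X.+1)).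
  by move: cst; rewrite [ecost _]/=; lia.
change (var (sem (For 63 (Var 60) clog_body) s1) 61 = up_log 2 X).
apply/eqP; rewrite eqn_leq lJ /=; apply: up_log_min => //.
case: dn => [->|]; [exact/ltnW/ltn_expl | by rewrite ep].
Qed.
End Logic.

(** * The round-robin algorithm *)

Section Cycles.
Variables (a0 x L : nat).
(** L is the order of x in Z/a_0; the a_0 / L = gcd(a_0, x) cycles of +x have length L. *)
Hypotheses (a00 : 0 < a0) (L0 : 0 < L) (Lx : a0 %| L * x)
  (Lmin : forall k, 0 < k < L -> ~~ (a0 %| k * x)).

Definition pos c j := (c + j * x) %% a0.
Let g := a0 %/ L.

Lemma cycle_dvd : L %| a0.
Proof.
apply: contraT => nd; have r0 : 0 < a0 %% L by rewrite lt0n.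
have /Lmin/negP[] : 0 < a0 %% L < L by rewrite r0 ltn_pmod.
have : a0 %| a0 * x by apply: dvdn_mulr.
by rewrite {2}(divn_eq a0 L) mulnDl -mulnA dvdn_addr // dvdn_mull.
Qed.

Lemma cycle_mul : g * L = a0. Proof. exact: divnK cycle_dvd. Qed.

Lemma cycle_dvdx : g %| x.
Proof. by move: Lx; rewrite -cycle_mul mulnC dvdn_pmul2l. Qed.

(** Since g divides a_0 and x, the residue modulo g is constant along a cycle; different c below g
    thus give disjoint cycles. *)
Lemma pos_mod c j : c < g -> pos c j %% g = c.
Proof.
move=> lt; rewrite /pos modn_dvdm; last by rewrite -cycle_mul dvdn_mulr.
by rewrite -modnDmr (eqP (dvdn_mull j cycle_dvdx)) addn0 modn_small.
Qed.

Lemma pos_lt c j : pos c j < a0. Proof. by rewrite ltn_pmod. Qed.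

Lemma posS c j : (pos c j + x) %% a0 = pos c j.+1.
Proof. by rewrite /pos modnDml -addnA -mulSnr. Qed.

Lemma pos_eq c j k : (pos c (j + k) == pos c j) = (L %| k).
Proof.
rewrite /pos mulnDl addnA -{2}[c + j * x]addn0 eqn_modDl mod0n.
apply/idP/idP => [d|/dvdnP[q ->]]; last by rewrite -mulnA; apply: dvdn_mull.
apply: contraT => nd; have r0 : 0 < k %% L by rewrite lt0n.
have /Lmin/negP[] : 0 < k %% L < L by rewrite r0 ltn_pmod.
have : a0 %| k * x by [].
by rewrite {1}(divn_eq k L) mulnDl -mulnA dvdn_addr // dvdn_mull.
Qed.

Lemma pos_modL c j : pos c (j %% L) = pos c j.
Proof.
by apply/esym/eqP; rewrite {1}(divn_eq j L) addnC pos_eq dvdn_mull.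
Qed.

(** The pairs (c, j) are g L = a_0 in number and have distinct positions, so they reach every
    residue. *)
Lemma pos_surj r : r < a0 -> exists c j, [/\ c < g, j < L & pos c j = r].
Proof.
move=> ltr; pose f (u : 'I_g * 'I_L) : 'I_a0 := Ordinal (pos_lt u.1 u.2).
have finj : injective f.
  move=> [c j] [c' j'] /(congr1 val) /= e.
  have ec : c = c' :> nat by rewrite -(pos_mod j (ltn_ord c)) e pos_mod.
  rewrite ec in e.
  have ej : j = j' :> nat.
    wlog le : j j' e / j <= j'.
      by move=> H; case/orP: (leq_total j j') => h; [exact: H | exact/esym/H].
    move/esym/eqP: e; rewrite -(subnKC le) pos_eq => /dvdn_leq.
    by have := ltn_ord j'; have := ltn_ord j; lia.
  by congr pair; apply: val_inj.
have [|h _ hK] := @inj_card_bij _ _ f finj; first by rewrite card_prod !card_ord cycle_mul.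
exists (h (Ordinal ltr)).1, (h (Ordinal ltr)).2; split=> //.
by have /(congr1 val) := hK (Ordinal ltr).
Qed.

Variables (S : nat -> nat -> Prop) (INF : nat).
(** S r v is the soundness of a value v stored at residue r. INF marks a missing value, so soundness
    is propagated only from values below it. *)
Hypothesis S_step : forall r v, r < a0 -> S r v -> v < INF -> S ((r + x) %% a0) (v + x).

Section Relax.
Variables (c p : nat) (f0 : nat -> nat).
Let q j := pos c (p + j).
Hypothesis f0_inf : forall r, f0 r <= INF.

(** A tour along the cycle from q 0, with its first j edges relaxed. The fourth clause makes q 0 the
    place of the least value: the last edge, back to q 0, can then never improve it, so a single
    tour closes the cycle. *)
Definition relaxed j f :=
  [/\ forall r, f r <= f0 r, forall r, (forall i, r != q i) -> f r = f0 r,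
      forall r, r < a0 -> S r (f r), forall i, f0 (q 0) <= f (q i)
    & forall i, i < j -> f (q i.+1) <= f (q i) + x].

Lemma relaxed_step j f : j < L -> relaxed j f ->
  relaxed j.+1 (if f (q j) + x < f (q j.+1) then upd f (q j.+1) (f (q j) + x) else f).
Proof.
move=> ltj [fle fout fS fmin fcl]; case: ltnP => [lt|le]; last first.
  by split=> // i; rewrite ltnS leq_eqVlt => /orP[/eqP->|/fcl].
have ltj1 : j.+1 < L.
  rewrite ltn_neqAle ltj andbT; apply/eqP => e; move: lt; rewrite {1}/q.
  have -> : f (q j.+1) = f (q 0).
    congr f; apply/eqP; rewrite /q addn0 e pos_eq //.
  by have := fle (q 0); have := fmin j; rewrite /q; lia.
have nq i : i <= j -> q i == q j.+1 = false.
  move=> lei; apply/negP; rewrite eq_sym /q.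
  have -> : p + j.+1 = p + i + (j.+1 - i) by lia.
  rewrite pos_eq => /dvdn_leq; lia.
split=> [r|r nr|r ltr|i|i]; rewrite ?updE.
- by case: eqP => // ->; apply: leq_trans (fle _); apply: ltnW.
- by rewrite (negPf (nr _)) fout.
- case: eqP => [->|_]; last exact: fS.
  rewrite /q addnS -posS; apply: S_step; [exact: pos_lt | exact/fS/pos_lt |].
  apply: leq_ltn_trans (leq_addr x _) _; apply: leq_trans lt _.
  exact: leq_trans (fle _) (f0_inf _).
- case: eqP => _ //; exact: leq_trans (fmin j) (leq_addr _ _).
- rewrite ltnS leq_eqVlt => /orP[/eqP->|lti]; first by rewrite eqxx nq.
  by rewrite !nq ?(ltnW lti) //; apply: fcl.
Qed.

Lemma relaxed_closed f : relaxed L f -> forall i, f (pos c i.+1) <= f (pos c i) + x.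
Proof.
move=> [_ _ _ _ cl] i.
(* k is i - p modulo L; the multiple of L keeps the truncated subtraction exact. *)
pose k := i + p * L - p.
have kE : p + k = i + p * L by rewrite /k subnKC // (leq_trans (leq_pmulr _ L0)) ?leq_addl.
have e1 j : pos c (p + (k + j) %% L) = pos c (i + j).
  by rewrite -pos_modL modnDmr addnA kE addnAC pos_modL -[in RHS]pos_modL -(modnMDl p (i + j) L) addnC pos_modL.
have := cl (k %% L) (ltn_pmod _ L0); rewrite /q.
have := e1 0; rewrite !addn0 => ->.
have -> : pos c (p + (k %% L).+1) = pos c i.+1.
  rewrite -pos_modL -[RHS]pos_modL addnS -addSn modnDmr addSn kE -addSn addnC.
  by rewrite modnMDl.
by [].
Qed.
End Relax.
End Cycles.

(** * The round-robin code *)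

Definition period_body :=
  Seq (Asn 17 (Bin OSub (Var 2) (Var 13)))
      (Ite (Bin OMod (Bin OMul (Var 17) (Var 11)) (Var 2)) (Cst 1) (Asn 12 (Var 17)) Skip).
(** Candidates a_0, a_0 - 1, ..., 1 are tried downwards, so the last one recorded is the order of x;
    the first, a_0 itself, always qualifies, hence register 12 is set. *)
Definition period := For 13 (Var 2) period_body.

Definition pos_expr i := Bin OMod (Bin OAdd (Var 14) (Bin OMul (Var i) (Var 11))) (Var 2).

Definition argmin_body :=
  Seq (Asn 17 (Get 7 (pos_expr 13)))
      (Ite (Var 17) (Var 15) (Seq (Asn 15 (Var 17)) (Asn 16 (Var 13))) Skip).
Definition relax_body :=
  Seq (Asn 18 (Bin OMod (Bin OAdd (Var 17) (Var 11)) (Var 2)))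
  (Seq (Asn 19 (Bin OAdd (Get 7 (Var 17)) (Var 11)))
  (Seq (Ite (Var 19) (Get 7 (Var 18)) (Sto 7 (Var 18) (Var 19)) Skip)
       (Asn 17 (Var 18)))).
Definition cycle_body :=
  Seq (Asn 15 (Var 21)) (Seq (Asn 16 (Cst 0)) (Seq (For 13 (Var 12) argmin_body)
  (Seq (Asn 17 (pos_expr 16)) (For 13 (Var 12) relax_body)))).
(** Round i treats a_(i+1), which sits in cell i + 2 of the input; a_0 is the modulus. *)
Definition gen_body :=
  Seq (Asn 11 (Get 0 (Bin OAdd (Var 10) (Cst 2))))
  (Seq period (For 14 (Bin ODiv (Var 2) (Var 12)) cycle_body)).
Definition round_robin :=
  Seq (For 20 (Var 2) (Sto 7 (Var 20) (Var 21)))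
  (Seq (Sto 7 (Cst 0) (Cst 0)) (For 10 (Var 0) gen_body)).

Section RoundRobin.
Variables (V Bg : nat).
Local Notation eval := (eval V Bg).
Local Notation sem := (sem V Bg).
Local Notation cost := (cost V Bg).
Variables (a0 x INF : nat).
Hypotheses (a00 : 0 < a0) (a0B : a0 <= Bg) (xV : a0 * x + a0 + x < V) (INFV : INF + x < V).

Let max1 k : 0 < k -> maxn 1 k = k. Proof. by lia. Qed.

Lemma periodP s : var s 2 = a0 -> var s 11 = x ->
  let L := var (sem period s) 12 in
  [/\ 0 < L <= a0, a0 %| L * x, forall k, 0 < k < L -> ~~ (a0 %| k * x)
    & cost period s <= 30 * a0.+1].
Proof.
move=> ea ex /=.
have [||j t ltj It [fv _]|] := @for_rule V Bg 13 (Var 2) period_body s a0 (fun j t =>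
  0 < j -> let L := var t 12 in
  [/\ 0 < L <= a0, a0 - j < L, a0 %| L * x
    & forall k, a0 - j < k < L -> ~~ (a0 %| k * x)]) 20.
- by [].
- by [].
- have e2 : var t 2 = a0 by rewrite fv.
  have e11 : var t 11 = x by rewrite fv.
  split; last by apply: leq_trans (flat_costP _ _ _ _) _.
  move=> _; rewrite /= !updE /= e2 e11 max1 // [_ * _ %% V]modn_small; last first.
    by apply: leq_ltn_trans xV; nia.
  have [d|nd] := boolP (a0 %| (a0 - j) * x).
    rewrite (eqP d) /= !updE /=; split=> //; [lia|lia|lia].
  have nd' : ~~ ((a0 - j) * x %% a0 < 1) by move: nd; rewrite /dvdn; case: (_ %% _).
  rewrite (negPf nd') /= !updE /=.
  have j0 : 0 < j.
    by case: (j) nd => [|//]; rewrite subn0 dvdn_mulr.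
  have [L1 L2 L3 L4] := It j0; split=> //; first lia.
  move=> k /andP[k1 k2]; case: (ltnP (a0 - j) k) => h; first by apply: L4; rewrite h.
  by have -> : k = a0 - j by lia.
- move=> /(_ a00)[L1 _ L3 L4] cst; split=> //.
    by move=> k k0; apply: L4; rewrite subnn.
  by apply: leq_trans cst _; rewrite /=; lia.
Qed.

Variables (S : nat -> nat -> Prop).
Hypothesis S_step : forall r v, r < a0 -> S r v -> v < INF -> S ((r + x) %% a0) (v + x).

Section OneCycle.
Variables (L c : nat).
Hypotheses (L0 : 0 < L <= a0) (Lx : a0 %| L * x)
  (Lmin : forall k, 0 < k < L -> ~~ (a0 %| k * x)) (ltc : c < a0).
Local Notation pos := (pos a0 x c).

Let B_pos j : pos j %% Bg = pos j.
Proof. by rewrite modn_small // (leq_trans _ a0B) // ltn_pmod. Qed.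

Let posE j : j <= L -> (c + (j * x) %% V) %% V %% a0 = pos j.
Proof.
move=> lej; have [_ La] := andP L0; rewrite /pos.
have h : c + j * x < V.
  by apply: leq_ltn_trans xV; have := leq_mul (leq_trans lej La) (leqnn x); lia.
by rewrite (modn_small (leq_ltn_trans (leq_addl c _) h)) (modn_small h).
Qed.

Lemma cycleP s : var s 2 = a0 -> var s 11 = x -> var s 12 = L -> var s 14 = c -> var s 21 = INF ->
  (forall r, arr s 7 r <= INF) -> (forall r, r < a0 -> S r (arr s 7 r)) ->
  let D' := arr (sem cycle_body s) 7 in
  [/\ forall r, D' r <= arr s 7 r, forall r, (forall i, r != pos i) -> D' r = arr s 7 r,
      forall r, r < a0 -> S r (D' r), forall i, D' (pos i.+1) <= D' (pos i) + x
    & cost cycle_body s <= 200 * L].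
Proof.
move=> e2 e11 e12 e14 e21 Dinf DS; set D := arr s 7 in Dinf DS *.
have [L1 La] := andP L0.
set s1 := setv (setv s 15 (var s 21)) 16 0.
have [|| j t ltj [Dt m1 m2 m3] [fv fa]|] := @for_rule V Bg 13 (Var 12) argmin_body s1 L (fun j t =>
  (* Only an inequality: register 15 starts at INF, which bounds all values, while the initial index
     0 need not attain it. *)
  [/\ arr t 7 = D, D (pos (var t 16)) <= var t 15, forall i, i < j -> var t 15 <= D (pos i)
    & var t 16 < L]) 40.
- by [].
- by split=> //; rewrite /= !updE /= e21; apply: Dinf.
- have [t2 [t11 t14]] : var t 2 = a0 /\ var t 11 = x /\ var t 14 = c by rewrite !fv.
  split; last by apply: leq_trans (flat_costP _ _ _ _) _.
  rewrite /= !updE /= t2 t11 t14 max1 // posE ?(ltnW ltj) // B_pos Dt.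
  case: ltnP => h; rewrite /= !updE /= ?Dt; split=> // i; rewrite ltnS leq_eqVlt.
    by case/orP=> [/eqP->//|/m2]; lia.
  by case/orP=> [/eqP->//|/m2].
move=> [Dt m1 m2 m3] cst1; set s2 := sem _ s1 in Dt m1 m2 m3 cst1 *.
have [fv fa] : agree (For 13 (Var 12) argmin_body) s1 s2 by apply: agree_sem.
set p := var s2 16 in m1 m3.
have Ep : eval (pos_expr 16) s2 = pos p.
  rewrite /= -/p.
  have [-> [-> ->]] : var s2 2 = a0 /\ var s2 11 = x /\ var s2 14 = c by rewrite !fv.
  by rewrite max1 // posE // ltnW.
set s3 := setv s2 17 (pos p).
pose q j := pos (p + j).
have f0min i : D (q 0) <= D (q i).
  rewrite /q addn0 -(pos_modL L1 Lx Lmin c (p + i)).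
  by apply: leq_trans m1 (m2 _ _); rewrite ltn_pmod.
have [|| j t ltj [et rt] [fv2 fa2]|] := @for_rule V Bg 13 (Var 12) relax_body s3 L (fun j t =>
  var t 17 = q j /\ relaxed a0 x S c p D j (arr t 7)) 60.
- by rewrite -e12 -[RHS](fv 12).
- split; first by rewrite /= /q addn0.
  by rewrite [arr s3 7]Dt; split.
- split; last by apply: leq_trans (flat_costP _ _ _ _) _.
  have t2 : var t 2 = a0 by rewrite fv2 // [var s3 _]fv.
  have t11 : var t 11 = x by rewrite fv2 // [var s3 _]fv.
  have step := relaxed_step a00 L1 Lx Lmin S_step Dinf ltj rt.
  have [rt1 _ _ _ _] := rt.
  have a0V : a0 + x < V by lia.
  have eD : (arr t 7 (q j) + x) %% V = arr t 7 (q j) + x.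
    by rewrite modn_small //; have := rt1 (q j); have := Dinf (q j); lia.
  have eq1 : (q j + x) %% V %% a0 = q j.+1.
    have qa : q j < a0 := ltn_pmod _ a00.
    have h : q j + x < V by lia.
    by rewrite (modn_small h) /q posS addnS.
  split; first by rewrite /= !updE /= et t2 t11 max1 // eq1; case: ifP.
  move: step; rewrite /= !updE /= ?updE /= et t2 t11 max1 // eq1 !B_pos eD.
  by case: ltnP => _; rewrite /= ?updE.
move=> [_ rt] cst2.
have -> : sem cycle_body s = sem (For 13 (Var 12) relax_body) s3 by rewrite /s3 -Ep.
have cE : cost cycle_body s = 2 + (2 + (cost (For 13 (Var 12) argmin_body) s1 +
    (ecost (pos_expr 16) + 1 + cost (For 13 (Var 12) relax_body) s3))) by rewrite /s3 -Ep.
rewrite {}cE; have [rt1 rt2 rt3 rt4 rt5] := rt.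
split=> //.
- by move=> r nr; apply: rt2 => i; apply: nr.
- exact: relaxed_closed rt.
move: cst1 cst2; rewrite ![ecost _]/=.
move: (cost _ s1) (cost _ s3) => C1 C2; lia.
Qed.
End OneCycle.

(** The cycles are disjoint, so later ones leave the closed edges of earlier ones intact; g cycles
    at cost O(L) take O(g L) = O(a_0) together. *)
Lemma genP s : var s 2 = a0 -> var s 21 = INF -> arr s 0 ((var s 10 + 2) %% V %% Bg) = x ->
  (forall r, arr s 7 r <= INF) -> (forall r, r < a0 -> S r (arr s 7 r)) ->
  let D' := arr (sem gen_body s) 7 in
  [/\ forall r, D' r <= arr s 7 r, forall r, r < a0 -> S r (D' r),
      forall r, r < a0 -> D' ((r + x) %% a0) <= D' r + x
    & cost gen_body s <= 500 * a0].
Proof.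
move=> e2 e21 ex Dinf DS; set s1 := setv s 11 x.
have [] := periodP (s := s1) e2 erefl.
set s2 := sem period s1; set L := var s2 12 => L0 Lx Lmin cst1.
have [fv1 fa1] : agree period s1 s2 by apply: agree_sem.
have [L1 La] := andP L0.
have g2 : eval (Bin ODiv (Var 2) (Var 12)) s2 = a0 %/ L.
  by rewrite /= -/L [var s2 2]fv1 // [var s1 2]e2 max1.
have gle : a0 %/ L <= a0 := leq_div _ _.
have gL : a0 %/ L * L = a0 by apply: cycle_mul Lmin.
have [|| c t ltc [t1 t2 t3] [fv fa]|] := @for_rule V Bg 14 (Bin ODiv (Var 2) (Var 12)) cycle_body s2
  (a0 %/ L) (fun c t => [/\ forall r, arr t 7 r <= arr s 7 r, forall r, r < a0 -> S r (arr t 7 r)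
   & forall c' i, c' < c -> arr t 7 (pos a0 x c' i.+1) <= arr t 7 (pos a0 x c' i) + x]) (200 * L).
- by [].
- by rewrite fa1.
- have ltca : c < a0 by apply: leq_trans ltc gle.
  have [|||||||c1 c2 c3 c4 c5] := @cycleP L c L0 Lx Lmin ltca (setv t 14 c).
  + by rewrite [LHS]fv // fv1.
  + by rewrite [LHS]fv // fv1.
  + by rewrite [LHS]fv.
  + by [].
  + by rewrite [LHS]fv // fv1.
  + by move=> r; apply: leq_trans (t1 r) _.
  + exact: t2.
  split; last exact: c5.
  split=> // [r|c' i]; first exact: leq_trans (c1 r) (t1 r).
  rewrite ltnS leq_eqVlt => /orP[/eqP->|ltc']; first exact: c4.
  have out j k : pos a0 x c' j != pos a0 x c k.
    apply/eqP => /(congr1 (modn^~ (a0 %/ L))).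
    rewrite !(pos_mod L1 Lx Lmin) ?(ltn_trans ltc' ltc) //.
    by move=> e; rewrite e ltnn in ltc'.
  by rewrite !c2 // t3.
move=> [t1 t2 t3] cst2.
have sE : sem gen_body s = sem (For 14 (Bin ODiv (Var 2) (Var 12)) cycle_body) s2.
  by rewrite /s2 /s1 -ex.
have cE : cost gen_body s = 10 + (cost period s1 +
   cost (For 14 (Bin ODiv (Var 2) (Var 12)) cycle_body) s2) by rewrite /s2 /s1 -ex.
rewrite sE cE; split=> //.
- move=> r ltr; have [c [j [ltc _ <-]]] := pos_surj a00 L1 Lx Lmin ltr.
  by rewrite posS; apply: t3.
move: cst1 cst2; rewrite [ecost _]/=.
move: (cost _ s1) (cost _ s2) => C1 C2; nia.
Qed.
End RoundRobin.

Section Whole.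
Variables (V Bg n : nat) (a : nat -> nat).
Hypothesis inst : instance n a.
Variable INF : nat.
Let a0 := a 0.
Let m := a n.
Hypotheses (mB : m.+2 <= Bg) (BV : Bg <= V) (mV : 3 * m * m < V) (INFV : INF + m < V).
Hypothesis INF_large : (2 * m %/ n.+1) * m + a0 <= INF.
Local Notation sem := (sem V Bg).
Local Notation cost := (cost V Bg).

Let sound i r v := v < INF -> v = r %[mod a0] /\ feasible i a v.

Lemma feasibleS i t : feasible i a t -> feasible i.+1 a t.
Proof.
move=> [y <-]; exists (fun j => if j == i.+1 then 0 else y j).
rewrite big_ord_recr /= eqxx muln0 addn0; apply: eq_bigr => j _.
by rewrite ltn_eqF //= ltnW // ltnS ltn_ord.
Qed.

Lemma feasible_recr i t : feasible i.+1 a t ->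
  exists k u, feasible i a u /\ t = u + k * a i.+1.
Proof.
move=> [y <-]; exists (y i.+1), (\sum_(j < i.+1) a j * y j); split; first by exists y.
by rewrite big_ord_recr /= mulnC.
Qed.

Lemma round_robinP s : var s 0 = n -> var s 2 = a0 -> var s 21 = INF ->
  (forall i, i <= n -> arr s 0 i.+1 = a i) -> (forall r, arr s 7 r = 0) ->
  (forall i, i < a0 -> is_target n a i (arr (sem round_robin s) 7 i)) /\
  cost round_robin s <= 1000 * (n.+1 * a0).
Proof.
move=> e0 e2 e21 ea D0.
have [a1 lta _] := inst.
have a0m : a0 <= m := inst_le inst (leq0n n).
have nm : n < m := inst_ge inst (leqnn n).
have Imod i : i < a0 -> i %% Bg = i by move=> lt; rewrite modn_small //; lia.
have [||j t ltj [It1 It2] [fv fa]|] := @for_rule V Bg 20 (Var 2) (Sto 7 (Var 20) (Var 21)) s a0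
  (fun j t => (forall r, r < j -> arr t 7 r = INF) /\ (forall r, arr t 7 r <= INF)) 20.
- by [].
- by split=> // r; rewrite D0.
- split=> //; rewrite /= !updE /= fv // e21 Imod //.
  split=> r; rewrite /upd; first by rewrite ltnS leq_eqVlt; case: eqP => //= _ /It1.
  by case: eqP.
set s1 := sem _ s; move=> [I1 I2] cst1.
have [fv1 fa1] : agree (For 20 (Var 2) (Sto 7 (Var 20) (Var 21))) s s1 by apply: agree_sem.
set s2 := seta s1 7 (0 %% Bg) 0.
have D2 r : r < a0 -> arr s2 7 r = if r == 0 then 0 else INF.
  by move=> ltr; rewrite /= /upd mod0n; case: eqP => // _; apply: I1.
have [||i t lti [It1 It2 It3] [fv fa]|] := @for_rule V Bg 10 (Var 0) gen_body s2 n
  (fun i t => [/\ forall r, arr t 7 r <= INF, forall r, r < a0 -> sound i r (arr t 7 r)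
     & forall u, feasible i a u -> arr t 7 (u %% a0) <= u]) (500 * a0).
- by rewrite /= fv1.
- split=> [r|r ltr|u].
  + by rewrite /= /upd; case: eqP.
  + rewrite D2 //; case: eqP => [-> _|_]; last by rewrite /sound ltnn.
    by split=> //; apply: feasible0.
  + move=> [y]; rewrite big_ord_recl big_ord0 addn0 => <-.
    by rewrite modnMr D2 // eqxx.
- have xm : a i.+1 <= m by apply: (inst_le inst).
  have h1 : a0 <= Bg by lia.
  have h2 : a0 * a i.+1 + a0 + a i.+1 < V.
    apply: leq_ltn_trans mV; have := leq_mul a0m xm.
    have : m <= m * m by rewrite leq_pmulr //; lia.
    rewrite -mulnA; move: (m * m) (a0 * _) => u v; lia.
  have h3 : INF + a i.+1 < V by apply: leq_ltn_trans INFV; rewrite leq_add2l.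
  have h4 r v : r < a0 -> sound i.+1 r v -> v < INF ->
      sound i.+1 ((r + a i.+1) %% a0) (v + a i.+1).
    move=> ltr Sv ltv _; have [e fv'] := Sv ltv; split.
      by rewrite modn_mod -modnDml e modnDml.
    exact: feasibleD fv' (feasible_gen _ (leqnn _)).
  have [|||||g1 g2 g3 g4] := @genP V Bg a0 (a i.+1) INF a1 h1 h2 h3 (sound i.+1) h4 (setv t 10 i).
  + by rewrite [LHS]fv // fv1.
  + by rewrite [LHS]fv // fv1.
  + have -> : arr (setv t 10 i) 0 = arr s 0 by rewrite [LHS]fa // [LHS]fa1.
    by rewrite /= !updE /= !modn_small ?addn2 ?ea //; lia.
  + exact: It1.
  + move=> r ltr ltv; have [? /feasibleS ?] := It2 r ltr ltv; by [].
  split; last exact: g4.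
  split=> // [r|u fu]; first exact: leq_trans (g1 r) (It1 r).
  (* Closure of the table under +a_(i+1) lets the k copies be added to w one at a time. *)
  have [k [w [fw ->]]] := feasible_recr fu.
  elim: k => [|k IH]; first by rewrite mul0n addn0; apply: leq_trans (g1 _) (It3 _ fw).
  have := g3 ((w + k * a i.+1) %% a0) (ltn_pmod _ a1).
  rewrite modnDml mulSnr addnA => h; apply: leq_trans h _; by rewrite leq_add2r.
move=> [It1 It2 It3] cst2.
have sE : sem round_robin s = sem (For 10 (Var 0) gen_body) s2 by [].
have cE : cost round_robin s = cost (For 20 (Var 2) (Sto 7 (Var 20) (Var 21))) s +
  (7 + cost (For 10 (Var 0) gen_body) s2) by [].
rewrite sE cE; split; last first.
  move: cst1 cst2; rewrite ![ecost _]/=.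
  move: (cost _ s) (cost _ s2) => C1 C2; nia.
move=> r ltr; set D := arr _ 7 in It1 It2 It3 *.
(* No cell is still missing: the a_0 consecutive integers from the bound on are feasible and below
   INF, and one of them is congruent to r. *)
have lim : D r < INF.
  have := INF_large; set B := (2 * m %/ n.+1) * m => hB.
  have [t [let_ lt_ et]] : exists t, [/\ B <= t, t < B + a0 & t %% a0 = r].
    exists (B + (r + (a0 - B %% a0)) %% a0); split; [exact: leq_addr | by rewrite ltn_add2l ltn_pmod |].
    rewrite modnDmr; have -> : B + (r + (a0 - B %% a0)) = (B %/ a0).+1 * a0 + r.
      have := divn_eq B a0; have := ltn_pmod B a1; rewrite -/a0 mulSn.
      move: (B %/ a0 * a0) (B %% a0) => u v; lia.
    by rewrite modnMDl modn_small.
  have := It3 t (large_feasible inst let_); rewrite et => h.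
  by apply: leq_ltn_trans h _; apply: leq_trans lt_ hB.
have [e f] := It2 r ltr lim; split=> // t et ft.
by have := It3 t ft; rewrite et modn_small.
Qed.
End Whole.

(** * The Fourier transform and its fixed-point version *)

Section ExactTransform.
Local Open Scope ring_scope.

(* [theta j] = exp (i pi / 2^(j+1)). *)
Fixpoint theta j : algC :=
  if j is j'.+1 then let w := sqrtC (theta j') in if 0 <= 'Re w then w else - w else 'i.

Lemma theta_sq j : theta j.+1 ^+ 2 = theta j.
Proof. by rewrite /=; case: ifP => _; rewrite ?sqrrN sqrtCK. Qed.

Lemma theta_norm j : `|theta j| = 1.
Proof.
elim: j => [|j IH]; first exact: normCi.
by apply/eqP; rewrite -(@pexpr_eq1 _ _ 2) // -normrX theta_sq IH.
Qed.

Lemma theta_Re j : 0 <= 'Re (theta j).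
Proof.
case: j => [|j] /=; first by rewrite Re_i.
case: ifP => // /negbT; rewrite -real_ltNge ?Creal_Re // => lt.
by rewrite raddfN oppr_ge0 ltW.
Qed.

(* [tw b] is exp (i pi r) for the binary fraction r = 0,b_0 b_1 b_2 ... whose digits are
   those of b in reverse order. *)
Fixpoint tw_from n s b : algC :=
  if n is n'.+1 then (if odd b then theta s else 1) * tw_from n' s.+1 b./2 else 1.
Definition tw b := tw_from b 0 b.

Lemma tw_fromS n s b :
  tw_from n.+1 s b = (if odd b then theta s else 1) * tw_from n s.+1 b./2.
Proof. by []. Qed.

Lemma tw_from0 n s : tw_from n s 0 = 1.
Proof. by elim: n s => //= n IH s; rewrite mul1r IH. Qed.

Lemma half_lt b n : (b < 2 ^ n.+1 -> b./2 < 2 ^ n)%N.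
Proof. by rewrite ltn_half_double -mul2n -expnS. Qed.

Lemma tw_fromE n n' s b : (b < 2 ^ n)%N -> (b < 2 ^ n')%N -> tw_from n s b = tw_from n' s b.
Proof.
elim: n n' s b => [|n IH] [|n'] s b //.
- by rewrite expn0 ltnS leqn0 => /eqP-> _; rewrite !tw_from0.
- by move=> _; rewrite expn0 ltnS leqn0 => /eqP->; rewrite !tw_from0.
- by move=> lt lt'; rewrite /= (IH n') ?half_lt.
Qed.

Lemma twE n b : (b < 2 ^ n)%N -> tw b = tw_from n 0 b.
Proof. by move=> lt; apply: tw_fromE => //; apply: ltn_expl. Qed.

Lemma tw_from_sq n s b : tw_from n s.+1 b ^+ 2 = tw_from n s b.
Proof.
elim: n s b => [|n IH] s b; first by rewrite expr1n.
rewrite [LHS]exprMn IH; congr (_ * _); case: ifP => _; rewrite ?expr1n //.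
exact: theta_sq.
Qed.

Lemma tw_norm b : `|tw b| = 1.
Proof.
rewrite /tw; move: {1}b 0%N => n s; elim: n s b => [|n IH] s b /=; first by rewrite normr1.
by rewrite normrM IH mulr1; case: ifP; rewrite ?normr1 ?theta_norm.
Qed.

Lemma tw0 : tw 0 = 1. Proof. by []. Qed.

Lemma tw_double_sq b : tw b.*2 ^+ 2 = tw b.
Proof.
have lt : (b.*2 < 2 ^ b.+1)%N by rewrite expnS -mul2n ltn_pmul2l // ltn_expl.
by rewrite (twE lt) /= odd_double mul1r doubleK tw_from_sq.
Qed.

Lemma tw_doubleS_sq b : tw b.*2.+1 ^+ 2 = - tw b.
Proof.
have lt : (b.*2.+1 < 2 ^ b.+1)%N.
  have := ltn_expl b (ltnSn 1); rewrite expnS -mul2n; move: (2 ^ b)%N => u; lia.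
by rewrite (twE lt) /= odd_double /= uphalf_double exprMn tw_from_sq sqrCi mulN1r.
Qed.

Lemma tw_from_split j s b : (b < 2 ^ j)%N ->
  tw_from j.+1 s (2 ^ j + b) = theta (s + j) * tw_from j.+1 s b.
Proof.
elim: j s b => [|j IH] s b.
  by rewrite expn0 ltnS leqn0 => /eqP->; rewrite /= addn0 !mulr1.
move=> lt; have e : (2 ^ j.+1 + b)./2 = (2 ^ j + b./2)%N by rewrite expnS mul2n halfD odd_double doubleK.
have o : odd (2 ^ j.+1 + b) = odd b by rewrite oddD expnS mul2n odd_double.
rewrite [LHS]tw_fromS [tw_from _ s b]tw_fromS e o IH ?half_lt //.
by rewrite mulrCA addSnnS.
Qed.

(** The new top digit j contributes the factor [theta j]. In this digit order a table of length 2^j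
    is a prefix of the next one, so one table serves all levels of the transform. *)
Lemma tw_split j b : (b < 2 ^ j)%N -> tw (2 ^ j + b) = theta j * tw b.
Proof.
move=> lt; have lt1 : (2 ^ j + b < 2 ^ j.+1)%N by rewrite expnS mul2n -addnn ltn_add2l.
rewrite (twE lt1) (@twE j.+1 b); last by apply: ltn_trans lt _; rewrite ltn_exp2l.
exact: tw_from_split.
Qed.

(** The values at 2b and 2b + 1 are [tw b] and its opposite, the two square roots of [nroot b] by
    [nroot_tw]. Hence X^(2h) - nroot b splits into the polynomials X^h - nroot (2b) and X^h - nroot
    (2b + 1) of the next level. *)
Definition nroot b : algC := if odd b then - tw b./2 else tw b./2.

Lemma nroot_tw b : tw b ^+ 2 = nroot b.
Proof.
rewrite /nroot -{1}(odd_double_half b); case: ifP => _; rewrite ?add1n ?add0n.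
  exact: tw_doubleS_sq.
exact: tw_double_sq.
Qed.

Lemma nroot_norm b : `|nroot b| = 1.
Proof. by rewrite /nroot; case: ifP => _; rewrite ?normrN tw_norm. Qed.

Section Transform.
Variables (k : nat) (f : nat -> algC).
Local Notation len l := (2 ^ (k - l))%N.

(* Decimation in frequency: the block b of level l, of length h = len l, holds the
   coefficients of the polynomial f modulo 'X^h - nroot b. *)
Definition fft l p : algC :=
  \sum_(q < 2 ^ l) f (p %% len l + q * len l)%N * nroot (p %/ len l)%N ^+ q.

Lemma fft0 p : (p < 2 ^ k)%N -> fft 0 p = f p.
Proof.
move=> lt; rewrite /fft big_ord_recl big_ord0 subn0 modn_small // divn_small //.
by rewrite expr0 mulr1 addr0 mul0n addn0.
Qed.

Lemma fftk b : fft k b = \sum_(q < 2 ^ k) f q * nroot b ^+ q.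
Proof.
by rewrite /fft subnn expn0 modn1 divn1; apply: eq_bigr => q _; rewrite add0n muln1.
Qed.

Lemma sum_even_odd n (F : nat -> algC) :
  \sum_(q < 2 * n) F q = \sum_(q < n) F q.*2 + \sum_(q < n) F q.*2.+1.
Proof.
elim: n => [|n IH]; first by rewrite muln0 !big_ord0 addr0.
by rewrite mulnS add2n !big_ord_recr /= IH !mul2n -addrA addrACA.
Qed.

Section Butterfly.
Variables (l i : nat).
Hypothesis ltl : (l < k)%N.
Let h := len l.+1.
Let b := (i %/ h)%N.
Let o := (i %% h)%N.
(** Butterfly i of a level joins the positions [bot] and [bot + h]: i = b h + o stands for offset o
    in block b, and blocks have length 2h. *)
Definition bot := (2 * h * b + o)%N.
Let lenE : len l = (2 * h)%N.
Proof. by rewrite /h -expnS -subSn. Qed.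
Let h0 : (0 < h)%N. Proof. by rewrite expn_gt0. Qed.
Let oh : (o < h)%N. Proof. by rewrite ltn_pmod. Qed.

Lemma fft_lo : fft l bot = \sum_(q < 2 ^ l) f (o + q * (2 * h))%N * nroot b ^+ q.
Proof.
have o2 : (o < 2 * h)%N by apply: leq_trans oh _; rewrite leq_pmull.
rewrite /fft lenE /bot mulnC divnMDl ?modnMDl ?(divn_small o2) ?(modn_small o2) ?addn0 //.
by rewrite muln_gt0.
Qed.

Lemma fft_hi : fft l (bot + h) = \sum_(q < 2 ^ l) f (o + h + q * (2 * h))%N * nroot b ^+ q.
Proof.
have o2 : (o + h < 2 * h)%N by rewrite mul2n -addnn ltn_add2r.
rewrite /fft lenE /bot -addnA mulnC divnMDl ?modnMDl ?(divn_small o2) ?(modn_small o2) ?addn0 //.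
by rewrite muln_gt0.
Qed.

Let bot_div : (bot = b.*2 * h + o)%N. Proof. by rewrite /bot -mul2n mulnAC. Qed.

(** X^h becomes [tw b] modulo X^h - tw b; the sum is split into the even and odd multiples of h. *)
Lemma fft_next_lo : fft l.+1 bot = fft l bot + tw b * fft l (bot + h).
Proof.
rewrite fft_lo fft_hi /fft -/h bot_div divnMDl // modnMDl (divn_small oh) (modn_small oh) addn0.
rewrite expnS (sum_even_odd _ (fun q => f (o + q * h)%N * nroot b.*2 ^+ q)) mulr_sumr; congr (_ + _); apply: eq_bigr => q _.
  by rewrite -mul2n exprM /nroot odd_double doubleK nroot_tw mulnCA mulnA.
rewrite exprS -mul2n exprM /nroot odd_double doubleK nroot_tw mulrCA; congr (_ * (f _ * _)).
by rewrite mulSn addnA [(q * _)%N]mulnCA mulnA.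
Qed.

Lemma fft_next_hi : fft l.+1 (bot + h) = fft l bot - tw b * fft l (bot + h).
Proof.
have e : (bot + h = b.*2.+1 * h + o)%N by rewrite bot_div mulSn addnC addnA.
rewrite fft_lo fft_hi /fft -/h e divnMDl // modnMDl (divn_small oh) (modn_small oh) addn0.
rewrite expnS (sum_even_odd _ (fun q => f (o + q * h)%N * nroot b.*2.+1 ^+ q)) mulr_sumr -sumrN; congr (_ + _); apply: eq_bigr => q _.
  by rewrite -mul2n exprM /nroot /= odd_double /= uphalf_double sqrrN nroot_tw mulnCA mulnA.
rewrite exprS -mul2n exprM /nroot /= odd_double /= uphalf_double sqrrN nroot_tw mulNr mulrN mulrCA.
by congr (- (_ * (f _ * _))); rewrite mulSn addnA [(q * _)%N]mulnCA mulnA.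
Qed.
End Butterfly.

Lemma fft_norm l p (B : algC) : (forall i, `|f i| <= B) -> `|fft l p| <= B *+ 2 ^ l.
Proof.
move=> fB; apply: le_trans (ler_norm_sum _ _ _) _.
rewrite -[X in _ *+ X]card_ord -sumr_const; apply: ler_sum => q _.
by rewrite normrM normrX nroot_norm expr1n mulr1.
Qed.
End Transform.

End ExactTransform.

(** * Triple convolutions *)

Section Convolution.
Local Open Scope ring_scope.

Definition conv (f g : nat -> nat) x : nat := (\sum_(i < x.+1) f i * g (x - i))%N.
Definition conv3 f g := conv (conv f f) g.

Lemma conv_gt0 f g x :
  reflect (exists y z, [/\ (0 < f y)%N, (0 < g z)%N & x = (y + z)%N]) (0 < conv f g x)%N.
Proof.
apply: (iffP idP) => [|[y [z [fy gz ->]]]].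
  rewrite lt0n sum_nat_eq0 negb_forall => /existsP[i]; rewrite /= muln_eq0 negb_or -!lt0n.
  case/andP=> fi gi; exists i, (x - i)%N; split=> //; rewrite subnKC // -ltnS.
  exact: ltn_ord.
have lt : (y < (y + z).+1)%N by rewrite ltnS leq_addr.
by rewrite /conv (bigD1 (Ordinal lt)) //= addKn addn_gt0 muln_gt0 fy gz.
Qed.

Lemma conv_le f g x a b : (forall i, (f i <= a)%N) -> (forall i, (g i <= b)%N) ->
  (conv f g x <= x.+1 * (a * b))%N.
Proof.
move=> fa gb; rewrite /conv -[X in (_ <= X * _)%N](card_ord x.+1) -sum_nat_const.
by apply: leq_sum => i _; apply: leq_mul.
Qed.

Definition natpoly N (f : nat -> nat) : {poly algC} := \poly_(i < N) (f i)%:R.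

Lemma natpolyE N f i : (forall j, (N <= j)%N -> f j = 0%N) -> (natpoly N f)`_i = (f i)%:R.
Proof. by move=> f0; rewrite coef_poly; case: ltnP => // /f0->. Qed.

Lemma natpoly_size N M f : (forall j, (N <= j)%N -> f j = 0%N) -> (N <= M)%N ->
  natpoly M f = natpoly N f.
Proof.
move=> f0 le; apply/polyP => i; rewrite !natpolyE // => j lej; apply: f0.
exact: leq_trans lej.
Qed.

Lemma natpolyM N M f g i : (forall j, (N <= j)%N -> f j = 0%N) ->
  (forall j, (M <= j)%N -> g j = 0%N) ->
  (natpoly N f * natpoly M g)`_i = (conv f g i)%:R.
Proof.
move=> f0 g0; rewrite coefM /conv natr_sum; apply: eq_bigr => j _.
by rewrite natrM !natpolyE.
Qed.

Lemma fft_natpoly k f b : fft k (fun i => (f i)%:R) k b = (natpoly (2 ^ k) f).[nroot b].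
Proof. by rewrite fftk horner_poly. Qed.

Lemma conv_supp f g N M : (forall j, (N <= j)%N -> f j = 0%N) ->
  (forall j, (M <= j)%N -> g j = 0%N) ->
  forall j, (N + M <= j)%N -> conv f g j = 0%N.
Proof.
move=> f0 g0 j le; rewrite /conv big1 // => i _.
by case: (leqP N i) => [/f0->//|lt]; rewrite g0 ?muln0 //; lia.
Qed.

(** The supports add up to L + L + 2L <= 2^k, so there is no cyclic wrap-around and the transform
    evaluates the product polynomial itself. *)
Lemma fft_conv3 k L f g b : (4 * L <= 2 ^ k)%N ->
  (forall j, (L <= j)%N -> f j = 0%N) -> (forall j, (2 * L <= j)%N -> g j = 0%N) ->
  fft k (fun i => (conv3 f g i)%:R) k b =
  fft k (fun i => (f i)%:R) k b ^+ 2 * fft k (fun i => (g i)%:R) k b.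
Proof.
move=> le f0 g0; rewrite !fft_natpoly expr2 -!hornerM; congr (_.[_]).
have ff0 := conv_supp f0 f0; have fg0 := conv_supp ff0 g0.
rewrite (natpoly_size fg0) -/(conv3 f g); last by lia.
rewrite (natpoly_size f0) ?(natpoly_size g0); [|lia|lia].
have eff : natpoly L f * natpoly L f = natpoly (L + L) (conv f f).
  by apply/polyP => i; rewrite natpolyM // natpolyE.
by apply/polyP => i; rewrite eff natpolyM // natpolyE.
Qed.

End Convolution.

(** * Gaussian integers and rounding errors *)

Section ErrorBounds.
Local Open Scope ring_scope.

Definition gi (x y : int) : algC := x%:~R + 'i * y%:~R.

Lemma giD x y x' y' : gi x y + gi x' y' = gi (x + x') (y + y').
Proof. by rewrite /gi !rmorphD /=; ring. Qed.

Lemma giN x y : - gi x y = gi (- x) (- y).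
Proof. by rewrite /gi !rmorphN /=; ring. Qed.

Lemma giB x y x' y' : gi x y - gi x' y' = gi (x - x') (y - y').
Proof. by rewrite giN giD. Qed.

Lemma giM x y x' y' : gi x y * gi x' y' = gi (x * x' - y * y') (x * y' + y * x').
Proof.
have i2 : 'i * 'i = -1 :> algC by rewrite -expr2 sqrCi.
rewrite /gi !rmorphD !rmorphN !rmorphM /=.
transitivity (x%:~R * x'%:~R + ('i * 'i) * (y%:~R * y'%:~R) +
  'i * (x%:~R * y'%:~R + y%:~R * x'%:~R) : algC); first by ring.
by rewrite i2; ring.
Qed.

Lemma gi_nat (n : nat) : gi n 0 = n%:R.
Proof. by rewrite /gi mulr0 addr0. Qed.

Lemma int_Creal (x : int) : (x%:~R : algC) \is Num.real.
Proof. by rewrite realz. Qed.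

Lemma gi_conj x y : (gi x y)^* = gi x (- y).
Proof.
by rewrite /gi rmorphD rmorphM /= conjCi !conj_Creal ?int_Creal // rmorphN /= mulrN mulNr.
Qed.

Lemma Re_gi x y : 'Re (gi x y) = x%:~R.
Proof. by rewrite /gi Re_rect ?int_Creal. Qed.

Lemma Im_gi x y : 'Im (gi x y) = y%:~R.
Proof. by rewrite /gi Im_rect ?int_Creal. Qed.

Lemma normRe (z : algC) : `|'Re z| <= `|z|.
Proof. by have [] := leif_normC_Re_Creal z. Qed.

Lemma normIm (z : algC) : `|'Im z| <= `|z|.
Proof. by have := normRe ('i * z); rewrite normrM normCi mul1r ReMil normrN. Qed.

Lemma gi_re x y (n : nat) : `|gi x y| <= n%:R -> `|x| <= n.
Proof.
move=> h; have := le_trans (normRe _) h.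
by rewrite Re_gi -intr_norm -[n%:R]/(n%:~R) ler_int.
Qed.

Lemma gi_im x y (n : nat) : `|gi x y| <= n%:R -> `|y| <= n.
Proof.
move=> h; have := le_trans (normIm _) h.
by rewrite Im_gi -intr_norm -[n%:R]/(n%:~R) ler_int.
Qed.

Lemma gi_norm_le (x y : int) (a b : nat) : `|x| <= a -> `|y| <= b -> `|gi x y| <= (a + b)%:R.
Proof.
move=> xa yb; apply: le_trans (ler_normD _ _) _; rewrite normrM normCi mul1r natrD.
by rewrite -[a%:R]/(a%:Z%:~R) -[b%:R]/(b%:Z%:~R) lerD // -intr_norm ler_int.
Qed.

(** Each coordinate is off by less than Q after rescaling. *)
Lemma gi_round (Q : nat) x y : (0 < Q)%N ->
  `|Q%:R * gi (x %/ Q)%Z (y %/ Q)%Z - gi x y| <= (2 * Q)%:R.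
Proof.
move=> Q0; rewrite -gi_nat giM giB mul2n -addnn.
have d z : `|Q%:Z * (z %/ Q)%Z - z| <= Q.
  have := divz_eq z Q; have := ltz_pmod z (_ : 0 < Q%:Z); have := modz_ge0 z (_ : Q%:Z != 0).
  lia.
apply: gi_norm_le; rewrite !mul0r ?subr0 ?addr0; exact: d.
Qed.

Lemma near_le (z t : algC) (e B : nat) : `|z - t| <= e%:R -> `|t| <= B%:R -> `|z| <= (B + e)%:R.
Proof.
move=> h1 h2; rewrite -[z](subrK t) addrC natrD.
by apply: le_trans (ler_normD _ _) _; rewrite lerD.
Qed.

(* Rounded multiplication of h by the fixed-point approximation w of T with scale Q. *)
Lemma cmul_err_gen (Q E F e B : nat) (hx hy wx wy : int) (H T : algC) :
  (0 < Q)%N -> `|gi hx hy - H| <= e%:R -> `|gi wx wy - Q%:R * T| <= E%:R ->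
  `|T| = 1 -> `|H| <= B%:R -> ((B + e) * E <= Q * F)%N ->
  `|gi ((hx * wx - hy * wy) %/ Q)%Z ((hx * wy + hy * wx) %/ Q)%Z - T * H| <= (e + F + 2)%:R.
Proof.
move=> Q0 hH wT T1 HB BE; set t := gi (_ %/ _)%Z _.
have rt := gi_round (hx * wx - hy * wy) (hx * wy + hy * wx) Q0.
rewrite -giM -/t in rt.
have hB := near_le hH HB.
have QR : 0 < Q%:R :> algC by rewrite ltr0n.
rewrite -(ler_pM2l QR) -[X in X * `|_|]ger0_norm ?(ltW QR) // -normrM.
(* Three errors: of the rounding, of w, and of h; the last keeps the factor Q because |T| = 1. *)
have -> : Q%:R * (t - T * H) = (Q%:R * t - gi hx hy * gi wx wy) +
  (gi hx hy * (gi wx wy - Q%:R * T) + Q%:R * T * (gi hx hy - H)) by ring.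
apply: le_trans (ler_normD _ _) _; apply: le_trans (lerD rt (ler_normD _ _)) _.
rewrite !normrM T1 mulr1 normr_nat.
have h1 : `|gi hx hy| * `|gi wx wy - Q%:R * T| <= (Q * F)%:R.
  apply: le_trans (ler_pM _ _ hB wT) _; rewrite ?normr_ge0 //.
  by rewrite -natrM ler_nat.
apply: le_trans (lerD (lexx _) (lerD h1 (ler_wpM2l (ltW QR) hH))) _.
by rewrite -!natrM -!natrD ler_nat; lia.
Qed.

Lemma cmul_err (Q E e B : nat) (hx hy wx wy : int) (H T : algC) :
  (0 < Q)%N -> `|gi hx hy - H| <= e%:R -> `|gi wx wy - Q%:R * T| <= E%:R ->
  `|T| = 1 -> `|H| <= B%:R -> ((B + e) * E <= Q)%N ->
  `|gi ((hx * wx - hy * wy) %/ Q)%Z ((hx * wy + hy * wx) %/ Q)%Z - T * H| <= (e + 3)%:R.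
Proof.
move=> Q0 hH wT T1 HB BE; rewrite -[3%N]/(1 + 2)%N addnA.
by apply: cmul_err_gen hH wT T1 HB _; rewrite ?muln1.
Qed.

(** Range of the coordinates before rounding, as required by [rep_round]. *)
Lemma cmul_range (Q E e B : nat) (hx hy wx wy : int) (H T : algC) :
  `|gi hx hy - H| <= e%:R -> `|gi wx wy - Q%:R * T| <= E%:R ->
  `|T| = 1 -> `|H| <= B%:R ->
  `|hx * wx - hy * wy| <= ((B + e) * (Q + E))%N /\ `|hx * wy + hy * wx| <= ((B + e) * (Q + E))%N.
Proof.
move=> hH wT T1 HB; have hB := near_le hH HB.
have TQ : `|Q%:R * T| <= Q%:R by rewrite normrM T1 mulr1 normr_nat.
have wB := near_le wT TQ.
have : `|gi hx hy * gi wx wy| <= ((B + e) * (Q + E))%:R.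
  by rewrite normrM natrM ler_pM.
by rewrite giM => h; split; [apply: gi_re h | apply: gi_im h].
Qed.

Lemma conj_err (Q E : nat) (wx wy : int) (T : algC) :
  `|gi wx wy - Q%:R * T| <= E%:R -> `|gi wx (- wy) - Q%:R * T^*| <= E%:R.
Proof.
move=> h; rewrite -gi_conj.
have -> : Q%:R * T^* = (Q%:R * T)^* by rewrite rmorphM /= conjC_nat.
by rewrite -rmorphB /= norm_conjC.
Qed.

End ErrorBounds.

(** * Fixed-point square roots on the unit circle *)

Section ThetaApproximation.
Local Open Scope ring_scope.

(** Half-angle formulas: x + i y approximates the square root of Q (a + i b) through 2 x^2 = Q (Q +
    a) and 2 x y = Q b, with d and e the defects of the floors. Multiplied by 4 x^2, the residual is
    a polynomial in 2 x^2 and 2 x y, whose main term Q^2 (Q^2 - a^2 - b^2) is small since |a + i b|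
    is near Q. *)
Lemma sqrt_residual (Q E a b x y d e : int) :
  97 <= Q -> 0 <= E <= Q -> 0 <= a <= 2 * Q -> 0 <= b <= 2 * Q ->
  `|a * a + b * b - Q * Q| <= 3 * Q * E ->
  Q <= 2 * x -> x <= 2 * Q -> 2 * (x * x) = (Q + a) * Q - d -> 0 <= d <= 4 * x + 1 ->
  2 * (x * y) = Q * b - e -> 0 <= e <= 2 * x ->
  `|x * x - y * y - Q * a| <= Q * (3 * E + 35).
Proof.
move=> Q97 /andP[E0 EQ] /andP[a0 aQ] /andP[b0 bQ] eta Qx xQ ed /andP[d0 dx] ee /andP[e0 ex].
set r := x * x - y * y - Q * a.
have Qp : 0 < Q by lia.
have key : 4 * (x * x) * r = Q * Q * (Q * Q - a * a - b * b) - 2 * d * (Q * Q) + d * d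
   + 2 * (Q * b) * e - e * e.
  have -> : 4 * (x * x) * r = (2 * (x * x)) * (2 * (x * x)) - (2 * (x * y)) * (2 * (x * y))
    - 2 * (2 * (x * x)) * (Q * a) by rewrite /r; ring.
  by rewrite ed ee; ring.
have bnd : `|4 * (x * x) * r| <= Q * Q * (Q * (3 * E + 35)).
  have h1 : `|Q * Q * (Q * Q - a * a - b * b)| <= Q * Q * (3 * Q * E).
    have -> : Q * Q - a * a - b * b = - (a * a + b * b - Q * Q) by ring.
    by rewrite normrM normrN ger0_norm ?ler_wpM2l ?mulr_ge0 // ltW.
  have h2 : 0 <= 2 * d * (Q * Q) <= 18 * Q * (Q * Q).
    by apply/andP; split; [rewrite !mulr_ge0 // ltW | rewrite ler_wpM2r ?mulr_ge0 ?ltW //; lia].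
  have h3 : 0 <= d * d <= 81 * (Q * Q).
    apply/andP; split; first by rewrite mulr_ge0.
    have : d * d <= (9 * Q) * (9 * Q) by apply: ler_pM => //; lia.
    by have -> : (9 * Q) * (9 * Q) = 81 * (Q * Q) by ring.
  have h4 : 0 <= 2 * (Q * b) * e <= 16 * Q * (Q * Q).
    apply/andP; split; first by rewrite !mulr_ge0 // ltW.
    have -> : 16 * Q * (Q * Q) = 2 * (Q * (2 * Q)) * (4 * Q) by ring.
    apply: ler_pM => //; first by rewrite !mulr_ge0 // ltW.
      by rewrite ler_pM2l // ler_pM2l.
    by lia.
  have h5 : 0 <= e * e <= 16 * (Q * Q).
    apply/andP; split; first by rewrite mulr_ge0.
    have : e * e <= (4 * Q) * (4 * Q) by apply: ler_pM => //; lia.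
    by have -> : (4 * Q) * (4 * Q) = 16 * (Q * Q) by ring.
  (* The quadratic terms 81 + 16 = 97 fit into one Q^3, whence 18 + 16 + 1 = 35 and the requirement
     on Q. *)
  have h6 : 97 * (Q * Q) <= Q * (Q * Q) by rewrite ler_wpM2r // mulr_ge0 // ltW.
  have -> : Q * Q * (Q * (3 * E + 35)) = Q * Q * (3 * Q * E) + 35 * (Q * (Q * Q)) by ring.
  have e18 : 18 * Q * (Q * Q) = 18 * (Q * (Q * Q)) by ring.
  have e16 : 16 * Q * (Q * Q) = 16 * (Q * (Q * Q)) by ring.
  rewrite key; rewrite e18 in h2; rewrite e16 in h4.
  move: h1 h2 h3 h4 h5 h6.
  move: (Q * Q * (Q * Q - a * a - b * b)) (Q * Q * (3 * Q * E)) (2 * d * (Q * Q)) (d * d)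
    (2 * (Q * b) * e) (e * e) (Q * (Q * Q)) (Q * Q) => t1 t2 t3 t4 t5 t6 t7 t8; lia.
have QQ : 0 < Q * Q by rewrite mulr_gt0.
rewrite -(ler_pM2l QQ); apply: le_trans bnd; rewrite normrM ler_wpM2r //.
rewrite ger0_norm; last by rewrite !mulr_ge0 //; lia.
have -> : 4 * (x * x) = (2 * x) * (2 * x) by ring.
by apply: ler_pM => //; lia.
Qed.

(** A difference of squares, (|z| - Q)(|z| + Q), with factors at most E and 3Q. *)
Lemma norm_residual (Q E : nat) (a b : int) (T : algC) : `|T| = 1 -> (E <= Q)%N ->
  `|gi a b - Q%:R * T| <= E%:R -> `|a * a + b * b - Q%:Z * Q| <= 3 * Q%:Z * E.
Proof.
move=> T1 EQ h; set z := gi a b in h.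
have zQ : `| `|z| - Q%:R | <= E%:R :> algC.
  have -> : Q%:R = `|Q%:R * T| by rewrite normrM T1 mulr1 normr_nat.
  by apply: le_trans (ler_dist_dist _ _) h.
have zB : `|z| <= (Q + E)%:R.
  by apply: near_le h _; rewrite normrM T1 mulr1 normr_nat.
have e : `|z| ^+ 2 = (a * a + b * b)%:~R.
  rewrite normCK gi_conj giM /gi; have -> : a * - b + b * a = 0 by ring.
  by rewrite mulr0 addr0; congr (_%:~R); ring.
have : `|(a * a + b * b - Q%:Z * Q)%:~R| <= (3 * Q * E)%:R :> algC.
  have -> : (a * a + b * b - Q%:Z * Q)%:~R = (`|z| - Q%:R) * (`|z| + Q%:R) :> algC.
    by rewrite -subr_sqr e rmorphB /= rmorphM /= expr2.
  rewrite normrM; have -> : (3 * Q * E = E * (3 * Q))%N by rewrite mulnC.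
  rewrite natrM ler_pM // ger0_norm ?addr_ge0 ?ler0n //.
  apply: le_trans (lerD zB (lexx _)) _; rewrite -natrD ler_nat; lia.
by rewrite -intr_norm -[_%:R]/((3 * Q * E)%N%:Z%:~R) ler_int; lia.
Qed.

(** The product |z - Q w| |z + Q w| is at most Q (4E + 39), and its second factor is at least x >=
    Q/2 because w has nonnegative real part, which is why [theta] selects that root. This gives 8E +
    78; with 84 instead, errors of the form 12 * 8^j - 12 reproduce themselves for j + 1. *)
Lemma theta_step (Q E a b x : nat) j : (97 <= Q)%N -> (E <= Q)%N ->
  `|gi a b - Q%:R * theta j| <= E%:R ->
  (x ^ 2 <= (Q + a) * Q %/ 2 < x.+1 ^ 2)%N ->
  `|gi x (b * Q %/ (2 * x))%N - Q%:R * theta j.+1| <= (8 * E + 84)%:R.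
Proof.
move=> Q97 EQ h /andP[xl xu].
have eta := norm_residual (theta_norm j) EQ h.
have TB : `|Q%:R * theta j| <= Q%:R by rewrite normrM theta_norm mulr1 normr_nat.
have hB := near_le h TB.
have aB : (a <= 2 * Q)%N by have := gi_re hB; lia.
have bB : (b <= 2 * Q)%N by have := gi_im hB; lia.
have X2 := divn_eq ((Q + a) * Q) 2; have X2' := ltn_pmod ((Q + a) * Q) (isT : (0 < 2)%N).
have xQ : (x <= 2 * Q)%N.
  rewrite -(@leq_exp2r _ _ 2) //; apply: leq_trans xl _.
  apply: leq_trans (leq_div _ _) _; rewrite expnMn mulnA leq_mul2r; apply/orP; right; lia.
have Qx : (Q <= 2 * x)%N.
  rewrite leqNgt; apply/negP => lt.
  have : (4 * x.+1 ^ 2 <= Q.+1 ^ 2)%N.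
    by rewrite (_ : 4 = 2 ^ 2)%N // -expnMn leq_exp2r //; lia.
  have : (Q * Q <= (Q + a) * Q)%N by rewrite leq_mul2r leq_addr orbT.
  have : (97 * Q <= Q * Q)%N by rewrite leq_mul2r Q97 orbT.
  have -> : (Q.+1 ^ 2 = Q * Q + 2 * Q + 1)%N by lia.
  move: xu X2 X2'; move: (Q * Q)%N (x.+1 ^ 2)%N ((Q + a) * Q)%N (_ %/ 2)%N (_ %% 2)%N => *; lia.
have x0 : (0 < 2 * x)%N by lia.
set y := (_ %/ _)%N.
have Y := divn_eq (b * Q) (2 * x); have Y' := ltn_pmod (b * Q) x0.
rewrite -/y in Y.
have res : `|x%:Z * x - y%:Z * y - Q%:Z * a| <= Q%:Z * (3 * E%:Z + 35).
  apply: (@sqrt_residual Q E a b x y ((Q%:Z + a) * Q - 2 * (x%:Z * x)) (Q%:Z * b - 2 * (x%:Z * y))) => //; lia.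
have r1 : `|x%:Z * y + y%:Z * x - Q%:Z * b| <= 4 * Q%:Z by lia.
set z := gi x y; set w := theta j.+1.
have zz : `|z * z - Q%:R * gi a b| <= (Q * (3 * E + 39))%:R.
  rewrite -gi_nat !giM giB !mul0r subr0 addr0.
  apply: le_trans (gi_norm_le (a := Q * (3 * E + 35)) (b := 4 * Q) _ _) _.
  - by move: res; lia.
  - by move: r1; lia.
  by rewrite ler_nat; lia.
have zw : `|z - Q%:R * w| * `|z + Q%:R * w| <= (Q * (4 * E + 39))%:R.
  have -> : (Q * (4 * E + 39) = Q * (3 * E + 39) + Q * E)%N by lia.
  rewrite -normrM -subr_sqr !expr2 natrD.
  have -> : z * z - Q%:R * w * (Q%:R * w) = (z * z - Q%:R * gi a b) + Q%:R * (gi a b - Q%:R * theta j).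
    by rewrite -(theta_sq j) -/w; ring.
  apply: le_trans (ler_normD _ _) _; rewrite lerD // normrM normr_nat natrM.
  by rewrite ler_wpM2l ?ler0n.
have xz : x%:R <= `|z + Q%:R * w|.
  apply: le_trans (normRe _); rewrite raddfD /= Re_gi.
  have -> : 'Re (Q%:R * w) = Q%:R * 'Re w by rewrite mulr_natl raddfMn mulr_natl.
  have := mulr_ge0 (ler0n algC Q) (theta_Re j.+1); rewrite -/w => hw.
  by rewrite ger0_norm ?addr_ge0 ?ler0z // lerDl.
have xp : 0 < x%:R :> algC by rewrite ltr0n; move: x0; rewrite muln_gt0.
rewrite -(ler_pM2r xp); apply: le_trans (ler_wpM2l (normr_ge0 _) xz) _.
apply: le_trans zw _; rewrite -natrM ler_nat.
apply: leq_trans (leq_mul Qx (leqnn _)) _.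
have -> : ((8 * E + 84) * x = 2 * x * (4 * E + 42))%N by ring.
by rewrite leq_mul2l leq_add2l orbT.
Qed.

End ThetaApproximation.

(** * Signed values modulo V *)

Section Rep.
Variable V : nat.
Hypothesis V0 : 0 < V.

Definition rep (z : int) : nat := `|(z %% V%:Z)%Z|.

Lemma repE z : (rep z : int) = (z %% V%:Z)%Z.
Proof. by rewrite /rep gez0_abs // modz_ge0 //; lia. Qed.

Lemma rep_lt z : rep z < V.
Proof. by have := @ltz_pmod z V; have := repE z; lia. Qed.

Lemma repD x y : (rep x + rep y) %% V = rep (x + y)%R.
Proof.
by apply/eqP; rewrite -eqz_nat repE -modz_nat PoszD !repE modzDm.
Qed.

Lemma repM x y : (rep x * rep y) %% V = rep (x * y)%R.
Proof.
by apply/eqP; rewrite -eqz_nat repE -modz_nat PoszM !repE modzMm.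
Qed.

Lemma repB x y : (rep x + (V - rep y)) %% V = rep (x - y)%R.
Proof.
apply/eqP; rewrite -eqz_nat repE -modz_nat PoszD -subzn ?(ltnW (rep_lt _)) // !repE.
have ex := divz_eq x V; have ey := divz_eq y V.
have -> : ((x %% V)%Z + (V%:Z - (y %% V)%Z) = (1 - (x %/ V)%Z + (y %/ V)%Z) * V + (x - y))%R by lia.
by rewrite modzMDl.
Qed.

Lemma rep_nat n : n < V -> rep n = n.
Proof. by move=> lt; rewrite /rep modz_nat modn_small. Qed.

(** Floor division is not compatible with residues modulo V. After adding Q R the residue is the
    integer x + Q R itself, which can be divided, and R is then taken off the quotient. *)
Lemma rep_round Q R (x : int) : 0 < Q -> (`|x| <= (Q * R)%N%:Z)%R -> 2 * (Q * R) < V ->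
  ((rep x + Q * R) %% V %/ maxn 1 Q + (V - R)) %% V = rep (x %/ Q)%Z.
Proof.
move=> Q0 xQR V2.
have RV : R < V by apply: leq_ltn_trans V2; nia.
have QRV : Q * R < V by lia.
have -> : (rep x + Q * R) %% V = `|(x + (Q * R)%N%:Z)%R|%N.
  rewrite -{1}(rep_nat QRV) repD /rep modz_small ?gez0_abs //; lia.
have -> : maxn 1 Q = Q by lia.
have Qp : (0 < Q%:Z)%R by lia.
have Qn : (Q%:Z != 0)%R by lia.
have dx := divz_eq x Q; have mx := ltz_pmod x Qp; have mx0 := modz_ge0 x Qn.
have q0 : (0 <= (x %/ Q)%Z + R%:Z)%R by nia.
have q1 : ((x %/ Q)%Z + R%:Z < V%:Z)%R by nia.
have -> : `|(x + (Q * R)%N%:Z)%R|%N %/ Q = `|((x %/ Q)%Z + R%:Z)%R|%N.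
  apply/eqP; rewrite -eqz_nat -divz_nat gez0_abs; last lia.
  rewrite PoszM mulrC addrC divzMDl; last lia.
  by rewrite addrC gez0_abs.
have e1 : `|((x %/ Q)%Z + R%:Z)%R|%N = rep ((x %/ Q)%Z + R%:Z)%R.
  rewrite /rep modz_small //; lia.
by rewrite e1 -{2}(rep_nat RV) repB addrK.
Qed.
End Rep.

(** * Butterflies and transforms as programs *)

Fixpoint seqs cs := if cs is c :: cs' then (if cs' is [::] then c else Seq c (seqs cs')) else Skip.

Definition rnd e := Bin OMsub (Bin ODiv (Bin OAdd e (Var 51)) (Var 50)) (Var 52).
Definition esub e1 e2 := Bin OMsub e1 e2.
Definition eadd e1 e2 := Bin OAdd e1 e2.
Definition emul e1 e2 := Bin OMul e1 e2.

(* Arrays: 0 the input; 1 and 2 the real and imaginary parts of the data; 3 and 4 those of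
   the roots of unity, scaled by Q; 5 the table of feasible integers; 6 the indicator of
   {0, a_0, ..., a_n}; 7 the output.  Registers 50 and 52 hold Q and R, and register 51
   holds Q R, which is added before a division by Q to keep the dividend nonnegative. *)
(* Registers 36, 37 and 38 receive the index of the current block and the two positions
   of the butterfly. *)
Definition idx_code := seqs
  [:: Asn 36 (Bin ODiv (Var 35) (Var 33));
      Asn 37 (eadd (Var 30) (eadd (emul (emul (Cst 2) (Var 33)) (Var 36)) (Bin OMod (Var 35) (Var 33))));
      Asn 38 (eadd (Var 37) (Var 33)); Asn 41 (Get 3 (Var 36)); Asn 42 (Get 4 (Var 36))].

Definition fwd_tail := seqs
  [:: Asn 39 (Get 1 (Var 38)); Asn 40 (Get 2 (Var 38));
      Asn 43 (rnd (esub (emul (Var 39) (Var 41)) (emul (Var 40) (Var 42))));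
      Asn 44 (rnd (eadd (emul (Var 39) (Var 42)) (emul (Var 40) (Var 41))));
      Asn 45 (Get 1 (Var 37)); Asn 46 (Get 2 (Var 37));
      Sto 1 (Var 37) (eadd (Var 45) (Var 43)); Sto 2 (Var 37) (eadd (Var 46) (Var 44));
      Sto 1 (Var 38) (esub (Var 45) (Var 43)); Sto 2 (Var 38) (esub (Var 46) (Var 44))].

(** Undoes a butterfly up to a factor 2, which is never divided out: the factors accumulate to 2^K
    and enter the threshold. *)
Definition inv_tail := seqs
  [:: Asn 45 (Get 1 (Var 37)); Asn 46 (Get 2 (Var 37)); Asn 47 (Get 1 (Var 38)); Asn 48 (Get 2 (Var 38));
      Asn 39 (esub (Var 45) (Var 47)); Asn 40 (esub (Var 46) (Var 48));
      Asn 43 (rnd (eadd (emul (Var 39) (Var 41)) (emul (Var 40) (Var 42))));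
      Asn 44 (rnd (esub (emul (Var 40) (Var 41)) (emul (Var 39) (Var 42))));
      Sto 1 (Var 37) (eadd (Var 45) (Var 47)); Sto 2 (Var 37) (eadd (Var 46) (Var 48));
      Sto 1 (Var 38) (Var 43); Sto 2 (Var 38) (Var 44)].

Definition fwd_body := Seq idx_code fwd_tail.
Definition inv_body := Seq idx_code inv_tail.

Ltac run_code t := rewrite fsemE //; cbv beta iota zeta delta [fsem fsetv fseta eval bin var arr eqn
  fwd_tail inv_tail idx_code seqs rnd esub eadd emul];
  rewrite -?/(var t) -?/(arr t).

Section Pairs.
Variables (K l : nat).
Hypothesis ltl : l < K.
Let h := 2 ^ (K - l.+1).
Let h0 : 0 < h. Proof. by rewrite expn_gt0. Qed.
(** The butterfly that touches position p. Each position belongs to exactly one, so the loop over a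
    level can say which entries are already new. *)
Definition pair_idx p := p %/ (2 * h) * h + p %% h.

Lemma half_len : 2 ^ K.-1 = 2 ^ l * h.
Proof. by rewrite /h -expnD; congr (2 ^ _); lia. Qed.

Lemma full_len : 2 ^ K = 2 ^ l * (2 * h).
Proof. by rewrite /h -expnS -expnD; congr (2 ^ _); lia. Qed.

Lemma block_lt i : i < 2 ^ K.-1 -> i %/ h < 2 ^ l.
Proof. by rewrite ltn_divLR // -half_len. Qed.

Lemma bot_lt i : i < 2 ^ K.-1 -> bot K l i + h < 2 ^ K.
Proof.
move=> /block_lt lt; rewrite /bot -/h full_len.
have := ltn_pmod i h0; have : 2 * h * (i %/ h).+1 <= 2 * h * 2 ^ l by rewrite leq_mul2l lt orbT.
rewrite mulnS [2 ^ l * _]mulnC; lia.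
Qed.

Lemma pair_idx_lo i : pair_idx (bot K l i) = i.
Proof.
have oh := ltn_pmod i h0; have o2 : i %% h < 2 * h by lia.
rewrite /pair_idx /bot -/h [2 * h * _]mulnC divnMDl ?muln_gt0 // (divn_small o2) addn0.
by rewrite mulnA modnMDl modn_mod [LHS]addnC addnC -divn_eq.
Qed.

Lemma pair_idx_hi i : pair_idx (bot K l i + h) = i.
Proof.
have oh := ltn_pmod i h0; have o2 : i %% h + h < 2 * h by lia.
rewrite /pair_idx /bot -/h -addnA [2 * h * _]mulnC divnMDl ?muln_gt0 // (divn_small o2) addn0.
by rewrite mulnA modnMDl modnDr modn_mod -divn_eq.
Qed.

Lemma pair_idx_lt p : p < 2 ^ K -> pair_idx p < 2 ^ K.-1.
Proof.
move=> ltp; have lt : p %/ (2 * h) < 2 ^ l by rewrite ltn_divLR ?muln_gt0 // -full_len.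
rewrite half_len /pair_idx; have := ltn_pmod p h0.
have : (p %/ (2 * h)).+1 * h <= 2 ^ l * h by rewrite leq_mul2r lt orbT.
rewrite mulSn; lia.
Qed.

Lemma pair_cases p : p = bot K l (pair_idx p) \/ p = bot K l (pair_idx p) + h.
Proof.
have oh := ltn_pmod p h0.
rewrite /bot -/h /pair_idx divnMDl // modnMDl modn_mod (divn_small oh) addn0.
have e := divn_eq p (2 * h); have lt : p %% (2 * h) < 2 * h by rewrite ltn_pmod ?muln_gt0.
have em : p %% h = p %% (2 * h) %% h by rewrite modn_dvdm // dvdn_mull.
rewrite em; case: (ltnP (p %% (2 * h)) h) => c; [left | right].
  by rewrite modn_small // mulnC.
have -> : p %% (2 * h) %% h = p %% (2 * h) - h.
  by rewrite -{1}(subnK c) modnDr modn_small // ltn_subLR // addnn -mul2n.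
rewrite -addnA subnK // mulnC //.
Qed.
End Pairs.

Section Machine.
Variables (V Bg Q R E : nat).
Local Notation sem := (sem V Bg).
Local Notation cost := (cost V Bg).
Local Notation rep := (rep V).
Hypotheses (Q0 : 0 < Q) (V2 : 2 * (Q * R) < V) (BgV : Bg < V).
Let V0 : 0 < V. Proof. by lia. Qed.

Definition near (re im : nat -> nat) p (target : algC) e :=
  exists x y, [/\ re p = rep x, im p = rep y & (`|gi x y - target| <= e%:R)%R].

Lemma near_eq re im re' im' p t e : re' p = re p -> im' p = im p ->
  near re im p t e -> near re' im' p t e.
Proof. by move=> e1 e2 [x [y [ex ey n]]]; exists x, y; rewrite e1 e2. Qed.

Definition consts t := [/\ var t 50 = Q, var t 51 = Q * R & var t 52 = R].

Definition butterfly_post p q t t' (G0 G1 : algC) e' :=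
  [/\ near (arr t' 1) (arr t' 2) p G0 e', near (arr t' 1) (arr t' 2) q G1 e'
    & forall r, r != p -> r != q -> arr t' 1 r = arr t 1 r /\ arr t' 2 r = arr t 2 r].

Lemma nearD (x y x' y' : int) (H G : algC) (e e' f : nat) : (`|gi x y - H| <= e%:R)%R ->
  (`|gi x' y' - G| <= e'%:R)%R -> e + e' <= f ->
  (`|gi (x + x') (y + y') - (H + G)| <= f%:R)%R.
Proof.
move=> h g le; have -> : (gi (x + x') (y + y') - (H + G) = (gi x y - H) + (gi x' y' - G))%R.
  by rewrite -giD; ring.
apply: le_trans (ler_normD _ _) _; apply: le_trans (lerD h g) _.
by rewrite -natrD ler_nat.
Qed.

Lemma nearB (x y x' y' : int) (H G : algC) (e e' f : nat) : (`|gi x y - H| <= e%:R)%R ->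
  (`|gi x' y' - G| <= e'%:R)%R -> e + e' <= f ->
  (`|gi (x - x') (y - y') - (H - G)| <= f%:R)%R.
Proof.
move=> h g le; have -> : (gi (x - x') (y - y') - (H - G) = (gi x y - H) - (gi x' y' - G))%R.
  by rewrite -giB; ring.
apply: le_trans (ler_normB _ _) _; apply: le_trans (lerD h g) _.
by rewrite -natrD ler_nat.
Qed.

Section Core.
Variables (t : store) (p q e B : nat) (H0 H1 T : algC).
Hypotheses (pB : p < Bg) (qB : q < Bg) (pq : q == p = false).
Hypotheses (v37 : var t 37 = p) (v38 : var t 38 = q) (cc : consts t).
(** The factors 2 in the last two bounds are for the inverse butterfly, which multiplies a
    difference of two entries by the root. *)
Hypotheses (dw : near (fun=> var t 41) (fun=> var t 42) 0 (Q%:R * T)%R E) (T1 : (`|T| = 1)%R)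
  (n0 : near (arr t 1) (arr t 2) p H0 e) (n1 : near (arr t 1) (arr t 2) q H1 e)
  (B0 : (`|H0| <= B%:R)%R) (B1 : (`|H1| <= B%:R)%R)
  (BE : (2 * B + 2 * e) * E <= Q) (BR : (2 * B + 2 * e) * (Q + E) <= Q * R).

Let qp : p == q = false. Proof. by rewrite eq_sym. Qed.
Let m0 : p %% Bg = p. Proof. exact: modn_small. Qed.
Let m1 : q %% Bg = q. Proof. exact: modn_small. Qed.

Lemma fwd_core : butterfly_post p q t (sem fwd_tail t) (H0 + T * H1)%R (H0 - T * H1)%R (2 * e + 3).
Proof.
have [x0 [y0 [ex0 ey0 d0]]] := n0; have [x1 [y1 [ex1 ey1 d1]]] := n1.
have [wx [wy [ewx ewy d]]] := dw; have [c1 c2 c3] := cc.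
have BE1 : (B + e) * E <= Q by apply: leq_trans BE; rewrite leq_mul2r leq_add ?leq_pmull ?orbT.
have BR1 : (B + e) * (Q + E) <= Q * R.
  by apply: leq_trans BR; rewrite leq_mul2r leq_add ?leq_pmull ?orbT.
have BRz : (((B + e) * (Q + E))%N%:Z <= (Q * R)%N%:Z)%R by rewrite lez_nat.
have err := cmul_err Q0 d1 d T1 B1 BE1.
have [rg1 rg2] := cmul_range d1 d T1 B1.
have rx := rep_round (V := V) V0 Q0 (le_trans rg1 BRz) V2.
have ry := rep_round (V := V) V0 Q0 (le_trans rg2 BRz) V2.
set gx := (_ %/ Q)%Z in err rx; set gy := (_ %/ Q)%Z in err ry.
have r1 : arr (sem fwd_tail t) 1 = upd (upd (arr t 1) p (rep (x0 + gx)%R)) q (rep (x0 - gx)%R).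
  run_code t; rewrite c1 c2 c3 v37 v38 !m1 !m0 ex0 ex1 ey1 ewx ewy !(repM V0) !(repB V0) rx.
  by rewrite !(repB V0) !(repD V0).
have r2 : arr (sem fwd_tail t) 2 = upd (upd (arr t 2) p (rep (y0 + gy)%R)) q (rep (y0 - gy)%R).
  run_code t; rewrite c1 c2 c3 v37 v38 !m1 !m0 ey0 ex1 ey1 ewx ewy !(repM V0) !(repD V0) ry.
  by rewrite !(repB V0) !(repD V0).
rewrite /butterfly_post r1 r2; split.
- exists (x0 + gx)%R, (y0 + gy)%R; rewrite !updE qp eqxx; split=> //.
  by apply: nearD d0 err _; rewrite addnA addnn mul2n.
- exists (x0 - gx)%R, (y0 - gy)%R; rewrite !updE eqxx; split=> //.
  by apply: nearB d0 err _; rewrite addnA addnn mul2n.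
- by move=> r np nq; rewrite !updE (negPf np) (negPf nq).
Qed.

Lemma inv_core : butterfly_post p q t (sem inv_tail t) (H0 + H1)%R (T^* * (H0 - H1))%R (2 * e + 3).
Proof.
have [x0 [y0 [ex0 ey0 d0]]] := n0; have [x1 [y1 [ex1 ey1 d1]]] := n1.
have [wx [wy [ewx ewy d]]] := dw; have [c1 c2 c3] := cc.
have dB := nearB d0 d1 (leqnn _).
have HB : (`|H0 - H1| <= (2 * B)%:R)%R.
  by apply: le_trans (ler_normB _ _) _; rewrite mul2n -addnn natrD lerD.
have BE1 : (2 * B + (e + e)) * E <= Q by rewrite addnn -mul2n.
have BR1 : (2 * B + (e + e)) * (Q + E) <= Q * R by rewrite addnn -mul2n.
have BRz : (((2 * B + (e + e)) * (Q + E))%N%:Z <= (Q * R)%N%:Z)%R by rewrite lez_nat.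
have T1' : (`|T^*| = 1)%R by rewrite norm_conjC.
have err := cmul_err Q0 dB (conj_err d) T1' HB BE1.
have [rg1 rg2] := cmul_range dB (conj_err d) T1' HB.
have rx := rep_round (V := V) V0 Q0 (le_trans rg1 BRz) V2.
have ry := rep_round (V := V) V0 Q0 (le_trans rg2 BRz) V2.
have e1 : ((x0 - x1) * wx - (y0 - y1) * - wy = (x0 - x1) * wx + (y0 - y1) * wy)%R by ring.
have e2 : ((x0 - x1) * - wy + (y0 - y1) * wx = (y0 - y1) * wx - (x0 - x1) * wy)%R by ring.
rewrite e1 e2 in err; rewrite e1 in rx; rewrite e2 in ry.
set gx := (_ %/ Q)%Z in err rx; set gy := (_ %/ Q)%Z in err ry.
have r1 : arr (sem inv_tail t) 1 = upd (upd (arr t 1) p (rep (x0 + x1)%R)) q (rep gx).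
  run_code t; rewrite c1 c2 c3 v37 v38 !m1 !m0 ex0 ex1 ey0 ey1 ewx ewy.
  by rewrite !(repB V0) !(repM V0) !(repD V0) rx.
have r2 : arr (sem inv_tail t) 2 = upd (upd (arr t 2) p (rep (y0 + y1)%R)) q (rep gy).
  run_code t; rewrite c1 c2 c3 v37 v38 !m1 !m0 ex0 ex1 ey0 ey1 ewx ewy.
  by rewrite !(repB V0) !(repM V0) !(repD V0) !(repB V0) ry.
rewrite /butterfly_post r1 r2; split.
- exists (x0 + x1)%R, (y0 + y1)%R; rewrite !updE qp eqxx; split=> //.
  by apply: nearD d0 d1 _; rewrite addnn mul2n leq_addr.
- exists gx, gy; rewrite !updE eqxx; split=> //.
  by apply: le_trans err _; rewrite addnn mul2n.
- by move=> r np nq; rewrite !updE (negPf np) (negPf nq).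
Qed.
End Core.

Section Stage.
Variables (K l off : nat).
Hypotheses (ltl : l < K) (offB : off + 2 ^ K <= Bg).
Let h := 2 ^ (K - l.+1).

Definition stage_ctx t := [/\ consts t, var t 30 = off, var t 33 = h
  & forall b, b < 2 ^ l -> near (arr t 3) (arr t 4) b (Q%:R * tw b)%R E].

Lemma idx_codeP t i : i < 2 ^ K.-1 -> stage_ctx t -> var t 35 = i ->
  let t' := sem idx_code t in
  [/\ var t' 36 = i %/ h, var t' 37 = off + bot K l i, var t' 38 = off + bot K l i + h,
      var t' 41 = arr t 3 (i %/ h) & var t' 42 = arr t 4 (i %/ h)].
Proof.
move=> lti [_ e30 e33 _] e35.
have h0 : 0 < h by rewrite expn_gt0.
have lb := block_lt ltl lti; have lbot := bot_lt ltl lti.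
have fl := full_len ltl; rewrite -/h in lb lbot fl.
have bB : i %/ h < Bg.
  have : 2 ^ l * 1 <= 2 ^ l * (2 * h) by rewrite leq_mul2l; lia.
  lia.
have mh : maxn 1 h = h by lia.
have e1 : (2 * h) %% V = 2 * h.
  rewrite modn_small //; have : 1 * (2 * h) <= 2 ^ l * (2 * h) by rewrite leq_mul2r expn_gt0 orbT.
  by lia.
have lim : off + bot K l i + h < V.
  apply: leq_ltn_trans BgV; apply: leq_trans offB; rewrite -addnA leq_add2l; exact: ltnW.
have e5 : (off + bot K l i + h) %% V = off + bot K l i + h := modn_small lim.
have lim4 : off + bot K l i < V := leq_ltn_trans (leq_addr _ _) lim.
have e4 : (off + bot K l i) %% V = off + bot K l i := modn_small lim4.
have lim3 : bot K l i < V := leq_ltn_trans (leq_addl _ _) lim4.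
have e3 : (2 * h * (i %/ h) + i %% h) %% V = bot K l i := modn_small lim3.
have e2 : (2 * h * (i %/ h)) %% V = 2 * h * (i %/ h).
  exact: modn_small (leq_ltn_trans (leq_addr _ _) lim3).
have e6 : i %/ h %% Bg = i %/ h := modn_small bB.
clear lim lim4 lim3 lb lbot fl bB lti.
by run_code t; rewrite e30 e33 e35 mh e1 e2 e3 e4 e5 e6.
Qed.

Lemma idx_ctx t : stage_ctx t -> stage_ctx (sem idx_code t).
Proof.
have [fv fa] := agree_sem V Bg idx_code t.
by move=> [[c1 c2 c3] e30 e33 tws]; split; [split|..]; rewrite ?fv // ?fa.
Qed.

Section Butterfly.
Variables (t : store) (i e B : nat) (H0 H1 : algC).
Let b := i %/ h.
Let p0 := off + bot K l i.
Hypotheses (lti : i < 2 ^ K.-1) (ctx : stage_ctx t) (e35 : var t 35 = i)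
  (n0 : near (arr t 1) (arr t 2) p0 H0 e) (n1 : near (arr t 1) (arr t 2) (p0 + h) H1 e)
  (B0 : (`|H0| <= B%:R)%R) (B1 : (`|H1| <= B%:R)%R)
  (BE : (2 * B + 2 * e) * E <= Q) (BR : (2 * B + 2 * e) * (Q + E) <= Q * R).

Let p1B : p0 + h < Bg.
Proof. by apply: leq_trans offB; rewrite /p0 -addnA ltn_add2l; exact: bot_lt. Qed.

Let split_body body : sem (Seq idx_code body) t = sem body (sem idx_code t).
Proof. by []. Qed.

Let core body G0 G1 e' : (forall t1, var t1 37 = p0 -> var t1 38 = p0 + h -> consts t1 ->
    near (fun=> var t1 41) (fun=> var t1 42) 0 (Q%:R * tw b)%R E ->
    near (arr t1 1) (arr t1 2) p0 H0 e -> near (arr t1 1) (arr t1 2) (p0 + h) H1 e ->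
    butterfly_post p0 (p0 + h) t1 (sem body t1) G0 G1 e') ->
  butterfly_post p0 (p0 + h) t (sem (Seq idx_code body) t) G0 G1 e'.
Proof.
rewrite split_body => H.
have [v36 v37 v38 v41 v42] := idx_codeP lti ctx e35.
have [cc _ _ tws] := idx_ctx ctx.
have [fv fa] := agree_sem V Bg idx_code t.
have a1 : arr (sem idx_code t) 1 = arr t 1 by rewrite fa.
have a2 : arr (sem idx_code t) 2 = arr t 2 by rewrite fa.
rewrite /butterfly_post -a1 -a2; apply: H; rewrite ?a1 ?a2 //.
have [wx [wy [ewx ewy dw]]] := tws b (block_lt ltl lti).
exists wx, wy; rewrite v41 v42 -ewx -ewy !fa //.
Qed.

Lemma fwd_bodyP : butterfly_post p0 (p0 + h) t (sem fwd_body t)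
  (H0 + tw b * H1)%R (H0 - tw b * H1)%R (2 * e + 3).
Proof.
apply: core => t1 v37 v38 cc tws m0 m1; have pq : p0 + h == p0 = false by rewrite gtn_eqF // -addn1 leq_add2l expn_gt0.
exact: (fwd_core (leq_ltn_trans (leq_addr _ _) p1B) p1B pq v37 v38 cc tws (tw_norm b) m0 m1 B1 BE BR).
Qed.

Lemma inv_bodyP : butterfly_post p0 (p0 + h) t (sem inv_body t)
  (H0 + H1)%R ((tw b)^* * (H0 - H1))%R (2 * e + 3).
Proof.
apply: core => t1 v37 v38 cc tws m0 m1; have pq : p0 + h == p0 = false by rewrite gtn_eqF // -addn1 leq_add2l expn_gt0.
exact: (inv_core (leq_ltn_trans (leq_addr _ _) p1B) p1B pq v37 v38 cc tws (tw_norm b) m0 m1 B0 B1 BE BR).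
Qed.
End Butterfly.
End Stage.
End Machine.

Definition fwd := Seq (Asn 33 (Var 32))
  (For 34 (Var 31) (Seq (For 35 (Var 32) fwd_body) (Asn 33 (Bin ODiv (Var 33) (Cst 2))))).
Definition bwd := Seq (Asn 33 (Cst 1))
  (For 34 (Var 31) (Seq (For 35 (Var 32) inv_body) (Asn 33 (Bin OMul (Var 33) (Cst 2))))).

Lemma sem_seq V Bg c1 c2 s : sem V Bg (Seq c1 c2) s = sem V Bg c2 (sem V Bg c1 s).
Proof. by []. Qed.

Lemma cost_seq V Bg c1 c2 s :
  cost V Bg (Seq c1 c2) s = cost V Bg c1 s + cost V Bg c2 (sem V Bg c1 s).
Proof. by []. Qed.

(** Error after j levels: the errors of the two entries add up and the rounded product contributes
    3. Over K levels this amounts to a factor of about 2^K. *)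
Definition err e0 j := iter j (fun e => 2 * e + 3) e0.

Lemma err_le e0 j : err e0 j + 3 <= 2 ^ j * (e0 + 3).
Proof.
elim: j => [|j IH]; first by rewrite mul1n.
rewrite /err iterS -/(err e0 j) expnS -mulnA; apply: leq_trans (_ : 2 * (err e0 j + 3) <= _).
  lia.
by rewrite leq_mul2l.
Qed.

Lemma err_mono e0 i j : i <= j -> err e0 i <= err e0 j.
Proof.
move=> /subnKC <-; elim: (j - i) => [|d IH]; first by rewrite addn0.
by apply: leq_trans IH _; rewrite addnS /err iterS -/(err e0 _); lia.
Qed.

Section Machine.
Variables (V Bg Q R E : nat).
Local Notation sem := (sem V Bg).
Local Notation cost := (cost V Bg).
Local Notation rep := (rep V).
Local Notation near := (near V).
Local Notation consts := (consts Q R).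
Hypotheses (Q0 : 0 < Q) (V2 : 2 * (Q * R) < V) (BgV : Bg < V).
Variables (K off : nat).
Hypotheses (offB : off + 2 ^ K <= Bg).
Local Notation near_all t old e :=
  (forall p, p < 2 ^ K -> near (arr t 1) (arr t 2) (off + p) (old p) e).

Definition outside t t' := forall q, q < off \/ off + 2 ^ K <= q ->
  arr t' 1 q = arr t 1 q /\ arr t' 2 q = arr t 2 q.

Section Stage.
Variable l : nat.
Hypothesis ltl : l < K.
Let h := 2 ^ (K - l.+1).
Local Notation stage_ctx := (stage_ctx V Q R E K l off).
Local Notation bot i := (bot K l i).
(** Kept abstract in the butterfly, so that both directions share the argument for a level. *)
Variables (body : cmd) (old new : nat -> algC) (e e' : nat).
Hypothesis body_ok : forall t i, i < 2 ^ K.-1 -> stage_ctx t -> var t 35 = i ->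
  near (arr t 1) (arr t 2) (off + bot i) (old (bot i)) e ->
  near (arr t 1) (arr t 2) (off + bot i + h) (old (bot i + h)) e ->
  butterfly_post V (off + bot i) (off + bot i + h) t (sem body t) (new (bot i)) (new (bot i + h)) e'.
Hypothesis body_vars : all (fun y => y \notin wv (For 35 (Var 32) body)) [:: 30; 33; 50; 51; 52].
Hypothesis body_arrs : all (fun y => y \notin wa (For 35 (Var 32) body)) [:: 3; 4].
Hypothesis body_cost : forall t, cost body t <= 200.

Lemma stageP t : stage_ctx t -> var t 32 = 2 ^ K.-1 -> near_all t old e ->
  let t' := sem (For 35 (Var 32) body) t in
  [/\ near_all t' new e', outside t t' & cost (For 35 (Var 32) body) t <= 4 + 2 ^ K.-1 * 205].
Proof.
move=> ctx e32 no.
have ctx_agree t1 : agree (For 35 (Var 32) body) t t1 -> stage_ctx t1.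
  have [[c1 c2 c3] e30 e33 tws] := ctx.
  move: body_vars body_arrs => /= /and5P[n30 n33 n50 n51 /andP[n52 _]] /and3P[n3 n4 _] [fv fa].
  by split; [split|..]; rewrite ?fv // ?fa.
have [|| i t1 lti [It out] fr|] := @for_rule V Bg 35 (Var 32) body t (2 ^ K.-1) (fun i t1 =>
  (forall p, p < 2 ^ K -> if pair_idx K l p < i then near (arr t1 1) (arr t1 2) (off + p) (new p) e'
     else near (arr t1 1) (arr t1 2) (off + p) (old p) e) /\ outside t t1) 200.
- exact: e32.
- by split=> // p ltp; exact: no.
- split; last exact: body_cost.
  have lb := bot_lt ltl lti; rewrite -/h in lb.
  have lb0 : bot i < 2 ^ K := leq_ltn_trans (leq_addr _ _) lb.
  have il := pair_idx_lo ltl i; have ih := pair_idx_hi ltl i; rewrite -/h in ih.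
  have n0 := It _ lb0; have n1 := It _ lb; rewrite il ltnn in n0; rewrite ih ltnn addnA in n1.
  have [||||b0 b1 bo] := @body_ok (setv t1 35 i) i lti => //.
    have [[c1 c2 c3] e30 e33 tws] := ctx_agree _ fr.
    by split; [split|..].
  set t2 := sem body _ in b0 b1 bo *.
  split=> [p ltp|q hq].
    have [epi|npi] := eqVneq (pair_idx K l p) i.
      rewrite epi ltnSn; case: (pair_cases K l p); rewrite epi -/h => ->; first exact: b0.
      by rewrite addnA.
    have -> : (pair_idx K l p < i.+1) = (pair_idx K l p < i) by rewrite ltnS leq_eqVlt (negPf npi).
    have np0 : off + p != off + bot i.
      by rewrite eqn_add2l; apply: contraNneq npi => ->; rewrite il.
    have np1 : off + p != off + bot i + h.
      by rewrite -addnA eqn_add2l; apply: contraNneq npi => ->; rewrite ih.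
    have [r1 r2] := bo _ np0 np1.
    by have := It p ltp; case: ifP => _; apply: near_eq.
  have [||r1 r2] := bo q; last by rewrite r1 r2; apply: out.
    by apply/eqP => eq; case: hq; rewrite eq; lia.
  by apply/eqP => eq; case: hq; rewrite eq; lia.
move=> [It out] cst; split=> // p ltp.
by have := It p ltp; rewrite pair_idx_lt.
Qed.
End Stage.

Hypothesis K0 : 0 < K.
Definition ctx t := [/\ consts t, var t 30 = off, var t 31 = K, var t 32 = 2 ^ K.-1
  & forall b, b < 2 ^ K.-1 -> near (arr t 3) (arr t 4) b (Q%:R * tw b)%R E].

Section Forward.
Variables (f : nat -> algC) (D B : nat).
Hypothesis fB : forall l p, l <= K -> (`|D%:R * fft K f l p| <= B%:R)%R.
Hypotheses (BE : (2 * B + 2 * err 0 K) * E <= Q) (BR : (2 * B + 2 * err 0 K) * (Q + E) <= Q * R).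

Lemma fwdP t : ctx t -> near_all t (fun p => D%:R * f p)%R 0 ->
  let t' := sem fwd t in
  [/\ near_all t' (fun p => D%:R * fft K f K p)%R (err 0 K), outside t t'
    & cost fwd t <= 20 + K * (2 ^ K.-1 * 205 + 20)].
Proof.
move=> [[c1 c2 c3] e30 e31 e32 tws] n0.
set t1 := setv t 33 (2 ^ K.-1).
set body := Seq (For 35 (Var 32) fwd_body) (Asn 33 (Bin ODiv (Var 33) (Cst 2))).
have [|| l t2 ltl [It out e33] [fv fa]|] := @for_rule V Bg 34 (Var 31) body t1 K (fun l t2 =>
  [/\ near_all t2 (fun p => D%:R * fft K f l p)%R (err 0 l), outside t1 t2
    (* After the last level the block length 1 is halved to 0, and nothing is claimed about it. *)
    & var t2 33 = if l < K then 2 ^ (K - l.+1) else var t2 33]) (2 ^ K.-1 * 205 + 15).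
- exact: e31.
- split=> //; last by rewrite K0 subn1.
  by move=> p ltp; rewrite fft0 //; exact: n0.
- rewrite ltl in e33.
  have sc : stage_ctx V Q R E K l off (setv t2 34 l).
    split; [by split; rewrite [LHS]fv|by rewrite [LHS]fv|exact: e33|].
    move=> b ltb; change (near (arr t2 3) (arr t2 4) b (Q%:R * tw b)%R E); rewrite !fa //.
    by apply: tws; apply: leq_trans ltb _; rewrite leq_exp2l //; lia.
  have [||||n1 o1 cst] := @stageP l ltl fwd_body (fun p => D%:R * fft K f l p)%R
     (fun p => D%:R * fft K f l.+1 p)%R (err 0 l) (err 0 l.+1) _ isT isT _ (setv t2 34 l) sc.
  + move=> t3 i lti sc3 e35 m0 m1.
    have el : err 0 l <= err 0 K by apply: err_mono; apply: ltnW.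
    have -> : (D%:R * fft K f l.+1 (bot K l i) = D%:R * fft K f l (bot K l i) +
      tw (i %/ 2 ^ (K - l.+1)) * (D%:R * fft K f l (bot K l i + 2 ^ (K - l.+1))))%R.
      by rewrite fft_next_lo //; ring.
    have -> : (D%:R * fft K f l.+1 (bot K l i + 2 ^ (K - l.+1)) = D%:R * fft K f l (bot K l i) -
      tw (i %/ 2 ^ (K - l.+1)) * (D%:R * fft K f l (bot K l i + 2 ^ (K - l.+1))))%R.
      by rewrite fft_next_hi //; ring.
    apply: (fwd_bodyP Q0 V2 BgV ltl offB lti sc3 e35 m0 m1 (B := B)).
    * by apply: fB; apply: ltnW.
    * by apply: leq_trans BE; rewrite leq_mul2r leq_add2l leq_mul2l el !orbT.
    * by apply: leq_trans BR; rewrite leq_mul2r leq_add2l leq_mul2l el !orbT.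
  + by move=> t3; apply: leq_trans (flat_costP _ _ _ _) _.
  + by rewrite [LHS]fv.
  + exact: It.
  split; last first.
    change (cost (For 35 (Var 32) fwd_body) (setv t2 34 l) + 7 <= 2 ^ K.-1 * 205 + 15).
    by move: cst; lia.
  split.
  + exact: n1.
  + move=> q hq; have [r1 r2] := o1 q hq; have [r3 r4] := out q hq.
    by split; [exact: etrans r1 r3 | exact: etrans r2 r4].
  have e33' : var (sem (For 35 (Var 32) fwd_body) (setv t2 34 l)) 33 = 2 ^ (K - l.+1).
    by rewrite (agree_sem V Bg (For 35 (Var 32) fwd_body) _).1.
  rewrite /body sem_seq; move: (sem (For _ _ _) _) e33' => t4 e33'.
  case lt1: (l.+1 < K) => //.
  by rewrite /= updE /= e33' -{1}(subnSK lt1) expnS mulKn.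
move=> [It out _] cst.
have sE : sem fwd t = sem (For 34 (Var 31) body) t1 by rewrite /t1 -e32.
have cE : cost fwd t = 2 + cost (For 34 (Var 31) body) t1 by rewrite /t1 -e32.
rewrite sE cE; split=> //; move: cst; rewrite [ecost _]/=.
by move: (cost _ _) (2 ^ _ * 205) => u v; rewrite -[v + 15 + 5]addnA; lia.
Qed.
End Forward.

Section Inverse.
Variables (g : nat -> algC) (C : algC) (e0 B : nat).
Hypothesis gB : forall l p, l <= K -> (`|C * 2%:R ^+ (K - l) * fft K g l p| <= B%:R)%R.
Hypotheses (BE : (2 * B + 2 * err e0 K) * E <= Q) (BR : (2 * B + 2 * err e0 K) * (Q + E) <= Q * R).

(** Every inverse level doubles the values, so at level l they are C 2^(K - l) times those of the
    exact transform. *)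
Lemma bwdP t : ctx t -> near_all t (fun p => C * fft K g K p)%R e0 ->
  let t' := sem bwd t in
  [/\ near_all t' (fun p => C * 2%:R ^+ K * g p)%R (err e0 K), outside t t'
    & cost bwd t <= 20 + K * (2 ^ K.-1 * 205 + 20)].
Proof.
move=> [[c1 c2 c3] e30 e31 e32 tws] n0.
set t1 := setv t 33 1.
set body := Seq (For 35 (Var 32) inv_body) (Asn 33 (Bin OMul (Var 33) (Cst 2))).
have KV : 2 ^ K < V by apply: leq_ltn_trans BgV; apply: leq_trans offB; rewrite leq_addl.
have [|| j t2 ltj [It out e33] [fv fa]|] := @for_rule V Bg 34 (Var 31) body t1 K (fun j t2 =>
  [/\ near_all t2 (fun p => C * 2%:R ^+ j * fft K g (K - j) p)%R (err e0 j), outside t1 t2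
    & var t2 33 = 2 ^ j]) (2 ^ K.-1 * 205 + 15).
- exact: e31.
- split=> // p ltp; rewrite expr0 mulr1 subn0; exact: n0.
- pose l := K - j.+1.
  have ltl : l < K by rewrite /l; lia.
  have lS : l.+1 = K - j by rewrite /l; lia.
  have hE : 2 ^ (K - l.+1) = 2 ^ j by rewrite lS subKn // ltnW.
  have sc : stage_ctx V Q R E K l off (setv t2 34 j).
    split; [by split; rewrite [LHS]fv|by rewrite [LHS]fv|by rewrite hE; exact: e33|].
    move=> b ltb; change (near (arr t2 3) (arr t2 4) b (Q%:R * tw b)%R E); rewrite !fa //.
    by apply: tws; apply: leq_trans ltb _; rewrite leq_exp2l //; lia.
  have [||||n1 o1 cst] := @stageP l ltl inv_body (fun p => C * 2%:R ^+ j * fft K g (K - j) p)%R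
     (fun p => C * 2%:R ^+ j.+1 * fft K g l p)%R (err e0 j) (err e0 j.+1) _ isT isT _ (setv t2 34 j) sc.
  + move=> t3 i lti sc3 e35 m0 m1; rewrite -lS in m0 m1.
    have el : err e0 j <= err e0 K by apply: err_mono; apply: ltnW.
    pose lo := fft K g l (bot K l i); pose hi := fft K g l (bot K l i + 2 ^ (K - l.+1)).
    pose w := tw (i %/ 2 ^ (K - l.+1)).
    have Hlo : (fft K g l.+1 (bot K l i) = lo + w * hi)%R by rewrite fft_next_lo.
    have Hhi : (fft K g l.+1 (bot K l i + 2 ^ (K - l.+1)) = lo - w * hi)%R by rewrite fft_next_hi.
    have ww : (w^* * w = 1)%R by rewrite mulrC -normCK tw_norm expr1n.
    have -> : (C * 2%:R ^+ j.+1 * lo = C * 2%:R ^+ j * fft K g l.+1 (bot K l i) +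
        C * 2%:R ^+ j * fft K g l.+1 (bot K l i + 2 ^ (K - l.+1)))%R.
      by rewrite Hlo Hhi exprS; ring.
    have -> : (C * 2%:R ^+ j.+1 * hi = w^* * (C * 2%:R ^+ j * fft K g l.+1 (bot K l i) -
        C * 2%:R ^+ j * fft K g l.+1 (bot K l i + 2 ^ (K - l.+1))))%R.
      transitivity (C * 2%:R ^+ j.+1 * (w^* * w) * hi)%R; first by rewrite ww; ring.
      by rewrite Hlo Hhi exprS; ring.
    have bnd p : (`|C * 2%:R ^+ j * fft K g l.+1 p| <= B%:R)%R.
      have -> : j = K - l.+1 by rewrite lS subKn // ltnW.
      exact: gB.
    apply: (inv_bodyP Q0 V2 BgV ltl offB lti sc3 e35 m0 m1 (B := B)) => //.
    * by apply: leq_trans BE; rewrite leq_mul2r leq_add2l leq_mul2l el !orbT.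
    * by apply: leq_trans BR; rewrite leq_mul2r leq_add2l leq_mul2l el !orbT.
  + by move=> t3; apply: leq_trans (flat_costP _ _ _ _) _.
  + by rewrite [LHS]fv.
  + exact: It.
  split; last first.
    change (cost (For 35 (Var 32) inv_body) (setv t2 34 j) + 5 <= 2 ^ K.-1 * 205 + 15).
    by move: cst; lia.
  split.
  + exact: n1.
  + move=> q hq; have [r1 r2] := o1 q hq; have [r3 r4] := out q hq.
    by split; [exact: etrans r1 r3 | exact: etrans r2 r4].
  have e33' : var (sem (For 35 (Var 32) inv_body) (setv t2 34 j)) 33 = 2 ^ j.
    by rewrite (agree_sem V Bg (For 35 (Var 32) inv_body) _).1.
  rewrite /body sem_seq; move: (sem (For _ _ _) _) e33' => t4 e33'.
  rewrite /= updE /= e33' mulnC -expnS modn_small //.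
  by apply: leq_ltn_trans KV; rewrite leq_exp2l.
move=> [It out _] cst.
have sE : sem bwd t = sem (For 34 (Var 31) body) t1 by [].
have cE : cost bwd t = 2 + cost (For 34 (Var 31) body) t1 by [].
rewrite sE cE; split=> //; first by move=> p ltp; have := It p ltp; rewrite subnn fft0.
move: cst; rewrite [ecost _]/=.
by move: (cost _ _) (2 ^ _ * 205) => u v; rewrite -[v + 15 + 5]addnA; lia.
Qed.
End Inverse.
End Machine.

(** * The table of roots of unity *)

Definition tbl_body := seqs
  [:: Asn 41 (Get 3 (Var 57)); Asn 42 (Get 4 (Var 57)); Asn 37 (eadd (Var 55) (Var 57));
      Sto 3 (Var 37) (rnd (esub (emul (Var 53) (Var 41)) (emul (Var 54) (Var 42))));
      Sto 4 (Var 37) (rnd (eadd (emul (Var 53) (Var 42)) (emul (Var 54) (Var 41))))].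

Definition bisect_body := Seq (Asn 64 (Bin ODiv (eadd (Var 58) (Var 59)) (Cst 2)))
  (Ite (Var 65) (emul (Var 64) (Var 64)) (Asn 59 (Var 64)) (Asn 58 (Var 64))).
Definition bisect := seqs
  [:: Asn 58 (Cst 0); Asn 59 (emul (Cst 2) (Var 50));
      Asn 65 (Bin ODiv (emul (eadd (Var 50) (Var 53)) (Var 50)) (Cst 2));
      For 66 (Var 67) bisect_body].

Definition tw_body := seqs
  [:: For 57 (Var 55) tbl_body; bisect;
      Asn 54 (Bin ODiv (emul (Var 54) (Var 50)) (emul (Cst 2) (Var 58)));
      Asn 53 (Var 58); Asn 55 (emul (Var 55) (Cst 2))].
Definition tw_code := seqs
  [:: Sto 3 (Cst 0) (Var 50); Sto 4 (Cst 0) (Cst 0); Asn 53 (Cst 0); Asn 54 (Var 50);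
      Asn 55 (Cst 1); For 56 (Var 5) tw_body].

Ltac run_code2 t := rewrite fsemE //; cbv beta iota zeta delta [fsem fsetv fseta eval bin var arr eqn
  tbl_body seqs rnd esub eadd emul];
  rewrite -?/(var t) -?/(arr t).

Lemma mid_le u v w : u < v -> v <= w -> (u + v) %/ 2 <= w.
Proof. lia. Qed.

(** The measure hi - lo - 1 halves in every round and stays at 0 afterwards, so surplus rounds are
    harmless. *)
Lemma bisect_left u v : u < v -> 2 * ((u + v) %/ 2 - u - 1) <= v - u - 1.
Proof. lia. Qed.

Lemma bisect_right u v : u < v -> 2 * (v - (u + v) %/ 2 - 1) <= v - u - 1.
Proof. lia. Qed.

Section Machine.
Variables (V Bg Q R : nat).
Local Notation sem := (sem V Bg).
Local Notation cost := (cost V Bg).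
Local Notation rep := (rep V).
Local Notation near := (near V).
Local Notation consts := (consts Q R).
Hypotheses (Q97 : 97 <= Q) (V2 : 2 * (Q * R) < V) (BgV : Bg < V) (QR : 4 * Q <= R).
Let V0 : 0 < V. Proof. by lia. Qed.
Let QQV : 8 * (Q * Q) < V.
Proof. by apply: leq_ltn_trans V2; have := leq_mul (leqnn Q) QR; lia. Qed.

Lemma bisectP t nb : var t 50 = Q -> var t 53 <= 2 * Q -> var t 67 = nb -> 2 * Q < 2 ^ nb ->
  let t' := sem bisect t in
  var t' 58 ^ 2 <= (Q + var t 53) * Q %/ 2 < (var t' 58).+1 ^ 2 /\
  cost bisect t <= 60 + nb * 60.
Proof.
move=> e50 l53 e67 ltnb; set X := _ %/ 2.
have QQ : 97 * Q <= Q * Q by rewrite leq_mul2r Q97 orbT.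
have X3 : (Q + var t 53) * Q <= 3 * (Q * Q).
  by rewrite mulnA leq_mul2r; apply/orP; right; lia.
have e1 : (Q + var t 53) %% V = Q + var t 53 by rewrite modn_small //; lia.
have e2 : ((Q + var t 53) * Q) %% V = (Q + var t 53) * Q by rewrite modn_small //; lia.
have e3 : (2 * Q) %% V = 2 * Q by rewrite modn_small //; lia.
have QQ4 : 2 * Q * (2 * Q) < V.
  by apply: leq_ltn_trans QQV; rewrite mulnACA leq_mul2r orbT.
have XQ : X <= 3 * (Q * Q) := leq_trans (leq_div _ _) X3.
set t1 := setv (setv (setv t 58 0) 59 (2 * Q)) 65 X.
have sE : sem bisect t = sem (For 66 (Var 67) bisect_body) t1.
  rewrite /bisect /seqs !sem_seq; congr (sem _ _).
  by rewrite /= !updE /= e50 e1 e2 e3.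
have cE : cost bisect t = 20 + cost (For 66 (Var 67) bisect_body) t1.
  rewrite /bisect /seqs !cost_seq -sem_seq -sem_seq -/(seqs _) addnA addnA.
  congr (_ + cost _ _).
  by rewrite /= !updE /= e50 e1 e2 e3.
have [|| i t2 lti [[h1 hX] h2' h3 h4] [fv fa]|] := @for_rule V Bg 66 (Var 67) bisect_body t1 nb (fun i t2 =>
  [/\ var t2 58 ^ 2 <= X /\ X < var t2 59 ^ 2, var t2 58 < var t2 59,
     (var t2 59 - var t2 58 - 1) * 2 ^ i <= 2 * Q & var t2 59 <= 2 * Q]) 50.
- exact: e67.
- split; [|rewrite /= !updE /=; lia|rewrite /= !updE /=; lia|by []].
  by rewrite /= !updE /=; split=> //; apply: leq_ltn_trans XQ _; rewrite expnMn; lia.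
- split; last by apply: leq_trans (flat_costP _ _ _ _) _.
  have e65 : var t2 65 = X by rewrite fv.
  have m1 : (var t2 58 + var t2 59) %% V = var t2 58 + var t2 59.
    by rewrite modn_small //; move: h2' h4 QQ QQV; lia.
  set mid := (var t2 58 + var t2 59) %/ 2.
  have md : mid <= 2 * Q := mid_le h2' h4.
  have m2 : (mid * mid) %% V = mid * mid.
    by rewrite modn_small //; apply: leq_ltn_trans (leq_mul md md) QQ4.
  rewrite /= !updE /= e65 m1 -/mid m2.
  have step d : 2 * (d - 1) <= var t2 59 - var t2 58 - 1 -> (d - 1) * 2 ^ i.+1 <= 2 * Q.
    by move=> le; apply: leq_trans h3; rewrite expnS mulnCA mulnA leq_mul2r le orbT.
  have sq n : n ^ 2 = n * n by rewrite expnS expn1.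
  case: ltnP => c; rewrite /= !updE /=; split=> //.
  + by rewrite -(@ltn_exp2r _ _ 2) // (leq_ltn_trans h1) // sq.
  + exact/step/bisect_left.
  + by rewrite -(@ltn_exp2r _ _ 2) // (leq_ltn_trans _ hX) // sq.
  + exact/step/bisect_right.
move=> [[h1 hX] h2 h3 _] cst; rewrite sE cE; split; last first.
  by move: cst; rewrite [ecost _]/=; move: (cost _ _) => u; lia.
set lo := var _ 58 in h1 h2 h3 *; set hi := var _ 59 in hX h2 h3.
have hi1 : hi = lo.+1.
  apply/eqP; rewrite eqn_leq h2 andbT leqNgt; apply/negP => lt.
  have : 1 * 2 ^ nb <= (hi - lo - 1) * 2 ^ nb by rewrite leq_mul2r; apply/orP; right; lia.
  lia.
by rewrite h1 -hi1.
Qed.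

(** Put E = 12 * 8^j. A new entry is the product of [theta j], with error E - 12, and an old entry,
    with error at most E. As E <= Q, [cmul_err_gen] applies with F = 2E and gives 3E - 10 <= 8E. *)
Lemma tblP t j : var t 55 = 2 ^ j -> 2 ^ j.+1 <= Bg -> consts t ->
  12 * 8 ^ j <= Q ->
  near (fun=> var t 53) (fun=> var t 54) 0 (Q%:R * theta j)%R (12 * 8 ^ j - 12) ->
  (forall b, b < 2 ^ j -> near (arr t 3) (arr t 4) b (Q%:R * tw b)%R (12 * 8 ^ j)) ->
  let t' := sem (For 57 (Var 55) tbl_body) t in
  (forall b, b < 2 ^ j.+1 -> near (arr t' 3) (arr t' 4) b (Q%:R * tw b)%R (12 * 8 ^ j.+1)) /\
  cost (For 57 (Var 55) tbl_body) t <= 4 + 2 ^ j * 105.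
Proof.
move=> e55 jB cc jQ nth ntw.
have E8 : 12 * 8 ^ j.+1 = 8 * (12 * 8 ^ j) by rewrite expnS mulnCA.
have E12 : 12 <= 12 * 8 ^ j by rewrite leq_pmulr // expn_gt0.
have two : 2 ^ j.+1 = 2 ^ j + 2 ^ j by rewrite expnS mul2n addnn.
set E := 12 * 8 ^ j in E8 E12 jQ nth ntw.
have [|| b t1 ltb It [fv fa]|] := @for_rule V Bg 57 (Var 55) tbl_body t (2 ^ j) (fun b t1 =>
  forall q, q < 2 ^ j + b -> near (arr t1 3) (arr t1 4) q (Q%:R * tw q)%R
     (if q < 2 ^ j then E else 12 * 8 ^ j.+1)) 100.
- exact: e55.
- by move=> q; rewrite addn0 => ltq; rewrite ltq; apply: ntw.
- split; last by apply: leq_trans (flat_costP _ _ _ _) _.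
  have [c1 c2 c3] : consts t1 by case: cc => *; split; rewrite fv.
  have f55 : var t1 55 = 2 ^ j by rewrite fv.
  have := It b (leq_trans ltb (leq_addr _ _)); rewrite ltb => -[wx [wy [ewx ewy dw]]].
  have [hx [hy [ehx ehy dh]]] := nth.
  have ff53 : var t1 53 = rep hx by rewrite fv.
  have ff54 : var t1 54 = rep hy by rewrite fv.
  have bB : b %% Bg = b by rewrite modn_small //; lia.
  have qV : (2 ^ j + b) %% V = 2 ^ j + b by rewrite modn_small //; lia.
  have qB : (2 ^ j + b) %% Bg = 2 ^ j + b by rewrite modn_small //; lia.
  have HB : (`|Q%:R * theta j| <= Q%:R)%R by rewrite normrM theta_norm mulr1 normr_nat.
  have Q0 : 0 < Q by lia.
  have BE : (Q + (E - 12)) * E <= Q * (2 * E).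
    by rewrite mulnA leq_mul2r; apply/orP; right; lia.
  have BRz : (((Q + (E - 12)) * (Q + E))%N%:Z <= (Q * R)%N%:Z)%R.
    rewrite lez_nat; apply: leq_trans (leq_mul (leqnn Q) QR).
    have -> : Q * (4 * Q) = (2 * Q) * (2 * Q) by ring.
    by apply: leq_mul; move: E12 jQ; generalize E; clear; lia.
  have err := cmul_err_gen Q0 dh dw (tw_norm b) HB BE.
  have [rg1 rg2] := cmul_range dh dw (tw_norm b) HB.
  have rx := rep_round (V := V) V0 Q0 (le_trans rg1 BRz) V2.
  have ry := rep_round (V := V) V0 Q0 (le_trans rg2 BRz) V2.
  set gx := (_ %/ Q)%Z in err rx; set gy := (_ %/ Q)%Z in err ry.
  set t2 := setv t1 57 b.
  have g2 y : y != 57 -> var t2 y = var t1 y by rewrite /= /upd => /negPf->.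
  have g57 : var t2 57 = b by [].
  have ga k : arr t2 k = arr t1 k by [].
  have r3 : arr (sem tbl_body t2) 3 = upd (arr t1 3) (2 ^ j + b) (rep gx).
    run_code2 t2; rewrite g57 !g2 // !ga f55 ff53 ff54 c1 c2 c3 bB ewx ewy qV qB.
    by rewrite !(repM V0) (repB V0) rx.
  have r4 : arr (sem tbl_body t2) 4 = upd (arr t1 4) (2 ^ j + b) (rep gy).
    run_code2 t2; rewrite g57 !g2 // !ga f55 ff53 ff54 c1 c2 c3 bB ewx ewy qV qB.
    by rewrite !(repM V0) (repD V0) ry.
  move=> q ltq; rewrite r3 r4.
  have [->|nq] := eqVneq q (2 ^ j + b).
    rewrite ltnNge leq_addr /=; exists gx, gy; rewrite !updE eqxx; split=> //.
    have -> : (Q%:R * tw (2 ^ j + b) = tw b * (Q%:R * theta j))%R by rewrite tw_split //; ring.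
    by apply: le_trans err _; rewrite ler_nat E8; move: E12; generalize E; clear; lia.
  have := It q; rewrite (_ : q < 2 ^ j + b); last by move: ltq nq; rewrite addnS ltnS leq_eqVlt; case: eqP.
  by move=> /(_ isT); apply: near_eq; rewrite updE (negPf nq).
move=> It cst; split; last by move: cst; rewrite [ecost _]/=; generalize (2 ^ j) (cost (For 57 (Var 55) tbl_body) t); clear; lia.
move=> b ltb; have := It b; rewrite -two => /(_ ltb) [x [y [ex ey d]]]; exists x, y; split=> //.
apply: le_trans d _; rewrite ler_nat; case: ifP => // _; rewrite E8; exact: leq_pmull.
Qed.
End Machine.

Section Machine.
Variables (V Bg Q R : nat).
Local Notation sem := (sem V Bg).
Local Notation cost := (cost V Bg).
Local Notation rep := (rep V).
Local Notation near := (near V).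
Local Notation consts := (consts Q R).
Hypotheses (Q97 : 97 <= Q) (V2 : 2 * (Q * R) < V) (BgV : Bg < V) (QR : 4 * Q <= R).
Let V0 : 0 < V. Proof. by lia. Qed.
Let QQV : 8 * (Q * Q) < V.
Proof. by apply: leq_ltn_trans V2; have := leq_mul (leqnn Q) QR; lia. Qed.

Definition tw_tail := seqs
  [:: Asn 54 (Bin ODiv (emul (Var 54) (Var 50)) (emul (Cst 2) (Var 58)));
      Asn 53 (Var 58); Asn 55 (emul (Var 55) (Cst 2))].

Variables (J nb : nat).
Hypotheses (nbQ : 2 * Q < 2 ^ nb) (JB : 2 ^ J <= Bg) (JQ : 12 * 8 ^ J <= Q).

Lemma twP t : consts t -> var t 5 = J -> var t 67 = nb ->
  let t' := sem tw_code t in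
  (forall b, b < 2 ^ J -> near (arr t' 3) (arr t' 4) b (Q%:R * tw b)%R (12 * 8 ^ J)) /\
  cost tw_code t <= 50 + J * (2 ^ J * 105 + nb * 60 + 100).
Proof.
move=> [c1 c2 c3] e5 e67.
have Bg0 : 0 < Bg by apply: leq_trans JB; rewrite expn_gt0.
pose t1 := setv (setv (setv (seta (seta t 3 0 Q) 4 0 0) 53 0) 54 Q) 55 1.
have tE : sem (Asn 55 (Cst 1)) (sem (Asn 54 (Var 50)) (sem (Asn 53 (Cst 0))
    (sem (Sto 4 (Cst 0) (Cst 0)) (sem (Sto 3 (Cst 0) (Var 50)) t)))) = t1.
  by rewrite /= mod0n !updE /= !c1.
have sE : sem tw_code t = sem (For 56 (Var 5) tw_body) t1.
  by rewrite /tw_code /seqs !sem_seq tE.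
have cE : cost tw_code t = 20 + cost (For 56 (Var 5) tw_body) t1.
  by rewrite /tw_code /seqs !cost_seq tE !addnA.
have QV : Q < V by apply: leq_ltn_trans QQV; have := leq_mul (leqnn Q) (leq_trans (isT : 1 <= 97) Q97); lia.
have [|| j t2 ltj [h55 hth htw] [fv fa]|] := @for_rule V Bg 56 (Var 5) tw_body t1 J (fun j t2 =>
  [/\ var t2 55 = 2 ^ j,
    (`|gi (var t2 53) (var t2 54) - Q%:R * theta j| <= (12 * 8 ^ j - 12)%:R)%R
    & forall b, b < 2 ^ j -> near (arr t2 3) (arr t2 4) b (Q%:R * tw b)%R (12 * 8 ^ j)])
   (2 ^ J * 105 + nb * 60 + 90).
- exact: e5.
- split=> // [|b].
    (* The starting values [theta 0] = i and [tw 0] = 1 are represented without error. *)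
    rewrite /= (_ : gi 0 Q - Q%:R * 'i = 0)%R ?normr0 //.
    by rewrite /gi add0r mulrC subrr.
  rewrite expn0 ltnS leqn0 => /eqP->; exists Q, 0; split; rewrite ?rep_nat //=.
  by rewrite gi_nat tw0 mulr1 subrr normr0 ler0n.
- set E := 12 * 8 ^ j in hth htw.
  have EE : E <= Q by apply: leq_trans JQ; rewrite leq_mul2l leq_exp2l // ltnW.
  have EE' : E - 12 <= Q := leq_trans (leq_subr _ _) EE.
  have E12 : 12 <= E by rewrite leq_pmulr // expn_gt0.
  have jB : 2 ^ j.+1 <= Bg by apply: leq_trans JB; rewrite leq_exp2l.
  set a := var t2 53 in hth; set b := var t2 54 in hth.
  have TB : (`|Q%:R * theta j| <= Q%:R)%R by rewrite normrM theta_norm mulr1 normr_nat.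
  have hB := near_le hth TB.
  have aQ : a <= 2 * Q by have := gi_re hB; move: EE'; generalize (E - 12); clear; lia.
  have bQ : b <= 2 * Q by have := gi_im hB; move: EE'; generalize (E - 12); clear; lia.
  have Q2V : 2 * Q < V by apply: leq_ltn_trans QQV; have := leq_mul (leqnn Q) (leq_trans (isT : 1 <= 97) Q97); lia.
  have aV : a < V := leq_ltn_trans aQ Q2V.
  have bV : b < V := leq_ltn_trans bQ Q2V.
  set t3 := setv t2 56 j.
  have cc3 : consts t3 by split; rewrite [LHS]fv.
  have nth : near (fun=> var t3 53) (fun=> var t3 54) 0 (Q%:R * theta j)%R (12 * 8 ^ j - 12).
    by exists a, b; split; rewrite ?rep_nat.
  have [ntab ctab] := tblP Q97 V2 BgV QR (t := t3) h55 jB cc3 EE nth htw.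
  set t4 := sem (For 57 (Var 55) tbl_body) t3 in ntab.
  have [fv4 fa4] : agree (For 57 (Var 55) tbl_body) t3 t4 := agree_sem _ _ _ _.
  have e4 : [/\ var t4 50 = Q, var t4 53 = a, var t4 54 = b, var t4 55 = 2 ^ j & var t4 67 = nb].
    by split; rewrite fv4 // [LHS]/=; rewrite ?[LHS]fv.
  case: e4 => e450 e453 e454 e455 e467.
  have a4 : var t4 53 <= 2 * Q by rewrite e453.
  have [bis cbis] := bisectP Q97 V2 BgV QR e450 a4 e467 nbQ.
  set t5 := sem bisect t4 in bis.
  have [fv5 fa5] : agree bisect t4 t5 := agree_sem _ _ _ _.
  set x := var t5 58 in bis; rewrite e453 in bis.
  have stp := theta_step Q97 EE' hth bis.
  have x2Q : x <= 2 * Q.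
    have [bl _] := andP bis; rewrite -(@leq_exp2r _ _ 2) //; apply: leq_trans bl _.
    apply: leq_trans (leq_div _ _) _; rewrite expnMn mulnA leq_mul2r; apply/orP; right.
    by move: aQ; clear; lia.
  have x0 : 0 < 2 * x.
    rewrite muln_gt0 /= lt0n; apply/eqP => xe; have [_ bu] := andP bis; move: bu; rewrite xe.
    rewrite ltnS leqn0 -leqn0 leqNgt divn_gt0 // => /negP; apply.
    by apply: leq_trans (leq_mul (leq_addr a Q) Q97); move: Q97; clear; lia.
  have j2V : 2 ^ j * 2 < V by rewrite mulnC -expnS; apply: leq_ltn_trans BgV.
  have QQ4 : 2 * Q * (2 * Q) < V.
    by apply: leq_ltn_trans QQV; rewrite mulnACA leq_mul2r orbT.
  have bQV : b * Q < V.
    by apply: leq_ltn_trans QQ4; apply: leq_mul => //; apply: leq_pmull.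
  have xV : 2 * x < V.
    by apply: leq_ltn_trans QQ4; apply: leq_mul => //; move: Q97; clear; lia.
  have bE : sem tw_body t3 = sem tw_tail t5 by rewrite /tw_body /tw_tail /seqs !sem_seq.
  have cEb : cost tw_body t3 = cost (For 57 (Var 55) tbl_body) t3 + (cost bisect t4 + 20).
    by rewrite /tw_body /seqs !cost_seq.
  have m1 : var (sem tw_tail t5) 54 = (b * Q) %/ (2 * x).
    rewrite /tw_tail /= !updE /= -/x [var t5 54]fv5 // [var t5 50]fv5 // e454 e450.
    rewrite (modn_small bQV) (modn_small xV); congr (_ %/ _).
    by move: x0; clear; lia.
  have m2 : var (sem tw_tail t5) 53 = x by [].
  have m3 : var (sem tw_tail t5) 55 = 2 ^ j.+1.
    rewrite /tw_tail /= !updE /= [var t5 55]fv5 // e455 modn_small // mulnC -expnS //.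
  have m4 k : arr (sem tw_tail t5) k = arr t4 k by rewrite [LHS]fa5.
  rewrite bE cEb; split.
    rewrite m1 m2 m3 !m4; split=> //.
    apply: le_trans stp _; rewrite ler_nat expnS mulnCA -/E.
    by move: E12; generalize E; clear; lia.
  move: ctab cbis; have : 2 ^ j <= 2 ^ J by rewrite leq_exp2l // ltnW.
  by generalize (2 ^ j) (2 ^ J) (cost (For 57 (Var 55) tbl_body) t3) (cost bisect t4); clear; lia.
move=> [_ _ It] cst; rewrite sE cE; split=> //.
by move: cst; rewrite [ecost _]/=; generalize (2 ^ J * 105) (cost (For 56 (Var 5) tw_body) t1); clear; nia.
Qed.
End Machine.

(** * Doubling the table of feasible integers *)

Definition clear_body := Seq (Sto 1 (Var 76) (Cst 0)) (Sto 2 (Var 76) (Cst 0)).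
Definition load1_body := Sto 1 (Var 76) (emul (Var 68) (Get 5 (Var 76))).
Definition load2_body := Sto 1 (eadd (Var 71) (Var 76)) (emul (Var 68) (Get 6 (Var 76))).
(** Both operands share the arrays 1 and 2, at [0, N) and [N, 2N); register 30 later selects the one
    to be transformed. *)
Definition load := Seq (For 76 (emul (Cst 2) (Var 71)) clear_body)
  (Seq (For 76 (Var 70) load1_body) (For 76 (Var 72) load2_body)).

(** Nothing is rounded here: the three scaled factors are multiplied exactly, modulo V. *)
Definition pw_body := seqs
  [:: Asn 39 (Get 1 (Var 76)); Asn 40 (Get 2 (Var 76)); Asn 38 (eadd (Var 71) (Var 76));
      Asn 41 (Get 1 (Var 38)); Asn 42 (Get 2 (Var 38));
      Asn 43 (esub (emul (Var 39) (Var 39)) (emul (Var 40) (Var 40)));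
      Asn 44 (eadd (emul (Var 39) (Var 40)) (emul (Var 40) (Var 39)));
      Sto 1 (Var 76) (esub (emul (Var 43) (Var 41)) (emul (Var 44) (Var 42)));
      Sto 2 (Var 76) (eadd (emul (Var 43) (Var 42)) (emul (Var 44) (Var 41)))].
Definition pointwise := For 76 (Var 71) pw_body.

(** With H = N D^3 / 2 in register 69, the test H < x is carried out as 2H < x + H, because an entry
    x near 0 may be negative. *)
Definition thr_body := Ite (emul (Cst 2) (Var 69)) (eadd (Get 1 (Var 76)) (Var 69))
  (Sto 5 (Var 76) (Cst 1)) (Sto 5 (Var 76) (Cst 0)).
Definition threshold := Seq
  (Asn 69 (Bin ODiv (emul (Var 71) (emul (Var 68) (emul (Var 68) (Var 68)))) (Cst 2)))
  (For 76 (Var 72) thr_body).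

Ltac run_code3 t := rewrite fsemE //; cbv beta iota zeta delta [fsem fsetv fseta eval bin var arr eqn
  clear_body load1_body load2_body pw_body thr_body seqs rnd esub eadd emul];
  rewrite -?/(var t) -?/(arr t).

Section Machine.
Variables (V Bg D : nat).
Local Notation sem := (sem V Bg).
Local Notation cost := (cost V Bg).
Local Notation rep := (rep V).
Local Notation near := (near V).
Variable L : nat.
Let N := 4 * L.
Hypotheses (NB : 2 * N <= Bg) (BgV : Bg < V) (DV : D < V).
Let V0 : 0 < V. Proof. by lia. Qed.

Definition cut k (f : nat -> nat) i := if i < k then f i else 0.

Lemma loadP t : var t 70 = L -> var t 71 = N -> var t 72 = 2 * L -> var t 68 = D ->
  (forall i, i < L -> arr t 5 i <= 1) -> (forall i, i < 2 * L -> arr t 6 i <= 1) ->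
  let t' := sem load t in
  [/\ forall p, p < N -> arr t' 1 p = D * cut L (arr t 5) p,
      forall p, p < N -> arr t' 1 (N + p) = D * cut (2 * L) (arr t 6) p,
      forall p, p < 2 * N -> arr t' 2 p = 0
    & cost load t <= 30 + L * 1000].
Proof.
move=> e70 e71 e72 e68 S1 A1.
have pB p : p < 2 * N -> p %% Bg = p by move=> ltp; rewrite modn_small // (leq_trans ltp).
have DM b : b <= 1 -> (D * b) %% V = D * b.
  by move=> b1; rewrite modn_small // (leq_ltn_trans _ DV) // -{2}[D]muln1 leq_mul2l b1 orbT.
have NV : 2 * N < V := leq_ltn_trans NB BgV.
have LN : 2 * L <= N by rewrite leq_mul2r orbT.
have LN1 : L <= N by rewrite leq_pmull.
have NN : N + N = 2 * N by rewrite mul2n addnn.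
have [|| i t1 lti [h1 h2] [fv fa]|] := @for_rule V Bg 76 (emul (Cst 2) (Var 71)) clear_body t (2 * N)
  (fun i t1 => (forall p, p < i -> arr t1 1 p = 0) /\ (forall p, p < i -> arr t1 2 p = 0)) 20.
- by rewrite /= e71 modn_small.
- by [].
- split; last by apply: leq_trans (flat_costP _ _ _ _) _.
  rewrite /= !updE /= pB //; split=> p; rewrite updE ltnS leq_eqVlt; case: eqP => //= _; [exact: h1|exact: h2].
set t1 := sem _ t => -[h1 h2] cst1.
have [fv1 fa1] : agree (For 76 (emul (Cst 2) (Var 71)) clear_body) t t1 := agree_sem _ _ _ _.
have [|| i t2 lti [h3 h4] [fv fa]|] := @for_rule V Bg 76 (Var 70) load1_body t1 L
  (fun i t2 => (forall p, p < i -> arr t2 1 p = D * arr t 5 p) /\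
     (forall p, i <= p -> arr t2 1 p = arr t1 1 p)) 20.
- by rewrite /= fv1.
- by [].
- split; last by apply: leq_trans (flat_costP _ _ _ _) _.
  have e5 : arr t2 5 = arr t 5 by rewrite fa // fa1.
  have ii : i %% Bg = i by rewrite pB // (leq_trans lti) // -NN (leq_trans LN1) // leq_addr.
  have f68 : var t2 68 = D by rewrite fv // fv1.
  rewrite /= !updE /= ii e5 f68 DM ?S1 //; split=> p.
    by rewrite updE ltnS leq_eqVlt; case: eqP => [->|] //= _; exact: h3.
  by move=> lt; rewrite updE gtn_eqF // h4 // ltnW.
set t2 := sem _ t1 => -[h3 h4] cst2.
have [fv2 fa2] : agree (For 76 (Var 70) load1_body) t1 t2 := agree_sem _ _ _ _.
have [|| i t3 lti [h5 h6] [fv fa]|] := @for_rule V Bg 76 (Var 72) load2_body t2 (2 * L)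
  (fun i t3 => (forall p, p < i -> arr t3 1 (N + p) = D * arr t 6 p) /\
     (forall p, (p < N) || (N + i <= p) -> arr t3 1 p = arr t2 1 p)) 20.
- by rewrite /= fv2 // fv1.
- by [].
- split; last by apply: leq_trans (flat_costP _ _ _ _) _.
  have e6 : arr t3 6 = arr t 6 by rewrite fa // fa2 // fa1.
  have iN : i < N by apply: leq_trans lti LN.
  have ii : i %% Bg = i by rewrite pB // (leq_trans iN) // -NN leq_addr.
  have f68 : var t3 68 = D by rewrite fv // fv2 // fv1.
  have f71 : var t3 71 = N by rewrite fv // fv2 // fv1.
  have Ni2 : N + i < 2 * N by rewrite -NN ltn_add2l.
  have Ni : (N + i) %% V %% Bg = N + i by rewrite (modn_small (ltn_trans Ni2 NV)) pB.
  rewrite /= !updE /= ii e6 f68 f71 DM ?A1 // Ni; split=> p.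
    by rewrite updE eqn_add2l ltnS leq_eqVlt; case: eqP => [->|] //= _; exact: h5.
  rewrite updE addnS => lt; have -> : p == N + i = false by apply/eqP; move: lt; clear; lia.
  by apply: h6; move: lt; clear; lia.
set t3 := sem _ t2 => -[h5 h6] cst3.
have [fv3 fa3] : agree (For 76 (Var 72) load2_body) t2 t3 := agree_sem _ _ _ _.
have sE : sem load t = t3 by [].
have cE : cost load t = cost (For 76 (emul (Cst 2) (Var 71)) clear_body) t +
  (cost (For 76 (Var 70) load1_body) t1 + cost (For 76 (Var 72) load2_body) t2) by [].
rewrite sE cE; split.
- move=> p ltp; rewrite h6 ?ltp // /cut; case: ltnP => le; first exact: h3.
  by rewrite h4 // h1 ?muln0 // -NN (leq_trans ltp) // leq_addr.
- move=> p ltp; rewrite /cut; case: ltnP => le; first exact: h5.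
  rewrite h6 ?leq_add2l ?le ?orbT // h4 ?(leq_trans LN1) ?leq_addr // h1 ?muln0 //.
  by rewrite -NN ltn_add2l.
- by move=> p ltp; rewrite fa3 // fa2 // h2.
move: cst1 cst2 cst3; rewrite ![ecost _]/= /N.
by generalize (cost (For 76 (emul (Cst 2) (Var 71)) clear_body) t) (cost (For 76 (Var 70) load1_body) t1) (cost (For 76 (Var 72) load2_body) t2); clear; lia.
Qed.

(** From e <= b follows |z| <= 2b, and the two summands contribute 4 b^2 e and 3 b^2 e. *)
Lemma mul3_err (z1 z2 y1 y2 : int) (Z Y : algC) (b e : nat) :
  (`|gi z1 z2 - Z| <= e%:R)%R -> (`|gi y1 y2 - Y| <= e%:R)%R ->
  (`|Z| <= b%:R)%R -> (`|Y| <= b%:R)%R -> e <= b ->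
  (`|gi z1 z2 ^+ 2 * gi y1 y2 - Z ^+ 2 * Y| <= (7 * (b * b * e))%:R)%R.
Proof.
set z := gi z1 z2; set y := gi y1 y2 => dz dy Zb Yb eb.
have zb : (`|z| <= (2 * b)%:R)%R.
  by apply: le_trans (near_le dz Zb) _; rewrite ler_nat mul2n -addnn leq_add2l.
have -> : (z ^+ 2 * y - Z ^+ 2 * Y = z * z * (y - Y) + (z - Z) * ((z + Z) * Y))%R by ring.
apply: le_trans (ler_normD _ _) _; rewrite !normrM.
have h1 : (`|z| * `|z| * `|y - Y| <= (2 * b * (2 * b) * e)%:R)%R.
  by rewrite (natrM _ (2 * b * (2 * b)) e) ler_pM // ?mulr_ge0 // (natrM _ (2 * b) (2 * b)) ler_pM.
have h2 : (`|z + Z| <= (3 * b)%:R)%R.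
  apply: le_trans (ler_normD _ _) _; rewrite (_ : 3 * b = 2 * b + b); last by clear; lia.
  by rewrite natrD lerD.
have h3 : (`|z - Z| * (`|z + Z| * `|Y|) <= (e * (3 * b * b))%:R)%R.
  by rewrite (natrM _ e) ler_pM // ?mulr_ge0 // (natrM _ (3 * b) b) ler_pM.
apply: le_trans (lerD h1 h3) _; rewrite -natrD ler_nat; clear; lia.
Qed.

Lemma pointwiseP t e b (F G : nat -> algC) : var t 71 = N ->
  (forall p, p < N -> near (arr t 1) (arr t 2) p (F p) e) ->
  (forall p, p < N -> near (arr t 1) (arr t 2) (N + p) (G p) e) ->
  (forall p, (`|F p| <= b%:R)%R) -> (forall p, (`|G p| <= b%:R)%R) -> e <= b ->
  let t' := sem pointwise t in
  (forall p, p < N -> near (arr t' 1) (arr t' 2) p (F p ^+ 2 * G p)%R (7 * (b * b * e))) /\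
  cost pointwise t <= 4 + N * 205.
Proof.
move=> e71 nF nG Fb Gb eb.
have pB p : p < 2 * N -> p %% Bg = p by move=> ltp; rewrite modn_small // (leq_trans ltp).
have NN : N + N = 2 * N by rewrite mul2n addnn.
have [|| i t1 lti [h1 h2] [fv fa]|] := @for_rule V Bg 76 (Var 71) pw_body t N
  (fun i t1 => (forall p, p < i -> near (arr t1 1) (arr t1 2) p (F p ^+ 2 * G p)%R (7 * (b * b * e))) /\
     (forall p, i <= p -> arr t1 1 p = arr t 1 p /\ arr t1 2 p = arr t 2 p)) 200.
- exact: e71.
- by [].
- split; last by apply: leq_trans (flat_costP _ _ _ _) _.
  have f71 : var t1 71 = N by rewrite fv.
  have ii : i %% Bg = i by rewrite pB // (leq_trans lti) // -NN leq_addr.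
  have Ni2 : N + i < 2 * N by rewrite -NN ltn_add2l.
  have NV : 2 * N < V := leq_ltn_trans NB BgV.
  have NiV : (N + i) %% V = N + i := modn_small (ltn_trans Ni2 NV).
  have NiB : (N + i) %% Bg = N + i by rewrite pB.
  have [z1 [z2 [ez1 ez2 dz]]] := nF i lti; have [y1 [y2 [ey1 ey2 dy]]] := nG i lti.
  have [r1 r2] := h2 i (leqnn i); rewrite -r1 in ez1; rewrite -r2 in ez2.
  have [r3 r4] := h2 (N + i) (leq_addl _ _); rewrite -r3 in ey1; rewrite -r4 in ey2.
  have err := mul3_err dz dy (Fb i) (Gb i) eb.
  pose gx := ((z1 * z1 - z2 * z2) * y1 - (z1 * z2 + z2 * z1) * y2)%R.
  pose gy := ((z1 * z1 - z2 * z2) * y2 + (z1 * z2 + z2 * z1) * y1)%R.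
  have gE : (gi z1 z2 ^+ 2 * gi y1 y2 = gi gx gy)%R by rewrite expr2 !giM.
  rewrite gE in err.
  set t2 := setv t1 76 i.
  have g2 y : y != 76 -> var t2 y = var t1 y by rewrite /= /upd => /negPf->.
  have g76 : var t2 76 = i by [].
  have ga k : arr t2 k = arr t1 k by [].
  have a1 : arr (sem pw_body t2) 1 = upd (arr t1 1) i (rep gx).
    run_code3 t2; rewrite g76 !g2 // !ga f71 ii NiV NiB ez1 ez2 ey1 ey2.
    by rewrite !(repM V0) !(repB V0) !(repD V0) !(repM V0) !(repB V0).
  have a2 : arr (sem pw_body t2) 2 = upd (arr t1 2) i (rep gy).
    run_code3 t2; rewrite g76 !g2 // !ga f71 ii NiV NiB ez1 ez2 ey1 ey2.
    by rewrite !(repM V0) !(repB V0) !(repD V0) !(repM V0) !(repD V0).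
  split=> p.
    rewrite ltnS leq_eqVlt => /orP[/eqP->|ltp].
      by exists gx, gy; rewrite a1 a2 !updE eqxx.
    have ne : p == i = false by rewrite ltn_eqF.
    by apply: near_eq (h1 p ltp); rewrite ?a1 ?a2 updE ne.
  by move=> ltp; rewrite a1 a2 !updE gtn_eqF //; apply: h2; apply: ltnW.
move=> [h1 _] cst; split=> //.
Qed.

Lemma thresholdP t (cnt : nat -> nat) e Z : var t 71 = N -> var t 72 = 2 * L -> var t 68 = D ->
  (forall p, p < N -> near (arr t 1) (arr t 2) p ((N * D ^ 3)%N%:R * (cnt p)%:R)%R e) ->
  (forall p, cnt p <= Z) -> 2 * e < N * D ^ 3 -> N * D ^ 3 * (Z + 2) < V ->
  let t' := sem threshold t in
  (forall p, p < 2 * L -> arr t' 5 p = (0 < cnt p)) /\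
  cost threshold t <= 50 + 2 * L * 45.
Proof.
move=> e71 e72 e68 nr cZ eD ZV.
set W := N * D ^ 3 in nr eD ZV.
have W0 : 0 < W by move: eD; clear; lia.
have D30 : 0 < D by move: W0; rewrite /W; case: (posnP D) => [->|//]; rewrite exp0n // muln0.
have L0 : 0 < L by move: W0; rewrite /W /N; case: (posnP L) => [->|//]; rewrite muln0 mul0n.
have WV : W < V by apply: leq_ltn_trans ZV; rewrite leq_pmulr // addn2.
have WE : W = N * (D * (D * D)) by rewrite /W !expnS expn0 muln1.
have N0 : 0 < N by rewrite /N muln_gt0.
have l3 : D * (D * D) <= W by rewrite WE leq_pmull.
have d3 : (D * (D * D)) %% V = D * (D * D) := modn_small (leq_ltn_trans l3 WV).
have d2 : (D * D) %% V = D * D.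
  by apply: modn_small; apply: leq_ltn_trans WV; apply: leq_trans l3; rewrite leq_pmull.
set Hh := 2 * L * D ^ 3.
have WH : W = 2 * Hh by rewrite /W /N /Hh !mulnA.
set t1 := setv t 69 Hh.
have tE : sem (Asn 69 (Bin ODiv (emul (Var 71) (emul (Var 68) (emul (Var 68) (Var 68)))) (Cst 2))) t = t1.
  by rewrite /= e71 e68 d2 d3 -WE modn_small // WH mulKn.
have HV : 2 * Hh < V by rewrite -WH.
have pB p : p < 2 * L -> p %% Bg = p.
  move=> ltp; rewrite modn_small // (leq_trans ltp) // (leq_trans _ NB) //.
  by rewrite /N mulnA leq_mul2r orbT.
have [|| i t2 lti h [fv fa]|] := @for_rule V Bg 76 (Var 72) thr_body t1 (2 * L)
  (fun i t2 => forall p, p < i -> arr t2 5 p = (0 < cnt p)) 40.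
- exact: e72.
- by [].
- split; last by apply: leq_trans (flat_costP _ _ _ _) _.
  have f69 : var t2 69 = Hh by rewrite fv.
  have ltiN : i < N by apply: leq_trans lti _; rewrite /N leq_mul2r orbT.
  have [x [y [ex _ d]]] := nr i ltiN.
  have e1 : arr t2 1 i = rep x by rewrite fa.
  have xe : (`|x - (W * cnt i)%N%:Z| <= e%:Z)%R.
    have := d; rewrite -natrM -gi_nat giB subr0; exact: gi_re.
  have cz := cZ i.
  have Wc : W * cnt i <= W * Z by rewrite leq_mul2l cz orbT.
  rewrite mulnDr in ZV.
  have val : (((rep x + Hh) %% V)%N%:Z = x + Hh%:Z)%R.
    have HhV : Hh < V by move: HV; clear; lia.
    rewrite -{1}(rep_nat HhV) (repD V0) repE // modz_small //.
    by move: xe Wc ZV eD WH; generalize (W * cnt i) (W * Z); clear; lia.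
  rewrite /= !updE /= f69 pB // e1 [_ %% V in X in X < _]modn_small //.
  have -> : (2 * Hh < (rep x + Hh) %% V) = (0 < cnt i).
    have [c0|c1] := posnP (cnt i).
      by apply/negbTE; rewrite -leqNgt; move: xe val eD WH; rewrite c0 muln0; clear; lia.
    have : W * 1 <= W * cnt i by rewrite leq_mul2l c1 orbT.
    by move: xe val eD WH; rewrite muln1; generalize (W * cnt i); clear; lia.
  move=> p; rewrite ltnS leq_eqVlt; case: eqP => [->|/eqP ne] /=.
    by case: (0 < cnt i) => _; rewrite /= updE eqxx.
  by move=> /h <-; case: (0 < cnt i); rewrite /= updE (negPf ne).
move=> h cst.
have sE : sem threshold t = sem (For 76 (Var 72) thr_body) t1 by rewrite -tE.
have cE : cost threshold t = 16 + cost (For 76 (Var 72) thr_body) t1 by rewrite -tE.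
rewrite sE cE; split=> //.
by move: cst; rewrite [ecost _]/=; generalize (cost (For 76 (Var 72) thr_body) t1); clear; lia.
Qed.
End Machine.

Definition step_of cl cf cp cb ct := seqs
  [:: Asn 71 (emul (Cst 4) (Var 70)); Asn 72 (emul (Cst 2) (Var 70)); Asn 32 (Var 72);
      Asn 31 (eadd (Var 75) (Cst 2)); cl;
      Asn 30 (Cst 0); cf; Asn 30 (Var 71); cf; Asn 30 (Cst 0);
      cp; cb; ct; Asn 70 (Var 72)].
Definition step_body := step_of load fwd pointwise bwd threshold.

Lemma cost_asn V Bg x e s : cost V Bg (Asn x e) s = ecost e + 1.
Proof. by []. Qed.

(* The commands are kept abstract so that rewriting does not unfold them. *)
Lemma step_ofE V Bg cl cf cp cb ct t t1 N :
  sem V Bg (Asn 31 (eadd (Var 75) (Cst 2))) (sem V Bg (Asn 32 (Var 72))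
   (sem V Bg (Asn 72 (emul (Cst 2) (Var 70))) (sem V Bg (Asn 71 (emul (Cst 4) (Var 70))) t))) = t1 ->
  let t2 := sem V Bg cl t1 in let t4 := sem V Bg cf (setv t2 30 0) in
  var t4 71 = N ->
  let t6 := sem V Bg cf (setv t4 30 N) in let t7 := setv t6 30 0 in
  let t8 := sem V Bg cp t7 in let t9 := sem V Bg cb t8 in let t10 := sem V Bg ct t9 in
  sem V Bg (step_of cl cf cp cb ct) t = setv t10 70 (var t10 72) /\
  cost V Bg (step_of cl cf cp cb ct) t = 25 + (cost V Bg cl t1 + (cost V Bg cf (setv t2 30 0) +
    (cost V Bg cf (setv t4 30 N) + (cost V Bg cp t7 + (cost V Bg cb t8 + cost V Bg ct t9))))).
Proof.
move=> s1 t2 t4 v4 t6 t7 t8 t9 t10.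
have s5 : sem V Bg (Asn 30 (Var 71)) t4 = setv t4 30 N by rewrite /= v4.
have s0 s : sem V Bg (Asn 30 (Cst 0)) s = setv s 30 0 by [].
rewrite /step_of /seqs !sem_seq !cost_seq !s1 !s0 -/t2 -/t4 !s5 -/t6 -/t7 -/t8 -/t9 -/t10.
split=> //; rewrite !cost_asn.
generalize (cost V Bg cl t1) (cost V Bg cf (setv t2 30 0)) (cost V Bg cf (setv t4 30 N))
  (cost V Bg cp t7) (cost V Bg cb t8) (cost V Bg ct t9); clear; move=> *; rewrite /=; lia.
Qed.

Section Machine.
Variables (V Bg Q R E D j : nat).
Local Notation sem := (sem V Bg).
Local Notation cost := (cost V Bg).
Local Notation rep := (rep V).
Local Notation near := (near V).
Local Notation consts := (consts Q R).
Let L := 2 ^ j.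
Let K := j.+2.
Let N := 4 * L.
(** A common bound for [2 * B + 2 * err] in the forward transforms ([Z1]) and in the inverse one
    ([Z2]). *)
Let Z := 4 * (D ^ 3 * N ^ 3).
Hypotheses (Q0 : 0 < Q) (V2 : 2 * (Q * R) < V) (BgV : Bg < V) (NB : 2 * N <= Bg) (DN : 50 * N ^ 3 <= D)
  (EQ : E <= Q) (ZE : Z * E <= Q) (ZR : 2 * Z <= R).

Let N0 : 4 <= N. Proof. by rewrite leq_pmulr // expn_gt0. Qed.
Let NE : N = 2 ^ K. Proof. by rewrite /N /L /K !expnS mulnA. Qed.
Let hE : 2 * L = 2 ^ K.-1. Proof. by rewrite /L /K expnS. Qed.
Let ZQ : Z * (Q + E) <= Q * R.
Proof.
apply: leq_trans (_ : Z * (2 * Q) <= _); first by rewrite leq_mul2l mul2n -addnn leq_add2l EQ orbT.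
by rewrite mulnCA [Z * Q]mulnC mulnCA leq_mul2l ZR orbT.
Qed.
Let N3 : N <= N ^ 3. Proof. by rewrite -{1}[N]expn1 leq_pexp2l //; apply: leq_trans N0. Qed.
Let D0 : 50 * 4 <= D.
Proof. by apply: leq_trans DN; rewrite leq_mul2l (leq_trans N0 N3). Qed.
(** Error of the pointwise products, from [mul3_err] with values up to D N and transform errors up
    to 3N. *)
Let e0 := 7 * (D * N * (D * N) * (3 * N)).
(** e0 = 21 D^2 N^3 is only quadratic in D, so 2 e0 = 42 D^2 N^3; the factor 50 in D >= 50 N^3
    leaves room for the added constant. *)
Let e0D : 2 * (e0 + 3) <= D ^ 3.
Proof.
have -> : e0 = 21 * (D * D * N ^ 3) by rewrite /e0 !expnS expn0; ring.
have h : D * D * (50 * N ^ 3) <= D * D * D by rewrite leq_mul2l DN orbT.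
have -> : D ^ 3 = D * D * D by rewrite !expnS expn0; ring.
have h1 : 1 <= D * D * N ^ 3 by rewrite !muln_gt0 expn_gt0; move: D0 N0; clear; lia.
rewrite (mulnCA (D * D)) in h.
by apply: leq_trans h; move: h1; generalize (D * D * N ^ 3); clear; lia.
Qed.
Let D3 : D <= D ^ 3. Proof. by rewrite -{1}[D]expn1 leq_pexp2l //; apply: leq_trans D0. Qed.
Let Z1 : 2 * (D * N) + 2 * (3 * N) <= Z.
Proof.
have h1 : D * N <= D ^ 3 * N ^ 3 by apply: leq_mul.
have h2 : 3 * N <= D * N by rewrite leq_mul2r; apply/orP; right; move: D0; clear; lia.
by rewrite /Z; move: h1 h2; generalize (D * N) (3 * N) (D ^ 3 * N ^ 3); clear; lia.
Qed.
Let Z2 : 2 * (D ^ 3 * N ^ 3) + 2 * (N * (e0 + 3)) <= Z.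
Proof.
have : N * (2 * (e0 + 3)) <= N ^ 3 * D ^ 3 by apply: leq_mul.
by rewrite /Z mulnCA [N ^ 3 * _]mulnC; generalize (N * (e0 + 3)) (D ^ 3 * N ^ 3); clear; lia.
Qed.
Let ZV : Z * 4 < V.
Proof.
apply: leq_ltn_trans V2; rewrite mulnC; apply: leq_trans (_ : 2 * (1 * R) <= _).
  by rewrite mul1n (_ : 4 * Z = 2 * (2 * Z)) ?leq_mul2l // mulnA.
by rewrite leq_mul2l leq_mul2r Q0 orbT.
Qed.
Let DV : D < V.
Proof.
apply: leq_ltn_trans ZV; rewrite /Z mulnC mulnA; apply: leq_trans D3 _.
rewrite mulnCA leq_pmulr // muln_gt0 expn_gt0; move: N0; clear; lia.
Qed.

Lemma cut_le1 k f : (forall i, i < k -> f i <= 1) -> forall i, cut k f i <= 1.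
Proof. by move=> f1 i; rewrite /cut; case: ifP => // /f1. Qed.

Lemma cut_out k f i : k <= i -> cut k f i = 0.
Proof. by rewrite /cut leqNgt => /negbTE->. Qed.

Lemma fft_nat_norm k (f : nat -> nat) b l p : (forall i, f i <= b) ->
  (`|fft k (fun i => (f i)%:R) l p| <= (2 ^ l * b)%:R)%R.
Proof.
move=> fb; rewrite natrM mulr_natl.
by apply: fft_norm => i; rewrite normr_nat ler_nat.
Qed.

(** The error is 0 for the loaded data, at most 3N after a forward transform, e0 after the products,
    and below N (e0 + 3) after the inverse transform. The counts come out multiplied by N D^3, and
    [e0D] keeps the error below half of that. *)
Lemma stepP t : consts t -> var t 70 = L -> var t 75 = j -> var t 68 = D ->
  (forall b, b < 2 ^ j.+1 -> near (arr t 3) (arr t 4) b (Q%:R * tw b)%R E) ->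
  (forall i, i < L -> arr t 5 i <= 1) -> (forall i, i < 2 * L -> arr t 6 i <= 1) ->
  let t' := sem step_body t in
  [/\ forall p, p < 2 * L ->
        arr t' 5 p = (0 < conv3 (cut L (arr t 5)) (cut (2 * L) (arr t 6)) p),
      var t' 70 = 2 * L & cost step_body t <= 4000 * (L * j.+2)].
Proof.
move=> [c1 c2 c3] e70 e75 e68 tws S1 A1.
have F c s y : y \notin wv c -> var (sem c s) y = var s y by move/(proj1 (agree_sem V Bg c s)).
have G c s k : k \notin wa c -> arr (sem c s) k = arr s k by move/(proj2 (agree_sem V Bg c s)).
have L0 : 0 < L by rewrite expn_gt0.
have NV : 2 * N < V := leq_ltn_trans NB BgV.
have NV1 : N < V by apply: leq_ltn_trans NV; rewrite leq_pmull.
have LN : 2 * L <= N by rewrite leq_mul2r orbT.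
have LV : 2 * L < V := leq_ltn_trans LN NV1.
have KV : j + 2 < V.
  by rewrite addn2; apply: ltn_trans NV1; rewrite NE; apply: ltn_expl.
pose t1 := setv (setv (setv (setv t 71 N) 72 (2 * L)) 32 (2 * L)) 31 K.
pose t2 := sem load t1. pose t3 := setv t2 30 0. pose t4 := sem fwd t3.
pose t5 := setv t4 30 N. pose t6 := sem fwd t5. pose t7 := setv t6 30 0.
pose t8 := sem pointwise t7. pose t9 := sem bwd t8. pose t10 := sem threshold t9.
have s1 : sem (Asn 31 (eadd (Var 75) (Cst 2))) (sem (Asn 32 (Var 72))
   (sem (Asn 72 (emul (Cst 2) (Var 70))) (sem (Asn 71 (emul (Cst 4) (Var 70))) t))) = t1.
  by rewrite /= !updE /= e70 e75 (modn_small NV1) (modn_small LV) (modn_small KV) addn2.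
have N30 s v y : y != 30 -> var (setv s 30 v) y = var s y by rewrite /= /upd => /negPf->.
have F2 y : y \notin wv load -> var t2 y = var t1 y by apply: F.
have F4 y : y \notin wv fwd -> y != 30 -> var t4 y = var t2 y.
  by move=> h1 h2; rewrite /t4 F // N30.
have F6 y : y \notin wv fwd -> y != 30 -> var t6 y = var t4 y.
  by move=> h1 h2; rewrite /t6 F // N30.
have F8 y : y \notin wv pointwise -> y != 30 -> var t8 y = var t6 y.
  by move=> h1 h2; rewrite /t8 F // N30.
have F9 y : y \notin wv bwd -> var t9 y = var t8 y by apply: F.
have F10 y : y \notin wv threshold -> var t10 y = var t9 y by apply: F.
have G2 k : k \notin wa load -> arr t2 k = arr t k by apply: G.
have G4 k : k \notin wa fwd -> arr t4 k = arr t2 k by apply: G.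
have G6 k : k \notin wa fwd -> arr t6 k = arr t4 k by apply: G.
have G8 k : k \notin wa pointwise -> arr t8 k = arr t6 k by apply: G.
have G9 k : k \notin wa bwd -> arr t9 k = arr t8 k by apply: G.
have v4 : var t4 71 = N by rewrite F4 // F2.
have v10 : var t10 72 = 2 * L by rewrite F10 // F9 // F8 // F6 // F4 // F2.
have [sE cE] := @step_ofE V Bg load fwd pointwise bwd threshold t t1 N s1 v4.
rewrite -/t2 -/t3 -/t4 -/t5 -/t6 -/t7 -/t8 -/t9 -/t10 v10 in sE cE.
have a51 : arr t1 5 = arr t 5 by []. have a61 : arr t1 6 = arr t 6 by [].
have [ld1 ld2 ld3 ld4] := loadP NB BgV DV (t := t1) e70 erefl erefl e68 S1 A1.
rewrite -/t2 a51 a61 in ld1 ld2 ld3.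
pose f := cut L (arr t 5). pose g := cut (2 * L) (arr t 6).
have f1 := cut_le1 S1 : forall i, f i <= 1. have g1 := cut_le1 A1 : forall i, g i <= 1.
have fB (u : nat -> nat) : (forall i, u i <= 1) -> forall l p, l <= K ->
    (`|D%:R * fft K (fun i => (u i)%:R) l p| <= (D * N)%N%:R)%R.
  move=> u1 l p le; rewrite normrM normr_nat natrM ler_wpM2l ?ler0n //.
  apply: le_trans (fft_nat_norm K l p u1) _.
  by rewrite ler_nat muln1 NE leq_exp2l.
have errK : err 0 K <= 3 * N.
  by apply: leq_trans (leq_addr 3 _) _; rewrite mulnC NE; apply: err_le.
have KN : 2 ^ K = N by rewrite NE.
have BE1 : (2 * (D * N) + 2 * err 0 K) * E <= Q.
  apply: leq_trans ZE; rewrite leq_mul2r; apply/orP; right; apply: leq_trans Z1.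
  by rewrite leq_add2l leq_mul2l errK orbT.
have BR1 : (2 * (D * N) + 2 * err 0 K) * (Q + E) <= Q * R.
  apply: leq_trans ZQ; rewrite leq_mul2r; apply/orP; right; apply: leq_trans Z1.
  by rewrite leq_add2l leq_mul2l errK orbT.
have tws' t' : arr t' 3 = arr t 3 -> arr t' 4 = arr t 4 -> forall b, b < 2 ^ K.-1 ->
   near (arr t' 3) (arr t' 4) b (Q%:R * tw b)%R E by move=> -> ->; exact: tws.
have nearD (u : nat -> nat) (re im : nat -> nat) off : (forall i, u i <= 1) ->
    (forall p, p < N -> re (off + p) = D * u p /\ im (off + p) = 0) ->
    forall p, p < 2 ^ K -> near re im (off + p) (D%:R * (u p)%:R)%R 0.
  move=> u1 h p; rewrite KN => ltp; have [r1 r2] := h p ltp; exists (D * u p)%N, 0.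
  have DuV : D * u p < V.
    by apply: leq_ltn_trans DV; rewrite -{2}[D]muln1 leq_mul2l u1 orbT.
  split; [by rewrite rep_nat ?r1 | by rewrite r2 /rep mod0z |].
  by rewrite gi_nat natrM subrr normr0.
have off0 : 0 + 2 ^ K <= Bg by rewrite add0n KN; apply: leq_trans NB; rewrite leq_pmull.
have ctx3 : ctx V Q R E K 0 t3.
  split; [by split; rewrite [LHS]F2 | by [] | exact: F2 | by rewrite [LHS]F2 // [LHS]/= hE |].
  by apply: tws'; exact: G2.
have [|n4 o4 cst4] := fwdP Q0 V2 BgV off0 (isT : 0 < K) (fB f f1) BE1 BR1 ctx3.
  apply: (nearD f _ _ 0 f1) => p ltp; split; first exact: ld1.
  by apply: ld3; apply: leq_trans ltp _; rewrite leq_pmull.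
rewrite -/t4 in n4 o4.
have NN : N + N = 2 * N by rewrite mul2n addnn.
have offN : N + 2 ^ K <= Bg by rewrite KN NN.
have ctx5 : ctx V Q R E K N t5.
  split; [by split; rewrite [LHS]F4 // F2 | by [] | by rewrite [LHS]F4 // F2
    | by rewrite [LHS]F4 // F2 // [LHS]/= hE |].
  by apply: tws'; rewrite [LHS]G4 // G2.
have [|n6 o6 cst6] := fwdP Q0 V2 BgV offN (isT : 0 < K) (fB g g1) BE1 BR1 ctx5.
  apply: (nearD g _ _ N g1) => p ltp.
  have out4 : N + p < 0 \/ 0 + 2 ^ K <= N + p by right; rewrite add0n KN leq_addr.
  have [r1 r2] := o4 (N + p) out4; split; first by rewrite [LHS]r1 ld2.
  by rewrite [LHS]r2; apply: ld3; rewrite -NN ltn_add2l.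
rewrite -/t6 in n6 o6.
pose Fh p := (D%:R * fft K (fun i => (f i)%:R) K p)%R.
pose Gh p := (D%:R * fft K (fun i => (g i)%:R) K p)%R.
have eDN : err 0 K <= D * N.
  by apply: leq_trans errK _; rewrite leq_mul2r; apply/orP; right; move: D0; clear; lia.
have [||||||n8 cst8] := @pointwiseP V Bg D L NB BgV DV t7 (err 0 K) (D * N) Fh Gh.
- by rewrite [LHS]F6.
- move=> p ltp; have ltp' : p < 2 ^ K by rewrite KN.
  have [r1 r2] := o6 p (or_introl ltp).
  by have := n4 p ltp'; rewrite add0n; apply: near_eq; rewrite ?[LHS]r1 ?[LHS]r2.
- by move=> p ltp; apply: n6; rewrite KN.
- by move=> p; apply: fB.
- by move=> p; apply: fB.
- exact: eDN.
rewrite -/t8 in n8; set e1 := 7 * _ in n8.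
have e10 : e1 <= e0 by rewrite /e1 /e0 leq_mul2l leq_mul2l errK !orbT.
pose h := conv3 f g.
have cf i : conv f f i <= 2 * L.
  case: (ltnP i (2 * L)) => lt.
    by apply: leq_trans (conv_le i f1 f1) _; rewrite !muln1.
  by rewrite (conv_supp (@cut_out L _) (@cut_out L _)) // addnn -mul2n.
have hN i : h i <= N ^ 2.
  case: (ltnP i N) => lt.
    apply: leq_trans (conv_le i cf g1) _; rewrite muln1 expnS expn1; exact: leq_mul.
  rewrite /h /conv3 (conv_supp (conv_supp (@cut_out L _) (@cut_out L _)) (@cut_out (2 * L) _)) //.
  by apply: leq_trans lt; rewrite /N; clear; lia.
have FG p : (Fh p ^+ 2 * Gh p = D%:R ^+ 3 * fft K (fun i => (h i)%:R) K p)%R.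
  rewrite /Fh /Gh /h (@fft_conv3 K L) ?KN //; last 2 first.
  - exact: cut_out.
  - exact: cut_out.
  by rewrite !exprS expr0; ring.
have hB l p : l <= K ->
    (`|D%:R ^+ 3 * 2%:R ^+ (K - l) * fft K (fun i => (h i)%:R) l p| <= (D ^ 3 * N ^ 3)%:R)%R.
  move=> le; have -> : (D%:R ^+ 3 * 2%:R ^+ (K - l) = (D ^ 3 * 2 ^ (K - l))%N%:R :> algC)%R.
    by rewrite natrM !natrX.
  rewrite normrM normr_nat.
  apply: le_trans (ler_wpM2l (ler0n _ _) (fft_nat_norm K l p hN)) _.
  rewrite -natrM ler_nat -mulnA leq_mul2l; apply/orP; right.
  by rewrite mulnA -expnD subnK // KN -expnS.
have errE : err e1 K + 3 <= N * (e0 + 3).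
  by apply: leq_trans (err_le e1 K) _; rewrite KN leq_mul2l leq_add2r e10 orbT.
have errE' : 2 * err e1 K <= 2 * (N * (e0 + 3)).
  by rewrite leq_mul2l /=; apply: leq_trans errE; apply: leq_addr.
have BE2 : (2 * (D ^ 3 * N ^ 3) + 2 * err e1 K) * E <= Q.
  apply: leq_trans ZE; rewrite leq_mul2r; apply/orP; right; apply: leq_trans Z2.
  by rewrite leq_add2l.
have BR2 : (2 * (D ^ 3 * N ^ 3) + 2 * err e1 K) * (Q + E) <= Q * R.
  apply: leq_trans ZQ; rewrite leq_mul2r; apply/orP; right; apply: leq_trans Z2.
  by rewrite leq_add2l.
have ctx8 : ctx V Q R E K 0 t8.
  split.
  - by split; rewrite F8 // F6 // F4 // F2.
  - by rewrite /t8 F.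
  - by rewrite F8 // F6 // F4 // F2.
  - by rewrite F8 // F6 // F4 // F2 // [LHS]/= hE.
  by apply: tws'; rewrite G8 // G6 // G4 // G2.
have [|n9 _ cst9] := bwdP Q0 V2 BgV off0 (isT : 0 < K) hB BE2 BR2 ctx8.
  by move=> p ltp; rewrite -FG add0n; apply: n8; move: ltp; rewrite KN.
rewrite -/t9 in n9.
have [|||||||thr cst10] := @thresholdP V Bg D L NB BgV DV t9 h (err e1 K) (N ^ 2).
- by rewrite F9 // F8 // F6 // F4 // F2.
- by rewrite F9 // F8 // F6 // F4 // F2.
- by rewrite F9 // F8 // F6 // F4 // F2.
- move=> p ltp; have := n9 p; rewrite KN add0n => /(_ ltp).
  by have -> : (D%:R ^+ 3 * 2%:R ^+ K = (N * D ^ 3)%N%:R :> algC)%R by rewrite -KN natrM !natrX mulrC.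
- exact: hN.
- apply: leq_trans (_ : 2 * (N * (e0 + 3)) <= _).
    by rewrite ltn_mul2l /=; apply: leq_trans errE; rewrite -addn1 leq_add2l.
  by rewrite mulnCA leq_mul2l e0D orbT.
- apply: leq_ltn_trans ZV; apply: leq_trans (_ : N * D ^ 3 * (N ^ 2 + N ^ 2) <= _).
    by rewrite leq_mul2l leq_add2l; apply/orP; right; rewrite expnS expn1; apply: leq_trans (_ : 2 * 1 <= _) => //; apply: leq_mul; apply: leq_trans N0.
  have -> : N * D ^ 3 * (N ^ 2 + N ^ 2) = 2 * (D ^ 3 * N ^ 3).
    by rewrite addnn -mul2n [N ^ 3]expnS; ring.
  by rewrite /Z; generalize (D ^ 3 * N ^ 3); clear; lia.
rewrite -/t10 in thr cst10; move=> t'.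
have tE : t' = setv t10 70 (2 * L) := sE.
rewrite tE cE; split; [exact: thr | exact: updE | ].
move: cst4 cst6 cst8 cst9 cst10 ld4; rewrite -hE.
generalize (cost load t1) (cost fwd t3) (cost fwd t5) (cost pointwise t7) (cost bwd t8)
  (cost threshold t9) => k1 k2 k3 k4 k5 k6.
have : K <= L * K by rewrite leq_pmull.
have : L * 2 <= L * K by rewrite leq_mul2l orbT.
have -> : K * (2 * L * 205 + 20) = 410 * (L * K) + 20 * K by clear; ring.
rewrite -/K /N; move: L0; generalize K L (L * K); clear; lia.
Qed.
End Machine.

(* A representation of t adds up its parts one at a time: y is the last partial
   sum below L. *)
Lemma feasible_split n a L t : instance n a -> 0 < L -> feasible n a t -> L <= t ->
  exists i y z, [/\ i <= n, y < L <= y + a i, feasible n a y, feasible n a z & t = y + a i + z].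
Proof.
move=> inst L0; have [t'] := ubnP t; elim: t' t => // t' IH t lt ft Lt.
have [i [u [le fu tE]]] := feasible_pos (leq_trans L0 Lt) ft.
have [uL|Lu] := ltnP u L.
  by exists i, u, 0; split=> //; [rewrite uL addnC -tE | exact: feasible0 | rewrite addn0 addnC].
have ai : 0 < a i by apply: leq_trans (inst_ge inst le).
have ut : u < t' by move: lt ai; rewrite tE; clear; lia.
have [k [y [z [lek yL fy fz uE]]]] := IH u ut fu Lu.
exists k, y, (z + a i); split=> //; first by apply: feasibleD fz (feasible_gen _ le).
by rewrite tE uE addnC addnA.
Qed.

(** For p in [L, 2L) the remainder z of [feasible_split] is below L because y + a_i >= L. A feasible
    p below L is written p + 0 + 0. *)
Lemma feasible_conv3 n a L (s A : nat -> nat) : instance n a -> 0 < L ->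
  (forall i, i < L -> (0 < s i) <-> feasible n a i) ->
  (forall i, i < 2 * L -> (0 < A i) <-> (i = 0 \/ exists2 k, k <= n & i = a k)) ->
  forall p, p < 2 * L -> (0 < conv3 (cut L s) (cut (2 * L) A) p) <-> feasible n a p.
Proof.
move=> inst L0 sP AP p ltp.
have cutP k f i : (0 < cut k f i) = (i < k) && (0 < f i) by rewrite /cut; case: ifP.
split=> [/conv_gt0[u [w [/conv_gt0[y [z [hy hz ->]]] hw ->]]]|fp].
  move: hy hz hw; rewrite !cutP => /andP[ly /(sP _ ly) fy] /andP[lz /(sP _ lz) fz] /andP[lw].
  move=> /(AP _ lw)[->|[k le ->]]; first by rewrite addn0; apply: feasibleD.
  by apply: feasibleD (feasible_gen _ le); apply: feasibleD.
have s0 : 0 < cut L s 0 by rewrite cutP L0 /=; apply/(sP _ L0); apply: feasible0.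
have [lt|le] := ltnP p L.
  apply/conv_gt0; exists p, 0; split; rewrite ?addn0 //.
    by apply/conv_gt0; exists p, 0; split; rewrite ?addn0 // cutP lt; apply/sP.
  have L2 : 0 < 2 * L by rewrite muln_gt0.
  by rewrite cutP L2; apply/(AP _ L2); left.
have [i [y [z [lei /andP[yL Ly] fy fz pE]]]] := feasible_split inst L0 fp le.
have zL : z < L by move: ltp Ly; rewrite pE; clear; lia.
have aL : a i < 2 * L by move: ltp; rewrite pE; clear; lia.
apply/conv_gt0; exists (y + z), (a i); split; last by rewrite pE addnAC.
  by apply/conv_gt0; exists y, z; split; rewrite // cutP ?yL ?zL; apply/sP.
by rewrite cutP aL; apply/(AP _ aL); right; exists i.
Qed.

Section Doubling.
Variables (V Bg Q R E D J n : nat) (a : nat -> nat).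
Local Notation sem := (sem V Bg).
Local Notation cost := (cost V Bg).
(** The last doubling starts from 2^(J-1) and has the longest transform, 4 * 2^(J-1) = 2 * 2^J; one
    choice of D, Q, R for it serves all doublings. *)
Let Z := 4 * (D ^ 3 * (2 * 2 ^ J) ^ 3).
Hypotheses (inst : instance n a) (Q0 : 0 < Q) (V2 : 2 * (Q * R) < V) (BgV : Bg < V)
  (NB : 4 * 2 ^ J <= Bg) (DN : 50 * (2 * 2 ^ J) ^ 3 <= D) (EQ : E <= Q) (ZE : Z * E <= Q)
  (ZR : 2 * Z <= R).

(** The lengths form a geometric progression, so all doublings together cost no more than the last
    one up to a constant. *)
Lemma doublingP t : consts Q R t -> var t 70 = 1 -> var t 5 = J -> var t 68 = D ->
  (forall b, b < 2 ^ J -> near V (arr t 3) (arr t 4) b (Q%:R * tw b)%R E) ->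
  arr t 5 0 = 1 -> (forall i, arr t 6 i <= 1) ->
  (forall i, (0 < arr t 6 i) <-> (i = 0 \/ exists2 k, k <= n & i = a k)) ->
  let t' := sem (For 75 (Var 5) step_body) t in
  (forall p, p < 2 ^ J -> (0 < arr t' 5 p) <-> feasible n a p) /\
  cost (For 75 (Var 5) step_body) t <= 10 + 4005 * (2 ^ J * J.+1).
Proof.
move=> [c1 c2 c3] e70 e5 e68 tws S1 A1 AP.
have [|| j t1 ltj [f70 f5 fS] [fv fa]|] := @for_rule_sum V Bg 75 (Var 5) step_body t J
  (fun j t1 => [/\ var t1 70 = 2 ^ j, forall p, p < 2 ^ j -> arr t1 5 p <= 1
     & forall p, p < 2 ^ j -> (0 < arr t1 5 p) <-> feasible n a p])
  (fun j => 4000 * (2 ^ j * j.+2)).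
- exact: e5.
- split=> //; first by case=> // _; rewrite S1.
  by case=> // _; rewrite S1; split=> // _; apply: feasible0.
- set L := 2 ^ j in f70 f5 fS *.
  have LJ : 2 * L <= 2 ^ J by rewrite /L -expnS leq_exp2l.
  have e4 : 4 * L = 2 * (2 * L) by rewrite mulnA.
  have NJ : 4 * L <= 2 * 2 ^ J by rewrite e4 leq_mul2l.
  have N3 : (4 * L) ^ 3 <= (2 * 2 ^ J) ^ 3 by rewrite leq_exp2r.
  have ZJ : 4 * (D ^ 3 * (4 * L) ^ 3) <= Z by rewrite /Z !leq_mul2l N3 !orbT.
  have h1 : 2 * (4 * L) <= Bg.
    by apply: leq_trans NB; rewrite e4 mulnA leq_mul2l.
  have h2 : 50 * (4 * L) ^ 3 <= D by apply: leq_trans DN; rewrite leq_mul2l N3 orbT.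
  have h3 : 4 * (D ^ 3 * (4 * L) ^ 3) * E <= Q by apply: leq_trans ZE; rewrite leq_mul2r ZJ orbT.
  have h4 : 2 * (4 * (D ^ 3 * (4 * L) ^ 3)) <= R by apply: leq_trans ZR; rewrite leq_mul2l ZJ.
  set t2 := setv t1 75 j.
  have g y : y != 75 -> var t2 y = var t1 y by rewrite /= /upd => /negPf->.
  have a3 : arr t2 3 = arr t 3 by exact: fa.
  have a4 : arr t2 4 = arr t 4 by exact: fa.
  have a6 : arr t2 6 = arr t 6 by exact: fa.
  have a5 : arr t2 5 = arr t1 5 by [].
  have [||||||| r1 r2 r3] := @stepP V Bg Q R E D j Q0 V2 BgV h1 h2 EQ h3 h4 t2.
  + by split; rewrite g // fv.
  + by rewrite g.
  + exact: updE.
  + by rewrite g // fv.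
  + move=> b ltb; rewrite a3 a4; apply: tws; apply: leq_trans ltb _.
    by rewrite leq_exp2l.
  + by rewrite a5.
  + by move=> i _; rewrite a6.
  rewrite a5 a6 in r1; split; last exact: r3.
  have L0 : 0 < L by rewrite expn_gt0.
  have cv := @feasible_conv3 n a L (arr t1 5) (arr t 6) inst L0 fS (fun i _ => AP i).
  rewrite expnS -/L; split; first exact: r2.
    by move=> p ltp; rewrite r1 //; case: (0 < _).
  by move=> p ltp; rewrite r1 // lt0b; apply: cv.
move=> [_ _ h] cst t0; split; first exact: h.
apply: leq_trans cst _; rewrite [ecost _]/=.
have : \sum_(j < J) (4000 * (2 ^ j * j.+2) + 5) <= 4005 * (2 ^ J * J.+1).
  clear.
  elim: J => [|k IH]; first by rewrite big_ord0.
  rewrite big_ord_recr /=; apply: leq_trans (leq_add IH (leqnn _)) _.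
  rewrite !expnS; have : 0 < 2 ^ k by rewrite expn_gt0.
  have -> : 2 * 2 ^ k * k.+2 = 2 ^ k * k.+1 + 2 ^ k * k.+2 + 2 ^ k.
    by rewrite !mulnS; clear; lia.
  have : 2 ^ k <= 2 ^ k * k.+2 by rewrite leq_pmulr.
  by generalize (2 ^ k) (2 ^ k * k.+2) (2 ^ k * k.+1); clear; lia.
by generalize (\sum_(j < J) (4000 * (2 ^ j * j.+2) + 5)) (2 ^ J * J.+1); clear; lia.
Qed.
End Doubling.

(** * Generator indicator and extraction of the targets *)

Definition fill_body := Sto 6 (Get 0 (eadd (Var 76) (Cst 1))) (Cst 1).
(** Positions are visited downwards, so the least feasible member of each residue class is written
    last. *)
Definition scan_body := Seq (Asn 77 (Bin OSub (Bin OSub (Var 4) (Var 76)) (Cst 1)))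
  (Ite (Cst 0) (Get 5 (Var 77)) (Sto 7 (Bin OMod (Var 77) (Var 2)) (Var 77)) Skip).
Definition fill := For 76 (eadd (Var 0) (Cst 1)) fill_body.
Definition scan := For 76 (Var 4) scan_body.

Section Machine.
Variables (V Bg n : nat) (a : nat -> nat).
Local Notation sem := (sem V Bg).
Local Notation cost := (cost V Bg).
Hypotheses (inst : instance n a) (BgV : Bg < V) (mB : (a n).+2 <= Bg).

Lemma fillP t : var t 0 = n -> (forall i, i <= n -> arr t 0 i.+1 = a i) ->
  arr t 6 0 = 1 -> (forall i, 0 < i -> arr t 6 i = 0) ->
  let t' := sem fill t in
  [/\ forall i, arr t' 6 i <= 1,
      forall i, (0 < arr t' 6 i) <-> (i = 0 \/ exists2 k, k <= n & i = a k)
    & cost fill t <= 20 + n.+1 * 30].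
Proof.
move=> e0 e1 A0 A1.
have nm : n < a n := inst_ge inst (leqnn n).
have n1V : n.+1 < V by move: nm mB BgV; clear; lia.
have [|| i t1 lti [h1 h2] [fv fa]|] := @for_rule V Bg 76 (eadd (Var 0) (Cst 1)) fill_body t n.+1
  (fun j t1 => (forall i, arr t1 6 i <= 1) /\
     forall i, (0 < arr t1 6 i) <-> (i = 0 \/ exists2 k, k < j & i = a k)) 25.
- by rewrite /= e0 addn1 modn_small.
- split=> [[|i]|[|i]]; rewrite ?A0 ?A1 //; first by split=> // _; left.
  by split=> // -[//|[k //]].
- split; last by apply: leq_trans (flat_costP _ _ _ _) _.
  have a1 : arr t1 0 = arr t 0 by apply: fa.
  have i1 : i.+1 < Bg by move: lti nm mB; clear; lia.
  have aB : a i < Bg by apply: leq_ltn_trans (inst_le inst _) _ => //; apply: ltn_trans mB.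
  have iV : (i + 1) %% V %% Bg = i.+1.
    by rewrite addn1 (modn_small (ltn_trans i1 BgV)) modn_small.
  rewrite /= !updE /= iV a1 e1 // (modn_small aB); split=> p; rewrite updE; case: eqP => [E|ne] //.
    by rewrite E; split=> // _; right; exists i.
  have [q1 q2] := h2 p; split=> [/q1[|[k lek]]|[p0|[k]]].
  - by left.
  - by right; exists k => //; apply: ltnW.
  - by apply: q2; left.
  by rewrite ltnS leq_eqVlt => /orP[/eqP->//|ltk pE]; apply: q2; right; exists k.
by move=> [h1 h2] cst; split=> //; apply: leq_trans cst _; rewrite /= leq_add // leq_mul2l orbT.
Qed.

Lemma scanP t B : var t 4 = B -> var t 2 = a 0 -> B <= Bg ->
  (forall p, p < B -> (0 < arr t 5 p) <-> feasible n a p) ->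
  let t' := sem scan t in
  (forall u, u < B -> feasible n a u ->
     let v := arr t' 7 (u %% a 0) in [/\ v <= u, feasible n a v & v = u %[mod a 0]]) /\
  cost scan t <= 10 + B * 60.
Proof.
move=> e4 e2 BB S.
have a0 : 0 < a 0 by have [] := inst.
have [|| i t1 lti h [fv fa]|] := @for_rule V Bg 76 (Var 4) scan_body t B
  (fun j t1 => forall u, B - j <= u < B -> feasible n a u ->
     let v := arr t1 7 (u %% a 0) in [/\ v <= u, feasible n a v & v = u %[mod a 0]]) 50.
- exact: e4.
- by move=> u /andP[]; rewrite subn0 leqNgt => /negbTE->.
- split; last by apply: leq_trans (flat_costP _ _ _ _) _.
  have f4 : var t1 4 = B by rewrite fv.
  have f2 : var t1 2 = a 0 by rewrite fv.
  have f5 : arr t1 5 = arr t 5 by apply: fa.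
  set w := B - i - 1.
  have wB : w < B by rewrite /w; move: lti; clear; lia.
  have wBg : w < Bg := leq_trans wB BB.
  rewrite /= !updE /= f4 -/w f5 f2 (maxn_idPr a0) (modn_small wBg).
  have rB : w %% a 0 < Bg by apply: leq_ltn_trans (leq_mod _ _) wBg.
  rewrite (modn_small rB) => u /andP[lo hi] fu.
  case: ifP => pw.
    have fw : feasible n a w by apply/(S w wB).
    rewrite /= updE; case: eqP => [e|ne].
      by split; [rewrite /w; move: lo; clear; lia | | rewrite e].
    apply: h => //; rewrite hi andbT.
    have : u <> w by move=> E; rewrite E in ne.
    by rewrite /w; move: lo; clear; lia.
  apply: h => //; rewrite hi andbT.
  have : u <> w by move=> E; move: fu; rewrite E => /(S w wB); rewrite pw.
  by rewrite /w; move: lo; clear; lia.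
move=> h cst; split; last by apply: leq_trans cst _; rewrite /= leq_add // leq_mul2l orbT.
by move=> u ltu fu v; apply: (h u) fu; rewrite subnn ltu.
Qed.

Lemma least_targets D : let B := (2 * a n) %/ n.+1 * a n + a 0 in
  (forall u, u < B -> feasible n a u ->
     let v := D (u %% a 0) in [/\ v <= u, feasible n a v & v = u %[mod a 0]]) ->
  forall i, i < a 0 -> is_target n a i (D i).
Proof.
move=> B h i lti; have a0 : 0 < a 0 by have [] := inst.
(* u is the member of the class of i in [X, X + a_0), where X (a_0 - 1) stands for -X modulo a_0. *)
set X := _ * a n in B h; pose u := X + (i + X * (a 0).-1) %% a 0.
have uB : u < B by rewrite /B ltn_add2l ltn_pmod.
have ui : u %% a 0 = i.
  rewrite /u modnDmr addnCA -mulnS prednK // -modnDmr modnMl addn0.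
  exact: modn_small.
have fu : feasible n a u by apply: large_feasible => //; apply: leq_addr.
have := h u uB fu; cbv zeta; rewrite ui => -[vu fv vE].
split=> // [|t tE ft]; first by rewrite vE modn_small.
have [lt|le] := ltnP t B; last by apply: leq_trans vu _; apply: leq_trans (ltnW uB) le.
by have := h t lt ft; cbv zeta; rewrite tE modn_small // => -[].
Qed.
End Machine.

(** * The whole algorithm and its running time *)

Definition bound_expr :=
  eadd (emul (Bin ODiv (emul (Cst 2) (Var 1)) (eadd (Var 0) (Cst 1))) (Var 1)) (Var 2).
(** Number of bisection rounds: m + 2 <= 2^(l + 2) for l the upper logarithm of m, so 76 (l + 2)
    bits hold Q = (m + 2)^76, and 2 more cover the interval [0, 2Q]. *)
Definition nb_expr := eadd (emul (Cst 76) (eadd (Var 3) (Cst 2))) (Cst 2).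
Definition fft_of cl ct cf cd cs := seqs
  [:: Asn 67 nb_expr; Asn 4 bound_expr; Asn 60 (Var 4); cl; Asn 5 (Var 61); ct;
      Sto 6 (Cst 0) (Cst 1); cf; Sto 5 (Cst 0) (Cst 1); Asn 70 (Cst 1); cd; cs].
Definition fft_alg := fft_of clog tw_code fill (For 75 (Var 5) step_body) scan.

Lemma fft_ofE V Bg cl ct cf cd cs t nb B :
  eval V Bg nb_expr t = nb -> eval V Bg bound_expr (setv t 67 nb) = B ->
  let t1 := setv (setv (setv t 67 nb) 4 B) 60 B in
  let t2 := sem V Bg cl t1 in let t3 := setv t2 5 (var t2 61) in
  let t4 := sem V Bg ct t3 in let t5 := seta t4 6 0 1 in
  let t6 := sem V Bg cf t5 in let t7 := setv (seta t6 5 0 1) 70 1 in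
  let t8 := sem V Bg cd t7 in
  sem V Bg (fft_of cl ct cf cd cs) t = sem V Bg cs t8 /\
  cost V Bg (fft_of cl ct cf cd cs) t = 50 + (cost V Bg cl t1 + (cost V Bg ct t3 +
    (cost V Bg cf t5 + (cost V Bg cd t7 + cost V Bg cs t8)))).
Proof.
move=> nE BE t1 t2 t3 t4 t5 t6 t7 t8.
have s1 : sem V Bg (Asn 67 nb_expr) t = setv t 67 nb by rewrite [LHS]/= -nE.
have s2 : sem V Bg (Asn 4 bound_expr) (setv t 67 nb) = setv (setv t 67 nb) 4 B.
  by rewrite [LHS]/= -BE.
have s3 s : var s 4 = B -> sem V Bg (Asn 60 (Var 4)) s = setv s 60 B by move=> /= ->.
have s4 : sem V Bg (Asn 5 (Var 61)) t2 = t3 by [].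
have s5 s k : sem V Bg (Sto k (Cst 0) (Cst 1)) s = seta s k 0 1 by rewrite /= mod0n.
have s7 : sem V Bg (Asn 70 (Cst 1)) (seta t6 5 0 1) = t7 by [].
rewrite /fft_of /seqs !sem_seq !cost_seq s1 s2 (s3 (setv (setv t 67 nb) 4 B)) // -/t1 -/t2.
rewrite s4 -/t4 !s5 -/t5 -/t6 s7 -/t8; split=> //; rewrite !cost_asn.
generalize (cost V Bg cl t1) (cost V Bg ct t3) (cost V Bg cf t5) (cost V Bg cd t7)
  (cost V Bg cs t8); clear; move=> *; rewrite /=; lia.
Qed.

(** * Choice of the parameters *)

Section Params.
Variables (n : nat) (a : nat -> nat).
Hypothesis inst : instance n a.
Let m := a n.
Let M := m.+2.
Let B := (2 * m) %/ n.+1 * m + a 0.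
Let J := up_log 2 B.

Let nm : n < m. Proof. rewrite /m; exact: (inst_ge inst (leqnn n)). Qed.
Let a0m : a 0 <= m. Proof. rewrite /m; exact: (inst_le inst). Qed.
Let a00 : 0 < a 0. Proof. by have [] := inst. Qed.

Lemma bound_ge : m < B.
Proof.
have d0 : 0 < (2 * m) %/ n.+1 by rewrite divn_gt0 //; move: nm; clear; lia.
by rewrite /B -addn1 leq_add // leq_pmull.
Qed.

Lemma bound_le : 4 * B <= M ^ 4.
Proof.
have h : B <= 2 * m * m + m by rewrite leq_add // leq_mul2r leq_div orbT.
apply: leq_trans (_ : 4 * (2 * m * m + m) <= _); first by rewrite leq_mul2l.
by rewrite /M !expnS expn0; clear; nia.
Qed.

Lemma bound_exp : B <= 2 ^ J < 2 * B.
Proof.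
have B2 : 1 < B by apply: leq_trans bound_ge; move: nm; clear; lia.
have /andP[lo hi] := up_log_bounds (ltnSn 1) B2.
rewrite /J hi; case: (up_log 2 B) lo hi => [|k]; first by rewrite expn0 => _; move: B2; clear; lia.
by rewrite expnS ltn_mul2l /=.
Qed.

Lemma M3 : 3 <= M. Proof. by rewrite /M; move: nm; clear; lia. Qed.
Lemma powM i j : i <= j -> M ^ i <= M ^ j.
Proof. by move=> le; rewrite leq_pexp2l. Qed.
Lemma constM c k : c <= 3 ^ k -> c <= M ^ k.
Proof. by case: k => [|k] le; [exact: le | apply: leq_trans le _; rewrite leq_exp2r // M3]. Qed.

Let N := 2 * 2 ^ J.
Let N4 : N <= M ^ 4.
Proof.
have /andP[_ h] := bound_exp; apply: leq_trans bound_le.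
have -> : 4 * B = 2 * (2 * B) by rewrite mulnA.
by rewrite leq_mul2l ltnW.
Qed.
Let N3 : N ^ 3 <= M ^ 12. Proof. by rewrite (expnM M 4 3) leq_exp2r. Qed.
(* D scales the table entries so that rounding errors stay below half a unit, and the
   powers of M leave room for the constants since 3 <= M. *)
Let D := M ^ 16.
Let Z := 4 * (D ^ 3 * N ^ 3).
(** The exponent exceeds 62 + 13, from [params_Z] and [params_E]. R has to exceed 2Z and 4Q, and V =
    M^160 leaves room for 2 Q R <= M^157. *)
Let Q := M ^ 76.
Let R := M ^ 80.
Let E := 12 * 8 ^ J.

Lemma params_N : 4 * 2 ^ J <= M ^ 6.
Proof.
have -> : 4 * 2 ^ J = 2 * N by rewrite /N mulnA.
by rewrite (expnD M 2 4) leq_mul // constM.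
Qed.
Lemma params_D : 50 * N ^ 3 <= D.
Proof. by rewrite /D (expnD M 4 12) leq_mul // constM. Qed.
Lemma params_Z : Z <= M ^ 62.
Proof.
rewrite /Z (expnD M 2 60); apply: leq_mul; first exact: constM.
by rewrite (expnD M 48 12) leq_mul // -expnM.
Qed.
(** 8^J is the cube of 2^J, hence polynomial in m: losing a factor 8 at each of J square roots is
    affordable. *)
Lemma params_E : E <= M ^ 13.
Proof.
apply: leq_trans (_ : 2 * N ^ 3 <= _).
  rewrite /E; have -> : 8 ^ J = (2 ^ J) ^ 3 by rewrite -expnM mulnC expnM.
  by rewrite /N expnMn mulnA leq_mul2r orbT.
by rewrite (expnD M 1 12) leq_mul // constM.
Qed.
Lemma params_ZE : Z * E <= Q.
Proof.
apply: leq_trans (leq_mul params_Z params_E) _.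
by rewrite -expnD powM.
Qed.
Lemma params_EQ : E <= Q.
Proof. by apply: leq_trans params_E _; apply: powM. Qed.
Lemma params_ZR : 2 * Z <= R.
Proof.
apply: leq_trans (leq_mul (constM (isT : 2 <= 3 ^ 1)) params_Z) _.
by rewrite -expnD powM.
Qed.
Lemma params_V : 2 * (Q * R) < M ^ 160.
Proof.
rewrite /Q /R -expnD; apply: leq_ltn_trans (_ : M ^ 157 < _).
  by rewrite (expnD M 1 156) leq_mul // constM.
by rewrite ltn_exp2l.
Qed.
Lemma params_QR : 4 * Q <= R.
Proof. by rewrite /Q /R (expnD M 4 76) leq_mul // constM. Qed.
Lemma params_Q : 97 <= Q.
Proof. by apply: leq_trans (_ : M ^ 5 <= _); [apply: constM | apply: powM]. Qed.
Lemma params_nb : 2 * Q < 2 ^ (76 * (up_log 2 m + 2) + 2).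
Proof.
have Ml : M <= 2 ^ (up_log 2 m + 2).
  have : m <= 2 ^ up_log 2 m by apply: up_logP.
  have : 0 < 2 ^ up_log 2 m by rewrite expn_gt0.
  by rewrite /M expnD; generalize (2 ^ up_log 2 m); clear; lia.
have h : M ^ 76 <= (2 ^ (up_log 2 m + 2)) ^ 76 by rewrite leq_exp2r.
rewrite -expnM mulnC in h.
rewrite expnD /Q; have : 0 < M ^ 76 by rewrite expn_gt0.
by move: h; generalize (M ^ 76) (2 ^ (76 * (up_log 2 m + 2))); clear; lia.
Qed.
End Params.

Section Algorithm.
Variables (V Bg Q R D n : nat) (a : nat -> nat).
Local Notation sem := (sem V Bg).
Local Notation cost := (cost V Bg).
Local Notation m := (a n).
Let B := (2 * m) %/ n.+1 * m + a 0.
Let J := up_log 2 B.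
Let N := 2 * 2 ^ J.
Let E := 12 * 8 ^ J.
Let Z := 4 * (D ^ 3 * N ^ 3).
Let nb := 76 * (up_log 2 m + 2) + 2.
Hypotheses (inst : instance n a) (Q97 : 97 <= Q) (V2 : 2 * (Q * R) < V) (BgV : Bg < V)
  (mB : m.+2 <= Bg) (NB : 4 * 2 ^ J <= Bg) (DN : 50 * N ^ 3 <= D) (EQ : E <= Q) (ZE : Z * E <= Q)
  (ZR : 2 * Z <= R) (QR : 4 * Q <= R) (nbQ : 2 * Q < 2 ^ nb) (mV : 2 * m * m < V)
  (nbV : nb < V).

Lemma fft_algP t : consts Q R t -> var t 0 = n -> var t 1 = m -> var t 2 = a 0 ->
  var t 3 = up_log 2 m -> var t 68 = D -> (forall i, i <= n -> arr t 0 i.+1 = a i) ->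
  (forall i, arr t 6 i = 0) ->
  let t' := sem fft_alg t in
  (forall i, i < a 0 -> is_target n a i (arr t' 7 i)) /\
  cost fft_alg t <= 4500 * (5 * (2 ^ J * J.+1)).
Proof.
move=> [c1 c2 c3] e0 e1 e2 e3 e68 A0 A6.
have F c s y : y \notin wv c -> var (sem c s) y = var s y by move/(proj1 (agree_sem V Bg c s)).
have G c s k : k \notin wa c -> arr (sem c s) k = arr s k by move/(proj2 (agree_sem V Bg c s)).
have nm : n < m := inst_ge inst (leqnn n).
have a0m : a 0 <= m by apply: inst_le.
have Bm : m < B := bound_ge inst.
have /andP[BP PB] : B <= 2 ^ J < 2 * B := bound_exp inst.
have P4 : 2 ^ J <= 4 * 2 ^ J by rewrite leq_pmull.
have BB : B <= Bg := leq_trans BP (leq_trans P4 NB).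
have BV2 : 2 * B < V.
  apply: leq_ltn_trans BgV; apply: leq_trans NB.
  by apply: leq_mul.
have BV : B < V := leq_ltn_trans BB BgV.
have Q0 : 0 < Q := leq_trans (isT : 0 < 97) Q97.
have lm : up_log 2 m <= m by apply: up_log_min => //; apply: ltnW; apply: ltn_expl.
have nbE : eval V Bg nb_expr t = nb.
  have l2 : up_log 2 m + 2 < V.
    by apply: leq_ltn_trans nbV; rewrite /nb; generalize (up_log 2 m); clear; lia.
  have l3 : 76 * (up_log 2 m + 2) < V by apply: leq_ltn_trans nbV; apply: leq_addr.
  by rewrite /= e3 (modn_small l2) (modn_small l3) modn_small.
have BE : eval V Bg bound_expr (setv t 67 nb) = B.
  rewrite /= /upd /= e0 e1 e2.
  have l1 : 2 * m < V by apply: leq_ltn_trans mV; rewrite leq_pmulr // (leq_ltn_trans _ nm).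
  have l2 : n + 1 < V by apply: leq_ltn_trans BV; rewrite addn1; apply: leq_trans nm (ltnW Bm).
  have l3 : (2 * m) %/ n.+1 * m < V by apply: leq_ltn_trans BV; apply: leq_addr.
  rewrite (modn_small l1) (modn_small l2) (maxn_idPr _) ?addn1 //.
  by rewrite (modn_small l3) modn_small.
pose t1 := setv (setv (setv t 67 nb) 4 B) 60 B. pose t2 := sem clog t1.
pose t3 := setv t2 5 (var t2 61). pose t4 := sem tw_code t3. pose t5 := seta t4 6 0 1.
pose t6 := sem fill t5. pose t7 := setv (seta t6 5 0 1) 70 1.
pose t8 := sem (For 75 (Var 5) step_body) t7.
have [sE cE] := @fft_ofE V Bg clog tw_code fill (For 75 (Var 5) step_body) scan t nb B nbE BE.
rewrite -/t1 -/t2 -/t3 -/t4 -/t5 -/t6 -/t7 -/t8 in sE cE.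
have g1 y : y != 60 -> y != 4 -> y != 67 -> var t1 y = var t y.
  by rewrite /= /upd => /negPf-> /negPf-> /negPf->.
have [l61 cst1] : var t2 61 = J /\ cost clog t1 <= 30 * B.+1 by apply: (@clogP V Bg t1); exact: BV2.
have g3 y : y != 5 -> y \notin wv clog -> var t3 y = var t1 y.
  by move=> h1 h2; rewrite -(F clog t1 y h2) /= /upd (negPf h1).
have t35 : var t3 5 = J by rewrite -l61; exact: updE.
have ct3 : consts Q R t3 by split; rewrite g3 // g1.
have t367 : var t3 67 = nb by rewrite g3.
have JQ : 12 * 8 ^ J <= Q := EQ.
have JB : 2 ^ J <= Bg := leq_trans P4 NB.
have [tws cst3] := twP Q97 V2 BgV QR nbQ JB JQ ct3 t35 t367.
rewrite -/t4 in tws.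
have g4 y : y \notin wv tw_code -> var t4 y = var t3 y by apply: F.
have a3 k : k \notin wa tw_code -> arr t4 k = arr t k by move=> h; rewrite [LHS](G tw_code t3 k h); exact: (G clog t1 k isT).
have [|||| A61 A6P cst5] := @fillP V Bg n a inst BgV mB t5.
- by rewrite [LHS]g4 // g3 // g1.
- by move=> i le; rewrite [arr t5 0]a3 // A0.
- by rewrite /= /upd.
- by case=> // i _; rewrite [LHS]/= /upd /= a3.
rewrite -/t6 in A61 A6P.
have g6 y : y \notin wv fill -> var t6 y = var t4 y by move=> h; rewrite [LHS]F.
have a6 k : k \notin wa fill -> arr t6 k = arr t5 k by apply: G.
have g7 y : y != 70 -> var t7 y = var t6 y by rewrite /= /upd => /negPf->.
have [|||||||| S8 cst7] := @doublingP V Bg Q R E D J n a inst Q0 V2 BgV NB DN EQ ZE ZR t7.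
- by split; rewrite g7 // g6 // g4 // g3 // g1.
- exact: updE.
- by rewrite g7 // g6 // g4.
- by rewrite g7 // g6 // g4 // g3 // g1.
- have -> : arr t7 3 = arr t4 3 by rewrite [LHS]a6.
  by have -> : arr t7 4 = arr t4 4 by rewrite [LHS]a6.
- by [].
- exact: A61.
- exact: A6P.
rewrite -/t8 in S8.
have w8 y : y \notin wv (For 75 (Var 5) step_body) -> var t8 y = var t7 y by apply: F.
have [|||| S9 cst8] := @scanP V Bg n a inst t8 B.
- by rewrite w8 // g7 // g6 // g4 // g3.
- by rewrite w8 // g7 // g6 // g4 // g3 // g1.
- exact: BB.
- by move=> p ltp; apply: S8; apply: leq_trans ltp BP.
move=> t'; have -> : t' = sem scan t8 := sE.
split; first exact: least_targets inst _ S9.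
rewrite [cost fft_alg t]cE.
move: cst1 cst3 cst5 cst7 cst8.
generalize (cost clog t1) (cost tw_code t3) (cost fill t5)
   (cost (For 75 (Var 5) step_body) t7) (cost scan t8) => k1 k2 k3 k4 k5.
(* The J square roots take about J nb steps in total; a crude linear bound on nb puts this below a
   multiple of 2^J J. *)
have nbP : nb <= 76 * 2 ^ J + 154.
  by rewrite /nb; move: lm Bm BP; generalize (up_log 2 m) (2 ^ J); clear; lia.
have P0 : 0 < 2 ^ J by rewrite expn_gt0.
move: nbP P0 nm Bm BP; generalize nb n m B J (2 ^ J); clear.
move=> b n' m' B' j P hb P0 nm mB BP h1 h2 h3 h4 h5.
have hj : j * b <= j * (230 * P) by rewrite leq_mul2l; apply/orP; right; move: hb P0; clear; lia.
have jP : j <= P * j by rewrite leq_pmull.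
have h2' : k2 <= 50 + (105 * (P * j) + 60 * (j * b) + 100 * j).
  by apply: leq_trans h2 _; clear; nia.
have hj' : j * (230 * P) = 230 * (P * j) by clear; ring.
rewrite hj' in hj; move: nm mB BP P0 h1 h2' h3 h4 h5 hj jP; clear.
rewrite (mulnS P j); generalize (P * j) (j * b); clear; lia.
Qed.
End Algorithm.

(** * Balancing the two running times *)

Lemma leq_sqr_add x y : (x + y) ^ 2 <= 2 * (x ^ 2 + y ^ 2).
Proof.
rewrite sqrnD; move: (nat_Cauchy x y).1.
by generalize (x * y) (x ^ 2) (y ^ 2); clear; lia.
Qed.

Lemma up_log_le_trunc_log m : 1 < m -> up_log 2 m <= 2 * trunc_log 2 m.
Proof.
move=> m2; have t1 : 0 < trunc_log 2 m by rewrite trunc_log_gt0.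
apply: leq_trans (_ : (trunc_log 2 m).+1 <= _); last by move: t1; clear; lia.
by apply: up_log_min => //; apply: ltnW; apply: trunc_log_ltn.
Qed.

Section Time.
Variables (n : nat) (a : nat -> nat).
Hypothesis inst : instance n a.
Local Notation m := (a n).
Local Notation lg := (up_log 2 m).
Let B := (2 * m) %/ n.+1 * m + a 0.
Let J := up_log 2 B.

(** From B n <= 3 m^2, 2^J < 2B and J + 1 <= 4 lg, the time multiplied by n is at most 24 c m^2 lg.
    Squaring and dividing by n^2 > m lg leaves m^3 lg; the division is done by multiplying both
    sides with m lg. *)
Lemma fft_time c : m * lg < n * n ->
  (c * (2 ^ J * J.+1)) ^ 2 <= (24 * c) ^ 2 * (m ^ 3 * lg).
Proof.
move=> big; have nm : n < m := inst_ge inst (leqnn n).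
have n0 : 0 < n by move: big; case: (n).
have m2 : 1 < m by apply: leq_ltn_trans nm.
have lg0 : 0 < lg by rewrite up_log_gt0.
have /andP[BP PB] : B <= 2 ^ J < 2 * B := bound_exp inst.
have Bn : B * n <= 3 * (m * m).
  rewrite /B mulnDl; apply: leq_trans (_ : 2 * m * m + m * m <= _); last by clear; lia.
  apply: leq_add; last by apply: leq_mul; [apply: inst_le | apply: ltnW].
  rewrite mulnAC leq_mul2r; apply/orP; right.
  by apply: leq_trans (leq_divM _ n.+1); rewrite leq_mul2l leqnSn orbT.
have Jl : J.+1 <= 4 * lg.
  apply: leq_trans (_ : (2 * lg + 1).+1 <= _); last by move: lg0; generalize lg; clear; lia.
  rewrite ltnS; apply: up_log_min => //.
  apply: leq_trans (_ : 2 * (m * m) <= _).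
    rewrite mul2n -addnn leq_add //; last first.
      by apply: leq_trans (inst_le inst (leq0n n)) _; rewrite leq_pmulr // ltnW.
    rewrite leq_mul2r; apply/orP; right; apply: leq_trans (leq_div2l (2 * m) (isT : 0 < 2) (n0 : 1 < n.+1)) _.
    by rewrite mulKn.
  have mP : m <= 2 ^ lg := up_logP _ (ltnSn 1).
  by rewrite addn1 expnS leq_mul2l mul2n -addnn expnD leq_mul.
have key : c * (2 ^ J * J.+1) * n <= 24 * c * (m ^ 2 * lg).
  apply: leq_trans (_ : c * ((6 * (m * m)) * (4 * lg)) <= _); last first.
    by rewrite !expnS expn0 muln1 leq_eqVlt; apply/orP; left; apply/eqP; ring.
  rewrite -mulnA leq_mul2l mulnAC; apply/orP; right; apply: leq_mul => //.
  apply: leq_trans (_ : 2 * B * n <= _); first by rewrite leq_mul2r (ltnW PB) orbT.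
  by rewrite -mulnA -[6]/(2 * 3) -(mulnA 2 3) leq_mul2l.
have ml0 : 0 < m * lg by rewrite muln_gt0 lg0 (ltnW m2).
rewrite -(leq_pmul2r ml0).
apply: leq_trans (_ : (c * (2 ^ J * J.+1)) ^ 2 * (n * n) <= _).
  by rewrite leq_mul2l (ltnW big) orbT.
have -> : (24 * c) ^ 2 * (m ^ 3 * lg) * (m * lg) = (24 * c * (m ^ 2 * lg)) ^ 2.
  by rewrite !expnS !expn0; ring.
by rewrite mulnn -expnMn leq_exp2r.
Qed.

(** In this branch (n + 1)^2 <= 2 (n^2 + 1) <= 4 m lg, and a_0 <= m. *)
Lemma rr_time c : 1 < m -> n * n <= m * lg ->
  (c * (n.+1 * a 0)) ^ 2 <= (2 * c) ^ 2 * (m ^ 3 * lg).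
Proof.
move=> m2 small; have lg0 : 0 < lg by rewrite up_log_gt0.
have ml0 : 0 < m * lg by rewrite muln_gt0 lg0 (ltnW m2).
have h : n.+1 ^ 2 <= 4 * (m * lg).
  rewrite -addn1; apply: leq_trans (leq_sqr_add n 1) _.
  by rewrite -mulnn exp1n; move: small ml0; generalize (n * n) (m * lg); clear; lia.
have a0 : a 0 ^ 2 <= m ^ 2 by rewrite leq_exp2r // inst_le.
rewrite (expnMn c) (expnMn n.+1); apply: leq_trans (_ : c ^ 2 * (4 * (m * lg) * m ^ 2) <= _).
  by rewrite leq_mul2l; apply/orP; right; apply: leq_mul.
by rewrite leq_eqVlt; apply/orP; left; apply/eqP; rewrite !expnS !expn0; ring.
Qed.

Lemma init_time c : 1 < m -> (c * m) ^ 2 <= c ^ 2 * (m ^ 3 * lg).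
Proof.
move=> m2; have lg0 : 0 < lg by rewrite up_log_gt0.
rewrite expnMn leq_mul2l; apply/orP; right.
rewrite -[m ^ 2]muln1 (expnS m 2) (mulnC m) -mulnA leq_mul2l muln_gt0 lg0 (ltnW m2) orbT //.
Qed.
End Time.

Lemma time_bound c0 c1 c2 : exists C, forall n a T, instance n a -> 1 < a n ->
  let B := (2 * a n) %/ n.+1 * a n + a 0 in let J := up_log 2 B in
  T <= c0 * a n + (if a n * up_log 2 (a n) < n * n then c2 * (2 ^ J * J.+1)
                    else c1 * (n.+1 * a 0)) ->
  T ^ 2 <= C * a n ^ 3 * trunc_log 2 (a n).
Proof.
(* The estimates are made with the upper logarithm, which is at most twice the lower one as soon as
   a_n > 1. *)
suff [C h] : exists C, forall n a T, instance n a -> 1 < a n ->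
  let B := (2 * a n) %/ n.+1 * a n + a 0 in let J := up_log 2 B in
  T <= c0 * a n + (if a n * up_log 2 (a n) < n * n then c2 * (2 ^ J * J.+1)
                    else c1 * (n.+1 * a 0)) ->
  T ^ 2 <= C * (a n ^ 3 * up_log 2 (a n)).
  exists (C * 2) => n a T inst m2 B J le; apply: leq_trans (h n a T inst m2 le) _.
  have -> : C * 2 * a n ^ 3 * trunc_log 2 (a n) = C * (a n ^ 3 * (2 * trunc_log 2 (a n))) by ring.
  by apply: leq_mul => //; apply: leq_mul => //; apply: up_log_le_trunc_log.
exists (2 * (c0 ^ 2 + ((24 * c2) ^ 2 + (2 * c1) ^ 2))) => n a T inst m2 B J le.
apply: leq_trans (_ : (c0 * a n + _) ^ 2 <= _); first by rewrite leq_exp2r //; exact: le.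
apply: leq_trans (leq_sqr_add _ _) _; rewrite -mulnA leq_mul2l mulnDl leq_add //.
  exact: init_time.
rewrite mulnDl; case: ltnP => br.
  by apply: leq_trans (leq_addr _ _); apply: fft_time.
by apply: leq_trans (leq_addl _ _); apply: rr_time.
Qed.

(** * The main program *)

Definition read_input := seqs
  [:: Asn 0 (Get 0 (Cst 0)); Asn 1 (Get 0 (eadd (Var 0) (Cst 1))); Asn 2 (Get 0 (Cst 1));
      Asn 80 (eadd (Var 1) (Cst 2)); Asn 60 (Var 1); Skip].
(** Repeated squaring, with 76 = 64 + 8 + 4. The value M^4 in register 21 is also the INF of
    [round_robin], large enough by [bound_le]. *)
Definition powers := seqs
  [:: Asn 81 (emul (Var 80) (Var 80)); Asn 21 (emul (Var 81) (Var 81));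
      Asn 83 (emul (Var 21) (Var 21)); Asn 68 (emul (Var 83) (Var 83));
      Asn 84 (emul (Var 68) (Var 68)); Asn 85 (emul (Var 84) (Var 84));
      Asn 50 (emul (emul (Var 85) (Var 83)) (Var 21)); Asn 52 (emul (Var 50) (Var 21));
      Asn 51 (emul (Var 50) (Var 52)); Skip].
Definition main_of ci cp cl cf cr := seqs
  [:: ci; cp; cl; Asn 3 (Var 61); Ite (emul (Var 3) (Var 1)) (emul (Var 0) (Var 0)) cf cr].
Definition main := main_of read_input powers clog fft_alg round_robin.

Lemma var_setv s x v : var (setv s x v) x = v.
Proof. by rewrite /= /upd eqxx. Qed.

Lemma sem_asn V Bg x e c s v : eval V Bg e s = v ->
  sem V Bg (Seq (Asn x e) c) s = sem V Bg c (setv s x v).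
Proof. by move=> <-. Qed.

Lemma main_ofE V Bg ci cp cl cf cr s :
  let t2 := sem V Bg cl (sem V Bg cp (sem V Bg ci s)) in let t3 := setv t2 3 (var t2 61) in
  forall b, (eval V Bg (emul (Var 3) (Var 1)) t3 < eval V Bg (emul (Var 0) (Var 0)) t3) = b ->
  sem V Bg (main_of ci cp cl cf cr) s = sem V Bg (if b then cf else cr) t3 /\
  cost V Bg (main_of ci cp cl cf cr) s <= 15 + (cost V Bg ci s + (cost V Bg cp (sem V Bg ci s) +
    (cost V Bg cl (sem V Bg cp (sem V Bg ci s)) + cost V Bg (if b then cf else cr) t3))).
Proof.
move=> t2 t3 b bE; rewrite /main_of /seqs !sem_seq !cost_seq cost_asn -/t2.
have -> : sem V Bg (Asn 3 (Var 61)) t2 = t3 by [].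
have iteE u v (c1 c2 : cmd) : sem V Bg (Ite u v c1 c2) t3 =
    sem V Bg (if eval V Bg u t3 < eval V Bg v t3 then c1 else c2) t3 by rewrite /=; case: ifP.
have costE u v (c1 c2 : cmd) : cost V Bg (Ite u v c1 c2) t3 <= ecost u + ecost v + 2 +
    cost V Bg (if eval V Bg u t3 < eval V Bg v t3 then c1 else c2) t3.
  by rewrite /= -(addnA _ 2 _) leq_add2l; case: ifP => _; rewrite leq_add2r.
rewrite iteE bE; split=> //; have := costE (emul (Var 3) (Var 1)) (emul (Var 0) (Var 0)) cf cr.
rewrite bE; generalize (cost V Bg (Ite (emul (Var 3) (Var 1)) (emul (Var 0) (Var 0)) cf cr) t3).
generalize (cost V Bg ci s) (cost V Bg cp (sem V Bg ci s))
  (cost V Bg cl (sem V Bg cp (sem V Bg ci s))) (cost V Bg (if b then cf else cr) t3).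
by clear; move=> k1 k2 k3 k4 k5; rewrite /=; lia.
Qed.

Section Machine.
Variables (V Bg M n : nat) (a : nat -> nat).
Local Notation sem := (sem V Bg).
Local Notation cost := (cost V Bg).
Hypotheses (inst : instance n a) (ME : M = (a n).+2) (BgE : Bg = M ^ 6) (VE : V = M ^ 160).

Let M3 : 3 <= M. Proof. by rewrite ME; apply: M3. Qed.
Let ltV i : i < 160 -> M ^ i < V.
Proof. by move=> lt; rewrite VE ltn_exp2l // (leq_trans _ M3). Qed.
Let mulV i j : i + j < 160 -> (M ^ i * M ^ j) %% V = M ^ (i + j).
Proof. by move=> lt; rewrite -expnD modn_small // ltV. Qed.
Let BgV : Bg < V. Proof. by rewrite BgE ltV. Qed.
Let MB : M <= Bg. Proof. by rewrite BgE -{1}[M]expn1 leq_pexp2l // (leq_trans _ M3). Qed.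

Lemma read_inputP s : arr s 0 0 = n -> (forall i, i <= n -> arr s 0 i.+1 = a i) ->
  let t := sem read_input s in
  [/\ var t 0 = n, var t 1 = a n, var t 2 = a 0, var t 80 = M & var t 60 = a n].
Proof.
move=> s0 sa t; have nm : n < a n := inst_ge inst (leqnn n).
have nB : n.+1 < Bg by apply: leq_trans MB; rewrite ME ltnS ltnS ltnW.
have MV : M < V := leq_ltn_trans MB BgV.
have tE : t = setv (setv (setv (setv (setv s 0 n) 1 (a n)) 2 (a 0)) 80 M) 60 (a n).
  rewrite /t /read_input /seqs.
  rewrite (@sem_asn V Bg 0 _ _ _ n); last by rewrite /= mod0n s0.
  rewrite (@sem_asn V Bg 1 _ _ _ (a n)); last first.
    by rewrite /= /upd /= addn1 (modn_small (ltn_trans nB BgV)) (modn_small nB) sa.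
  rewrite (@sem_asn V Bg 2 _ _ _ (a 0)); last first.
    by rewrite /= (modn_small (leq_ltn_trans (isT : 1 <= n.+1) nB)) sa.
  rewrite (@sem_asn V Bg 80 _ _ _ M); last first.
    by rewrite /= /upd /= addn2 -ME modn_small.
  by rewrite (@sem_asn V Bg 60 _ _ _ (a n)).
by rewrite tE.
Qed.

Lemma powersP t : var t 80 = M -> let t' := sem powers t in
  [/\ var t' 21 = M ^ 4, var t' 68 = M ^ 16, var t' 50 = M ^ 76, var t' 52 = M ^ 80
    & var t' 51 = M ^ 76 * M ^ 80].
Proof.
move=> t80 t'.
have tE : t' = setv (setv (setv (setv (setv (setv (setv (setv (setv t 81 (M ^ 2)) 21 (M ^ 4))
   83 (M ^ 8)) 68 (M ^ 16)) 84 (M ^ 32)) 85 (M ^ 64)) 50 (M ^ 76)) 52 (M ^ 80)) 51 (M ^ 156).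
  rewrite /t' /powers /seqs.
  rewrite (@sem_asn V Bg 81 _ _ _ (M ^ 2)); last by rewrite /= t80 (@mulV 1 1).
  rewrite (@sem_asn V Bg 21 _ _ _ (M ^ 4)); last by rewrite /= /upd /= (@mulV 2 2).
  rewrite (@sem_asn V Bg 83 _ _ _ (M ^ 8)); last by rewrite /= /upd /= (@mulV 4 4).
  rewrite (@sem_asn V Bg 68 _ _ _ (M ^ 16)); last by rewrite /= /upd /= (@mulV 8 8).
  rewrite (@sem_asn V Bg 84 _ _ _ (M ^ 32)); last by rewrite /= /upd /= (@mulV 16 16).
  rewrite (@sem_asn V Bg 85 _ _ _ (M ^ 64)); last by rewrite /= /upd /= (@mulV 32 32).
  rewrite (@sem_asn V Bg 50 _ _ _ (M ^ 76)); last first.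
    by rewrite /= /upd /= (@mulV 64 8) // (@mulV 72 4).
  rewrite (@sem_asn V Bg 52 _ _ _ (M ^ 80)); last by rewrite /= /upd /= (@mulV 76 4).
  by rewrite (@sem_asn V Bg 51 _ _ _ (M ^ 156)) //= /upd /= (@mulV 76 80).
by rewrite tE; split; rewrite //= /upd /= -expnD.
Qed.

Lemma mainP : let s := init_store Bg n a in let m := a n in
  let B := (2 * m) %/ n.+1 * m + a 0 in let J := up_log 2 B in
  (forall i, i < a 0 -> is_target n a i (arr (sem main s) 7 i)) /\
  cost main s <= 200 + 30 * m + (if m * up_log 2 m < n * n then 4500 * (5 * (2 ^ J * J.+1))
                                 else 1000 * (n.+1 * a 0)).
Proof.
move=> s m B J.
have nm : n < m := inst_ge inst (leqnn n).
have mM : m < M by rewrite ME.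
have M2 : 1 < M by apply: leq_trans M3.
have MV : M < V := leq_ltn_trans MB BgV.
have constM c k : c <= 3 ^ k -> c <= M ^ k by rewrite ME; apply: constM.
have mm k : 3 * m * m <= M ^ (3 + k).
  apply: leq_trans (_ : M ^ 3 <= _); last by rewrite leq_pexp2l // ltnW.
  by rewrite !expnS expn0 muln1 mulnA !leq_mul // ltnW.
have lm : up_log 2 m <= m by apply: up_log_min => //; apply: ltnW; apply: ltn_expl.
have s00 : arr s 0 0 = n by [].
have s0 i : i <= n -> arr s 0 i.+1 = a i by move=> le; rewrite /= /init_state /= ltnS le.
have sk k r : 0 < k -> arr s k r = 0.
  case: k => // k _; rewrite /s /init_store /= mulSn.
  have : n.+1 < Bg + k * Bg + r.
    rewrite -addnA; apply: leq_trans (leq_addr _ _); apply: leq_trans MB; rewrite ME.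
    by rewrite !ltnS ltnW.
  by case: (Bg + k * Bg + r) => //= u lt; rewrite leqNgt lt.
pose t0 := sem read_input s. pose t1 := sem powers t0. pose t2 := sem clog t1.
pose t3 := setv t2 3 (var t2 61).
have F c t y : y \notin wv c -> var (sem c t) y = var t y by move/(proj1 (agree_sem V Bg c t)).
have G c t k : k \notin wa c -> arr (sem c t) k = arr t k by move/(proj2 (agree_sem V Bg c t)).
have [r0 r1 r2 r80 r60] := read_inputP s00 s0; rewrite -/t0 in r0 r1 r2 r80 r60.
have [p21 p68 p50 p52 p51] := powersP r80; rewrite -/t1 in p21 p68 p50 p52 p51.
have f1 y : y \notin wv powers -> var t1 y = var t0 y by apply: F.
have f2 y : y \notin wv clog -> var t2 y = var t1 y by apply: F.
have f3 y : y != 3 -> var t3 y = var t2 y by rewrite /= /upd => /negPf->.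
have g0 k : arr t0 k = arr s k := G read_input s k isT.
have g1 k : arr t1 k = arr t0 k := G powers t0 k isT.
have g2 k : arr t2 k = arr t1 k := G clog t1 k isT.
have g3 k : arr t3 k = arr t2 k by [].
have mE := @main_ofE V Bg read_input powers clog fft_alg round_robin s.
cbv zeta in mE; rewrite -/t0 -/t1 -/t2 -/t3 in mE.
have cst0 : cost read_input s <= 40 by apply: leq_trans (flat_costP _ _ _ _) _.
have cst1 : cost powers t0 <= 80 by apply: leq_trans (flat_costP _ _ _ _) _.
have cl := @clogP V Bg t1; rewrite -/t2 in cl.
have t33 : var t3 3 = var t2 61 := var_setv t2 3 (var t2 61).
rewrite /main; clearbody t3 t2 t1 t0.
have a3 k : arr t3 k = arr s k by rewrite g3 g2 g1 g0.
have m2V : 2 * m < V.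
  apply: leq_ltn_trans (_ : M ^ 4 < _); last exact: ltV.
  apply: leq_trans (mm 1); rewrite leq_mul // -[X in X <= _]muln1 leq_mul // (leq_ltn_trans _ nm) //.
have e60 : var t1 60 = m by rewrite f1.
have [l61 cst2] : var t2 61 = up_log 2 m /\ cost clog t1 <= 30 * m.+1.
  by move: cl; rewrite e60 => /(_ m2V).
have v0 : var t3 0 = n by rewrite f3 // f2 // f1.
have v1 : var t3 1 = m by rewrite f3 // f2 // f1.
have v2 : var t3 2 = a 0 by rewrite f3 // f2 // f1.
have v3 : var t3 3 = up_log 2 m by rewrite t33.
have mmV : 3 * m * m < V by apply: leq_ltn_trans (mm 0) _; apply: ltV.
have m2mV : 2 * m * m < V by apply: leq_ltn_trans mmV; rewrite -!mulnA leq_mul2r orbT.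
have lmV : up_log 2 m * m < V.
  by apply: leq_ltn_trans m2mV; rewrite leq_mul2r (leq_trans lm) ?leq_pmull // orbT.
have nnV : n * n < V.
  by apply: leq_ltn_trans m2mV; rewrite -mulnA; apply: leq_trans (leq_pmull _ _) => //; rewrite leq_mul // ltnW.
have bE : (eval V Bg (emul (Var 3) (Var 1)) t3 < eval V Bg (emul (Var 0) (Var 0)) t3) =
    (m * up_log 2 m < n * n).
  by rewrite [LHS]/= v0 v1 v3 (modn_small lmV) (modn_small nnV) mulnC.
have [sE cE] := mE _ bE.
rewrite sE.
suff [h cst] : (forall i, i < a 0 -> is_target n a i
   (arr (sem (if m * up_log 2 m < n * n then fft_alg else round_robin) t3) 7 i)) /\
   cost (if m * up_log 2 m < n * n then fft_alg else round_robin) t3 <=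
   (if m * up_log 2 m < n * n then 4500 * (5 * (2 ^ J * J.+1)) else 1000 * (n.+1 * a 0)).
  split; first exact: h.
  apply: leq_trans cE _; move: cst0 cst1 cst2 cst.
  generalize (cost read_input s) (cost powers t0) (cost clog t1)
    (cost (if m * up_log 2 m < n * n then fft_alg else round_robin) t3).
  generalize (if m * up_log 2 m < n * n then 4500 * (5 * (2 ^ J * J.+1)) else 1000 * (n.+1 * a 0)).
  clear; lia.
have mB : m.+2 <= Bg by rewrite -ME.
case: ifP => _.
  have pN := params_N inst. have pD := params_D inst. have pE := params_EQ inst.
  have pZ := params_ZE inst. have pR := params_ZR inst. have pQ := params_QR inst.
  have p97 := params_Q inst. have pV := params_V n a. have pn := params_nb n a.
  rewrite -!ME in pN pD pE pZ pR pQ p97 pV pn; rewrite -BgE in pN; rewrite -VE in pV.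
  have nbV : 76 * (up_log 2 m + 2) + 2 < V.
    apply: leq_ltn_trans (_ : M ^ 5 * M < _); last by rewrite -expnSr ltV.
    apply: leq_trans (_ : 200 * M <= _); last by rewrite leq_mul // constM.
    by move: lm mM nm; generalize (up_log 2 m); clear; lia.
  have ct : consts (M ^ 76) (M ^ 80) t3 by split; rewrite f3 // f2.
  have v68 : var t3 68 = M ^ 16 by rewrite f3 // f2.
  apply: (fft_algP inst p97 pV BgV mB pN pD pE pZ pR pQ pn m2mV nbV ct v0 v1 v2 v3 v68).
    by move=> i le; rewrite a3 s0.
  by move=> i; rewrite a3 sk.
have v21 : var t3 21 = M ^ 4 by rewrite f3 // f2.
have iV : M ^ 4 + m < V.
  apply: leq_ltn_trans (_ : M ^ 4 * M < _); last by rewrite -expnSr ltV.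
  apply: leq_trans (_ : M ^ 4 + M ^ 4 * 2 <= _); last by rewrite -{1}[M ^ 4]muln1 -mulnDr leq_mul // M3.
  rewrite leq_add2l; apply: leq_trans (ltnW mM) _; apply: leq_trans (leq_pmulr _ _) => //.
  by rewrite -{1}[M]expn1 leq_pexp2l // ltnW.
have iB : B <= M ^ 4.
  by apply: leq_trans (leq_trans (leq_pmull B _) (bound_le inst)) _; rewrite // -ME.
apply: (round_robinP inst mB (ltnW BgV) mmV iV iB v0 v2 v21).
  by move=> i le; rewrite a3 s0.
by move=> i; rewrite a3 sk.
Qed.
End Machine.

(** Checked by computation at 160, since [2 ^ 160] is out of reach in unary numerals; [leq_exp160]
    makes the connection. *)
Lemma main_wf V : 160 <= V -> cwf V 8 main.
Proof. by move=> le; apply: (cwf_mono le); vm_compute. Qed.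

Lemma leq_exp160 : 160 <= 2 ^ 160.
Proof. exact: ltnW (ltn_expl 160 (ltnSn 1)). Qed.

(* AllTargets is solvable on a word RAM with words of O(log a_n) bits in time
   O(a_n^{3/2} log^{1/2} a_n): the squared step count is O(a_n^3 log a_n). *)
Theorem theorem7 :
  exists (P : seq instr) (c C N : nat),
    forall (n : nat) (a : nat -> nat), instance n a ->
      exists (T : nat) (s : state),
        [/\ exec ((a n).+2 ^ c) P T (init_state n a) = Some s,
            solves_AllTargets n a s
          & N <= a n -> T ^ 2 <= C * (a n) ^ 3 * trunc_log 2 (a n)].
Proof.
have [C hC] := time_bound 500 1000 (4500 * 5).
(* V and Bg are the 160th and 6th powers of a_n + 2, words are twice as long as V, and the output is
   array 7. The time bound starts at a_n = 2 because the logarithm of 1 is 0. *)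
exists (program 160 6 7 main), (2 * 160), C, 2 => n a inst.
have K8 := leq_trans (isT : 8 <= 160) leq_exp160.
have [T [s [ex TE out]]] := program_correct inst (main_wf leq_exp160) K8 (isT : 7 < 8) (isT : 6 < 160) (isT : 1 < 160).
have [h cst] := mainP inst erefl erefl erefl.
exists T, s; split; first exact: ex.
  move=> i lti; rewrite out; first exact: h.
  apply: leq_trans lti _; apply: leq_trans (inst_le inst (leq0n n)) _.
  apply: leq_trans (_ : (a n).+2 ^ 1 <= _); first by rewrite expn1 ltnW.
  by rewrite leq_pexp2l.
move=> m2; apply: hC => //; rewrite TE -mulnA.
move: cst; generalize (cost ((a n).+2 ^ 160) ((a n).+2 ^ 6) main
  (init_store ((a n).+2 ^ 6) n a)) => k cst.
apply: leq_trans (leq_add cst (leqnn _)) _; rewrite addnAC leq_add2r.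
by move: m2; clear; lia.
Qed.
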